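(* Let $A(\lambda)$, $B(\lambda)$ be the autoregressive and moving average polynomials of the context, let $F(\lambda)=A(\lambda)^{-1}B(\lambda)$ be irreducible, and let $R_1,\ldots,R_p\in\mathbb{C}^{d\times d}$ be a complete set of regular right solvents of $A(\lambda)$. Suppose $\mathbb{E}\|L(1)\|^2<\infty$ and $\mathbb{E}L(1)=0_m$. Let $Y(t)=\sum_{k=1}^pY_k(t)$, $t\ge0$, be the MCARMA$(p,q)$ process given by $$Y_k(t)=e^{R_kt}Y_k(0)+\int_0^te^{R_k(t-u)}\,\mathrm{Res}[F,R_k]\,\mathrm{d}L(u),\qquad t\ge0,\ k=1,\ldots,p,$$ with initial conditions $Y_k(0)$ in $\mathbb{C}^d$ such that $V(R_1,\ldots,R_p)[Y_1(0)^\top,\ldots,Y_p(0)^\top]^\top\in\mathbb{R}^{pd}$. Fix $h>0$ and write $Y_n^{(h)}:=Y(nh)$. Define $\Psi_0:=I_d$, $$[\Psi_p,\ldots,\Psi_1]:=-[e^{-phR_1},\ldots,e^{-phR_p}]\,V^{-1}(e^{-hR_1},\ldots,e^{-hR_p})\in\mathbb{C}^{d\times pd},$$ and the matrix polynomial $\Phi(\lambda):=I_d-\Phi_1\lambda-\ldots-\Phi_p\lambda^p$ with $\Phi_j:=-\Psi_p^{-1}\Psi_{p-j}$ for $j=1,\ldots,p$. Then there exists a matrix polynomial $\Theta(\lambda)=I_d+\Theta_1\lambda+\ldots+\Theta_{p-1}\lambda^{p-1}$ with coefficients in $\mathbb{C}^{d\times d}$ such that $$\Phi(\mathsf{B})Y_n^{(h)}=\Theta(\mathsf{B})\varepsilon_n^{(h)},\qquad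 n\ge p,$$ where $\mathsf{B}$ denotes the backshift operator ($\mathsf{B}^jY_n^{(h)}=Y_{n-j}^{(h)}$ for $j\in\mathbb{N}$) and $(\varepsilon_n^{(h)})_{n\ge1}$ is a $d$-dimensional weak white noise. Thus $(Y_n^{(h)})_{n\ge p}$ admits a weak VARMA$(p,p-1)$ representation.
   Context: Let $d,m\ge 1$ be integers and $p>q$ positive integers. $L=(L(t))_{t\in\mathbb{R}}$ is a two-sided $\mathbb{R}^m$-valued Lévy process: $L(0)=0_m$ a.s., stationary and independent increments, càdlàg paths. Let $$A(\lambda)=I_d\lambda^p+A_1\lambda^{p-1}+\ldots+A_p,\qquad B(\lambda)=B_0\lambda^q+\ldots+B_{q-1}\lambda+B_q,$$ with $A_1,\ldots,A_p\in\mathbb{R}^{d\times d}$, $B_0,\ldots,B_q\in\mathbb{R}^{d\times m}$. Solvents: $\sigma(A(\cdot))=\{\lambda\in\mathbb{C}:\det A(\lambda)=0\}$, and $\sigma(R)$ is the set of eigenvalues of a matrix $R$. A matrix $R\in\mathbb{C}^{d\times d}$ is a right solvent of $A(\lambda)$ if $R^p+A_1R^{p-1}+\ldots+A_{p-1}R+A_p=0_{d\times d}$. It is regular if $\sigma(R)\cap\sigma(A^{(1)}(\cdot))=\emptyset$, where $A^{(1)}(\lambda)$ is the monic matrix polynomial of degree $p-1$ with $A(\lambda)=A^{(1)}(\lambda)(\lambda I_d-R)$. A set of right solvents $R_1,\ldots,R_p$ is complete if $\sigma(A(\cdot))=\bigcup_{k=1}^p\sigma(R_k)$. $F(\lambda)=A(\lambda)^{-1}B(\lambda)$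 is irreducible if $A(\lambda)$ and $B(\lambda)$ are left coprime. For a regular right solvent $R$, the residue is $\mathrm{Res}[F,R]=\frac{1}{2\pi i}\oint_{\Gamma_R}F(\lambda)\,\mathrm{d}\lambda\in\mathbb{C}^{d\times m}$, where $\Gamma_R$ is a simple closed (positively oriented) contour with $\sigma(R)$ in its interior and $\sigma(A(\cdot))\setminus\sigma(R)$ in its exterior. For $S_1,\ldots,S_p\in\mathbb{C}^{d\times d}$, $V(S_1,\ldots,S_p)\in\mathbb{C}^{pd\times pd}$ is the block Vandermonde matrix whose $(i,k)$ block is $S_k^{i-1}$, $i,k=1,\ldots,p$, and $V^{-1}(S_1,\ldots,S_p)$ is its inverse. A $d$-dimensional weak white noise is a ($\mathbb{C}^d$-valued) sequence of square integrable, mean zero, pairwise uncorrelated random vectors with a common covariance matrix; covariances are $\mathrm{Cov}(U,W)=\mathbb{E}[(U-\mathbb{E}U)(W-\mathbb{E}W)^{\mathsf H}]$, with $\mathsf H$ the complex conjugate transpose.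
   Formalization: The block Vandermonde matrix V(e^{-hR_1},…,e^{-hR_p}) is assumed invertible, so that its inverse in the definition of the Ψ_j exists; this can fail, e.g. d=1, p=2, R=±iw, h=π/w. *)

(* Defs.v *)
From HB Require Import structures.
From mathcomp Require Import all_boot all_order all_algebra.
From mathcomp Require Import all_classical all_reals all_analysis.
From mathcomp Require Import complex.

Set Implicit Arguments.
Unset Strict Implicit.
Unset Printing Implicit Defensive.

Import Order.TTheory GRing.Theory Num.Theory.
Import numFieldNormedType.Exports.

Local Open Scope classical_set_scope.
Local Open Scope ring_scope.
Local Open Scope complex_scope.

Definition toC (R : realType) (a b : nat) (M : 'M[R]_(a, b)) : 'M[R[i]]_(a, b) :=
  map_mx (fun x : R => x%:C) M.

Definition adjmx (R : realType) (a b : nat) (M : 'M[R[i]]_(a, b)) :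
    'M[R[i]]_(b, a) :=
  \matrix_(i, j) ((M j i)^*)%C.

Definition clim (R : realType) (u : nat -> R[i]) : R[i] :=
  limn (fun n => complex.Re (u n)) +i* limn (fun n => complex.Im (u n)).

Definition expm (R : realType) (d : nat) (M : 'M[R[i]]_d) : 'M[R[i]]_d :=
  \matrix_(i, j)
    clim (fun n => \sum_(0 <= k < n) (k`!%:R)^-1 * (M ^+ k : 'M[R[i]]_d) i j).

Definition vandermonde (R : realType) (d p : nat) (S : 'I_p -> 'M[R[i]]_d) :
    'M[R[i]]_(\sum_(i < p) d) :=
  \mxblock_(i < p, k < p) (S k ^+ i : 'M[R[i]]_d).

(* c_0 X^n + c_1 X^(n-1) + ... + c_n; only c_0, ..., c_n are used *)
Definition mxpolynomial (R : realType) (a b n : nat) (c : nat -> 'M[R[i]]_(a, b)) :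
    'M[{poly R[i]}]_(a, b) :=
  \sum_(j < n.+1) 'X^(n - j) *: map_mx polyC (c j).

Definition monic_mxpolynomial (R : realType) (d n : nat) (c : nat -> 'M[R[i]]_d) :
    'M[{poly R[i]}]_d :=
  mxpolynomial n (fun j => if j == 0%N then 1%:M else c j).

Definition mxeval (R : realType) (a b : nat) (M : 'M[{poly R[i]}]_(a, b)) (z : R[i]) :
    'M[R[i]]_(a, b) :=
  \matrix_(i, j) (M i j).[z].

Definition ar_poly (R : realType) (d p : nat) (A : nat -> 'M[R]_d) :
    'M[{poly R[i]}]_d :=
  monic_mxpolynomial p (fun j => toC (A j)).

Definition ma_poly (R : realType) (d m q : nat) (B : nat -> 'M[R]_(d, m)) :
    'M[{poly R[i]}]_(d, m) :=
  mxpolynomial q (fun j => toC (B j)).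

Definition spectrum_poly (R : realType) (d : nat) (A : 'M[{poly R[i]}]_d) : set R[i] :=
  [set z | \det (mxeval A z) = 0].

Definition spectrum (R : realType) (d : nat) (S : 'M[R[i]]_d) : set R[i] :=
  [set z | eigenvalue S z].

Definition left_coprime (R : realType) (d m : nat)
    (A : 'M[{poly R[i]}]_d) (B : 'M[{poly R[i]}]_(d, m)) : Prop :=
  forall (D A' : 'M[{poly R[i]}]_d) (B' : 'M[{poly R[i]}]_(d, m)),
    A = D *m A' -> B = D *m B' -> D \in unitmx.

Definition right_solvent (R : realType) (d p : nat) (A : nat -> 'M[R]_d)
    (S : 'M[R[i]]_d) : Prop :=
  S ^+ p + \sum_(1 <= j < p.+1) toC (A j) *m (S ^+ (p - j)) = 0.

Definition regular_right_solvent (R : realType) (d p : nat) (A : nat -> 'M[R]_d)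
    (S : 'M[R[i]]_d) : Prop :=
  right_solvent p A S /\
  exists c : nat -> 'M[R[i]]_d,
    let A1 := monic_mxpolynomial p.-1 c in
    ar_poly p A = A1 *m ('X%:M - map_mx polyC S) /\
    spectrum S `&` spectrum_poly A1 = set0.

Definition complete_solvents (R : realType) (d p : nat) (A : nat -> 'M[R]_d)
    (S : 'I_p -> 'M[R[i]]_d) : Prop :=
  spectrum_poly (ar_poly p A) = \bigcup_(k in [set: 'I_p]) spectrum (S k).

Section Contours.
Variable R : realType.

Definition C1_curve (g : R -> R[i]) : Prop :=
  [/\ forall t, derivable (fun s => complex.Re (g s)) t 1,
      forall t, derivable (fun s => complex.Im (g s)) t 1,
      continuous (derive1 (fun s => complex.Re (g s))) &
      continuous (derive1 (fun s => complex.Im (g s)))].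

(* The parameter interval is [0, 1]; [0 :: s] lists the break points.  Two
   neighbouring pieces agree at their common end point, so that the curve is
   continuous on [0, 1]. *)
Definition piecewise_C1 (g : R -> R[i]) : Prop :=
  exists2 s : seq R, itv_partition 0 1 s &
    forall i, (i < size s)%N ->
      exists2 g' : R -> R[i], C1_curve g' &
        {in `[nth 0 (0 :: s) i, nth 0 s i], g =1 g'}.

Definition simple_closed_contour (g : R -> R[i]) : Prop :=
  [/\ piecewise_C1 g, g 0 = g 1 & {in `[0, 1[ &, injective g}].

Definition trace (g : R -> R[i]) : set R[i]^o := [set g t | t in `[0, 1]].

Definition contour_interior (g : R -> R[i]) : set R[i]^o :=
  [set z | ~ trace g z /\ bounded_set (connected_component (~` trace g) z)].

Definition contour_exterior (g : R -> R[i]) : set R[i]^o :=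
  [set z | ~ trace g z /\ ~ bounded_set (connected_component (~` trace g) z)].

Definition curve_derive (g : R -> R[i]) (t : R) : R[i] :=
  derive1 (fun s => complex.Re (g s)) t +i*
  derive1 (fun s => complex.Im (g s)) t.

(* [curve_derive g] is meaningless at the finitely many break points, which
   do not contribute to the integral. *)
Definition contour_integral (g : R -> R[i]) (f : R[i] -> R[i]) : R[i] :=
  let F t := f (g t) * curve_derive g t in
  Rintegral lebesgue_measure `[0, 1] (fun t => complex.Re (F t)) +i*
  Rintegral lebesgue_measure `[0, 1] (fun t => complex.Im (F t)).

Definition two_pi_i : R[i] := 0 +i* (2 * pi).

Definition winding_number (g : R -> R[i]) (z : R[i]) : R[i] :=
  two_pi_i^-1 * contour_integral g (fun x => (x - z)^-1).

Definition positively_oriented (g : R -> R[i]) : Prop :=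
  forall z, contour_interior g z -> winding_number g z = 1.

Definition residue_contour (d : nat) (A : 'M[{poly R[i]}]_d) (S : 'M[R[i]]_d)
    (g : R -> R[i]) : Prop :=
  [/\ simple_closed_contour g, positively_oriented g,
      spectrum S `<=` contour_interior g &
      spectrum_poly A `\` spectrum S `<=` contour_exterior g].

(* Res[A^-1 B, S]: the value does not depend on the contour; [xget] selects it
   (with default 0). *)
Definition residue (d m : nat) (A : 'M[{poly R[i]}]_d) (B : 'M[{poly R[i]}]_(d, m))
    (S : 'M[R[i]]_d) : 'M[R[i]]_(d, m) :=
  xget 0 [set M | exists2 g, residue_contour A S g &
    M = \matrix_(i, j) (two_pi_i^-1 *
          contour_integral g (fun z => (invmx (mxeval A z) *m mxeval B z) i j))].

End Contours.

Section Probability.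
Context (disp : measure_display) (T : measurableType disp) (R : realType).
Variable P : probability T R.

Definition cvec_normsq (d : nat) (v : 'cV[R[i]]_d) : R :=
  \sum_(i < d) (complex.Re (v i 0) ^+ 2 + complex.Im (v i 0) ^+ 2).

Definition crandom_vector (d : nat) (X : T -> 'cV[R[i]]_d) : Prop :=
  forall i, measurable_fun setT (fun w => complex.Re (X w i 0)) /\
            measurable_fun setT (fun w => complex.Im (X w i 0)).

Definition cexpectation (X : T -> R[i]) : R[i] :=
  fine 'E_P[fun w => complex.Re (X w)] +i* fine 'E_P[fun w => complex.Im (X w)].

Definition mexpectation (a b : nat) (X : T -> 'M[R[i]]_(a, b)) : 'M[R[i]]_(a, b) :=
  \matrix_(i, j) cexpectation (fun w => X w i j).

Definition square_integrable (d : nat) (X : T -> 'cV[R[i]]_d) : Prop :=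
  ('E_P[fun w => cvec_normsq (X w)] < +oo)%E.

Definition ccovariance (d : nat) (U W : T -> 'cV[R[i]]_d) : 'M[R[i]]_d :=
  mexpectation (fun w =>
    (U w - mexpectation U) *m adjmx (W w - mexpectation W)).

(* the index set is {1, 2, ...}: the value [e 0] is irrelevant *)
Definition weak_white_noise (d : nat) (e : nat -> T -> 'cV[R[i]]_d) : Prop :=
  [/\ forall n, (1 <= n)%N ->
        [/\ crandom_vector (e n), square_integrable (e n) & mexpectation (e n) = 0],
      forall n k, (1 <= n)%N -> (1 <= k)%N -> n != k -> ccovariance (e n) (e k) = 0 &
      exists Sigma : 'M[R[i]]_d,
        forall n, (1 <= n)%N -> ccovariance (e n) (e n) = Sigma].

Definition borel_cV (m : nat) : set (set 'cV[R]_m) :=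
  <<s [set C | exists (i : 'I_m) (A : set R),
         measurable A /\ C = [set v : 'cV[R]_m | A (v i 0)]] >>.

Record levy_process (m : nat) (L : R -> T -> 'cV[R]_m) : Prop := LevyProcess {
  levy_measurable : forall t i, measurable_fun setT (fun w => L t w i 0) ;
  levy0 : {ae P, forall w, L 0 w = 0} ;
  levy_stationary : forall s t h : R, s <= t -> forall B, borel_cV B ->
    P [set w | B (L (t + h) w - L (s + h) w)] = P [set w | B (L t w - L s w)] ;
  levy_independent : forall (n : nat) (t : nat -> R),
    (forall i, (i < n)%N -> t i <= t i.+1) ->
    forall B : nat -> set 'cV[R]_m, (forall i, borel_cV (B i)) ->
    (P (\bigcap_(i in [set k | (k < n)%N])
          [set w | B i (L (t i.+1) w - L (t i) w)%R]) =
     \prod_(i < n) P [set w | B i (L (t i.+1) w - L (t i) w)%R])%E ;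
  levy_cadlag : {ae P, forall w, forall (t : R) (i : 'I_m),
    ((fun s => L s w i 0) @ t^'+ --> L t w i 0) /\
    cvg ((fun s => L s w i 0) @ t^'-)} }.

Definition left_sum (d m : nat) (L : R -> T -> 'cV[R]_m)
    (f : R -> 'M[R[i]]_(d, m)) (a : R) (s : seq R) (w : T) : 'cV[R[i]]_d :=
  \sum_(i < size s)
    f (nth 0 (a :: s) i) *m toC (L (nth 0 s i) w - L (nth 0 (a :: s) i) w).

(* For a deterministic continuous integrand the stochastic integral of f over
   [a, b] is the limit in probability, as the mesh tends to 0, of the left
   point sums; [is_stoch_integral] characterizes it up to a.s. equality. *)
Definition is_stoch_integral (d m : nat) (L : R -> T -> 'cV[R]_m)
    (f : R -> 'M[R[i]]_(d, m)) (a b : R) (J : T -> 'cV[R[i]]_d) : Prop :=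
  crandom_vector J /\
  forall eps : R, 0 < eps -> exists2 delta : R, 0 < delta &
    forall s : seq R, itv_partition a b s ->
      (forall i, (i < size s)%N -> nth 0 s i - nth 0 (a :: s) i < delta) ->
      (P [set w | (eps <= Num.sqrt (cvec_normsq (left_sum L f a s w - J w)))%R]
         <= eps%:E)%E.

Definition mcarma_component (d m : nat) (L : R -> T -> 'cV[R]_m)
    (S : 'M[R[i]]_d) (C : 'M[R[i]]_(d, m)) (Y : R -> T -> 'cV[R[i]]_d) : Prop :=
  forall t : R, 0 <= t ->
    crandom_vector (Y t) /\
    exists2 J : T -> 'cV[R[i]]_d,
      is_stoch_integral L (fun u => expm ((t - u)%:C *: S) *m C) 0 t J &
      {ae P, forall w, Y t w = expm (t%:C *: S) *m Y 0 w + J w}.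

End Probability.

Section Sampling.
Variables (R : realType) (d p : nat) (S : 'I_p -> 'M[R[i]]_d) (h : R).

Definition sampled_vandermonde : 'M[R[i]]_(\sum_(i < p) d) :=
  vandermonde (fun k => expm ((- h)%:C *: S k)).

(* the block row [Psi_p, ..., Psi_1] *)
Definition Psi_row : 'M[R[i]]_(d, \sum_(i < p) d) :=
  - ((\mxrow_(k < p) expm ((- (p%:R * h))%:C *: S k)) *m
     invmx sampled_vandermonde).

(* Psi_0 = I, and Psi_j is block number p - j (counted from 0) of [Psi_row]
   for 1 <= j <= p *)
Definition Psi (j : nat) : 'M[R[i]]_d :=
  if j == 0%N then 1%:M
  else if insub (p - j)%N is Some i then submxrow Psi_row i else 0.

Definition Phi (j : nat) : 'M[R[i]]_d := - (invmx (Psi p) *m Psi (p - j)).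

(* coefficients of the polynomial I - Phi_1 X - ... - Phi_p X^p *)
Definition Phi_coef (j : nat) : 'M[R[i]]_d :=
  if j == 0%N then 1%:M else - Phi j.

End Sampling.

(* (c_0 + c_1 B + ... + c_r B^r) X_n, where B is the backshift operator *)
Definition backshift_poly (R : realType) (T : Type) (d r : nat)
    (c : nat -> 'M[R[i]]_d) (X : nat -> T -> 'cV[R[i]]_d) (n : nat) (w : T) :
    'cV[R[i]]_d :=
  \sum_(j < r.+1) c j *m X (n - j)%N w.

(* Main.v *)
Require Import Defs.
From HB Require Import structures.
From mathcomp Require Import all_boot all_order all_algebra.
From mathcomp Require Import all_classical all_reals all_analysis.
From mathcomp Require Import measurable_realfun complex.
From mathcomp Require Import ring lra.

(** Each component propagates by an exponential: with Z_k = exp(-h S_k),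
    Y_k((n+1) h) = Z_k^{-1} Y_k(n h) + W_{n,k}, where W_{n,k} is a stochastic integral
    over [n h, (n+1) h].  The stacked vectors W_n = (W_{n,k})_k are centred, square
    integrable, uncorrelated and have a common covariance matrix
    (noise_mean, noise_uncorrelated, noise_stationary).

    These facts are proved on discrete sums.  The increments of L are centred,
    uncorrelated over disjoint intervals and have stationary second moments;
    this follows from the moments of L(1) alone, by independence for the square
    integrability (independent_sum_sqint) and by right continuity for the means
    (imean_eq0).  Sums over uniform partitions inherit these properties.  They
    converge to W_n in probability by definition of the integral, and in mean
    square because along refinements they form a Cauchy sequence
    (refinement_l2cvg, approx_l2cvg).

    The coefficients Psi are chosen so that every Z_k is a right solvent of the
    matrix polynomial they define.  Its constant coefficient Psi_p is invertible
    by invertibility of the Vandermonde matrix (Psi_unit), so that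
    sum_j Phi_j Z_k^j = 0 for the normalized coefficients.  Writing
    Y_k((n-j) h) in terms of Y_k(n h) and of the noise in between, the terms in
    Y_k(n h) cancel for all k at once, and the autoregressive side becomes a
    moving sum of p consecutive noise vectors with matrix coefficients
    (sampled_autoregression).

    It remains to turn this moving sum, driven by the white noise W of dimension
    p d, into a moving average of a white noise of dimension d.  The moving sum
    is the output H x_n of a linear system x_n = F x_{n-1} + G W_{n-1} with a
    nilpotent block shift F, F^p = 0 (realization_output, shift_mx_nilpotent).
    The innovations of the steady-state Kalman filter of this system are white,
    and since F^p = 0 the filter expresses H x_n through the last p innovations:
    this is the moving average of order p - 1 (innovation_white,
    innovation_representation).  The steady state is a fixed point of the
    Riccati recursion, obtained as the limit of the decreasing sequence that
    starts from the stationary covariance of the state (riccati_fixed_point);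
    singular innovation covariances are allowed.  The filter has to be started
    with a prediction error whose covariance is this fixed point and which is
    uncorrelated with the noise; it is built from the increments of L before
    time 0 (past_vector), unless L is degenerate, in which case the fixed point
    is 0. *)

Set Implicit Arguments.
Unset Strict Implicit.
Unset Printing Implicit Defensive.

Import Order.TTheory GRing.Theory Num.Theory.
Import numFieldNormedType.Exports.

Local Open Scope classical_set_scope.
Local Open Scope ring_scope.
Local Open Scope complex_scope.

(** * Positive semidefinite matrices *)

Section Adjoint.
Variable R : realType.
Local Notation C := R[i].

Lemma adjmx_spectralE a b (M : 'M[C]_(a, b)) : adjmx M = map_mx Num.conj M^T.
Proof. by apply/matrixP => i j; rewrite !mxE; case: (M j i). Qed.

Lemma adjmxK a b (M : 'M[C]_(a, b)) : adjmx (adjmx M) = M.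
Proof. by apply/matrixP => i j; rewrite !mxE conjcK. Qed.

Lemma adjmx_mul a b c (M : 'M[C]_(a, b)) (N : 'M[C]_(b, c)) :
  adjmx (M *m N) = adjmx N *m adjmx M.
Proof.
apply/matrixP => i j; rewrite !mxE rmorph_sum; apply: eq_bigr => k _.
by rewrite !mxE rmorphM mulrC.
Qed.

Lemma adjmxD a b (M N : 'M[C]_(a, b)) : adjmx (M + N) = adjmx M + adjmx N.
Proof. by apply/matrixP => i j; rewrite !mxE rmorphD. Qed.

Lemma adjmxN a b (M : 'M[C]_(a, b)) : adjmx (- M) = - adjmx M.
Proof. by apply/matrixP => i j; rewrite !mxE rmorphN. Qed.

Lemma adjmxB a b (M N : 'M[C]_(a, b)) : adjmx (M - N) = adjmx M - adjmx N.
Proof. by rewrite adjmxD adjmxN. Qed.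

Lemma adjmx0 a b : adjmx (0 : 'M[C]_(a, b)) = 0.
Proof. by apply/matrixP => i j; rewrite !mxE rmorph0. Qed.

Lemma adjmx1 a : adjmx (1%:M : 'M[C]_a) = 1%:M.
Proof. by apply/matrixP => i j; rewrite !mxE eq_sym rmorph_nat. Qed.

Lemma adjmxZ a b (x : C) (M : 'M[C]_(a, b)) : adjmx (x *: M) = conjc x *: adjmx M.
Proof. by apply/matrixP => i j; rewrite !mxE rmorphM. Qed.

Definition qform n (M : 'M[C]_n) (v : 'rV[C]_n) : C := (v *m M *m adjmx v) 0 0.

Lemma qformD n (M N : 'M[C]_n) v : qform (M + N) v = qform M v + qform N v.
Proof. by rewrite /qform mulmxDr mulmxDl mxE. Qed.

Lemma qformN n (M : 'M[C]_n) v : qform (- M) v = - qform M v.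
Proof. by rewrite /qform mulmxN mulNmx mxE. Qed.

Lemma qformB n (M N : 'M[C]_n) v : qform (M - N) v = qform M v - qform N v.
Proof. by rewrite qformD qformN. Qed.

Lemma qform_congr n k (A : 'M[C]_(n, k)) (M : 'M[C]_k) v :
  qform (A *m M *m adjmx A) v = qform M (v *m A).
Proof. by rewrite /qform adjmx_mul !mulmxA. Qed.

Lemma qform_adj n (M : 'M[C]_n) v : qform (adjmx M) v = conjc (qform M v).
Proof.
rewrite /qform.
have -> : conjc ((v *m M *m adjmx v) 0 0) = adjmx (v *m M *m adjmx v) 0 0.
  by rewrite [RHS]mxE.
by rewrite !adjmx_mul adjmxK mulmxA.
Qed.

Lemma sesq_delta n (M : 'M[C]_n) (k l : 'I_n) :
  ((delta_mx 0 k : 'rV_n) *m M *m adjmx (delta_mx 0 l : 'rV_n)) 0 0 = M k l.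
Proof.
rewrite -rowE mxE (bigD1 l) //= big1 ?addr0 => [|o ol].
  by rewrite !mxE !eqxx rmorph1 mulr1.
by rewrite !mxE (negPf ol) andbF rmorph0 mulr0.
Qed.

Definition delta2 n (i j : 'I_n) (c : C) : 'rV[C]_n :=
  delta_mx 0 i + c *: delta_mx 0 j.

(** This lets the entries of a matrix be read off from its quadratic form. *)
Lemma qform_delta2 n (M : 'M[C]_n) i j (c : C) :
  qform M (delta2 i j c) = M i i + conjc c * M i j + c * M j i + c * conjc c * M j j.
Proof.
rewrite /qform /delta2 adjmxD adjmxZ mulmxDr !mulmxDl -!scalemxAl -!scalemxAr.
have eD (X Y : 'M[C]_1) : (X + Y) 0 0 = X 0 0 + Y 0 0 by rewrite mxE.
have eZ a (X : 'M[C]_1) : (a *: X) 0 0 = a * X 0 0 by rewrite mxE.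
by rewrite !(eD, eZ) !sesq_delta !addrA mulrA; congr (_ + _); rewrite addrAC.
Qed.

Lemma conjcN (x : C) : conjc (- x) = - conjc x :> C.
Proof. by case: x. Qed.

Fact polarization_identity (K : comPzRingType) (w a b c e : K) : w * w = -1 ->
  4 * b = a + b + c + e - (a + - b + - c + e) +
    w * (a + - w * b + w * c + w * - w * e -
         (a + w * b + - w * c + - w * w * e)).
Proof.
move=> ww; rewrite -[LHS]subr0 -[0](mulr0 (2 * (b - c))) -(subrr (-1)) -{1}ww.
by ring.
Qed.

Lemma polarization n (M : 'M[C]_n) i j (w : C) : w * w = -1 -> conjc w = - w ->
  4 * M i j = qform M (delta2 i j 1) - qform M (delta2 i j (-1)) +
    w * (qform M (delta2 i j w) - qform M (delta2 i j (- w))).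
Proof.
move=> ww cw; rewrite !qform_delta2 !conjcN cw !conjc1 opprK.
rewrite !mul1r !mulN1r !opprK mul1r; exact: polarization_identity.
Qed.

Lemma imag_sqr : 'i * 'i = -1 :> C.
Proof. by rewrite -expr2 sqr_i. Qed.

Lemma imag_conj : conjc ('i : C) = - 'i :> C.
Proof. by apply/eqP; rewrite eq_complex /= oppr0 !eqxx. Qed.

(** Polarization applied to both sides: only the zero matrix has zero form. *)
Lemma qform_eq0 n (M : 'M[C]_n) : (forall v, qform M v = 0) -> M = 0.
Proof.
move=> M0; apply/matrixP => i j; rewrite mxE.
apply: (mulfI (_ : (4 : C) != 0)); first by rewrite pnatr_eq0.
apply: etrans (polarization M i j imag_sqr imag_conj) _.
have -> : qform M = fun=> 0 by apply/funext.
by rewrite subr0 mulr0 add0r mulr0.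
Qed.

(** The order on C makes the values of the form real, so that hermitian symmetry
    is a consequence rather than a requirement. *)
Definition psd n (M : 'M[C]_n) : Prop := forall v, 0 <= qform M v.

Lemma psd_hermitian n (M : 'M[C]_n) : psd M -> adjmx M = M.
Proof.
move=> pM; apply/eqP; rewrite -subr_eq0; apply/eqP; apply: qform_eq0 => v.
rewrite qformB qform_adj; have /ger0_Im := pM v.
by case: (qform M v) => a b /= ->; apply/eqP; rewrite eq_complex /= !subrr oppr0 addr0 !eqxx.
Qed.

Lemma psdD n (M N : 'M[C]_n) : psd M -> psd N -> psd (M + N).
Proof. by move=> pM pN v; rewrite qformD addr_ge0. Qed.

Lemma psd0 n : psd (0 : 'M[C]_n).
Proof. by move=> v; rewrite /qform mulmx0 mul0mx mxE. Qed.

Lemma psd_congr n k (A : 'M[C]_(n, k)) (M : 'M[C]_k) :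
  psd M -> psd (A *m M *m adjmx A).
Proof. by move=> pM v; rewrite qform_congr. Qed.

Lemma psd_sum n (I : Type) (r : seq I) (F : I -> 'M[C]_n) :
  (forall i, psd (F i)) -> psd (\sum_(i <- r) F i).
Proof. by move=> pF; apply: big_ind => //; [exact: psd0 | exact: psdD]. Qed.

Lemma psd_antisym n (M N : 'M[C]_n) : psd (M - N) -> psd (N - M) -> M = N.
Proof.
move=> p1 p2; apply/eqP; rewrite -subr_eq0; apply/eqP; apply: qform_eq0 => v.
by apply: le_anti; rewrite p1 andbT -oppr_ge0 -qformN opprB p2.
Qed.

Lemma psd_trans n (M N O : 'M[C]_n) : psd (N - M) -> psd (O - N) -> psd (O - M).
Proof. by move=> p1 p2; rewrite -(subrKA N); exact: psdD. Qed.

Lemma gram_eq0 n k (N : 'M[C]_(n, k)) : N *m adjmx N = 0 -> N = 0.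
Proof.
move=> N0; apply/matrixP => i j; rewrite mxE.
have /matrixP/(_ i i) := N0; rewrite !mxE => /eqP.
rewrite psumr_eq0; last by move=> l _; rewrite !mxE mulcJ_ge0.
move=> /allP/(_ j); rewrite mem_index_enum => /(_ isT) /=.
by rewrite !mxE mulf_eq0 conjc_eq0 orbb => /eqP.
Qed.

Fact gram_conj n (U s D M : 'M[C]_n) : M = adjmx U *m D *m U -> D = s *m adjmx s ->
  M = (adjmx U *m s) *m adjmx (adjmx U *m s).
Proof. by move=> -> ->; rewrite adjmx_mul adjmxK !mulmxA. Qed.

(** A square root exists by the spectral theorem: the eigenvalues are values
    of the quadratic form, hence nonnegative. *)
Lemma psd_factor n (M : 'M[C]_n) : psd M -> exists N : 'M[C]_n, M = N *m adjmx N.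
Proof.
move=> pM; have hM := psd_hermitian pM.
have nM : M \is normalmx by apply/normalmxP; rewrite -adjmx_spectralE hM.
have uP := spectral_unitarymx M.
have := orthomx_spectralP nM; rewrite invmx_unitary // -adjmx_spectralE.
have uP' : spectralmx M *m adjmx (spectralmx M) = 1%:M.
  by rewrite adjmx_spectralE; apply/unitarymxP.
move: uP'; move: (spectralmx M) (spectral_diag M) => U D uU eM.
have D0 i : 0 <= D 0 i.
  have := pM (row i U); rewrite rowE -qform_congr eM !mulmxA uU mul1mx -mulmxA uU.
  by rewrite mulmx1 /qform sesq_delta !mxE eqxx mulr1n.
pose s : 'M[C]_n := diag_mx (\row_i sqrtc (D 0 i)).
have Ds : diag_mx D = s *m adjmx s.
  apply/matrixP => i j; rewrite mul_diag_mx !mxE.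
  have [->|ij] := eqVneq i j; last by rewrite mulr0n rmorph0 mulr0.
  rewrite !mulr1n; have := sqrtc_ge0 (D 0 j); rewrite D0.
  move=> s0; rewrite -[LHS]sqr_sqrtc expr2; congr (_ * _).
  by move/ger0_Im: s0; case: (sqrtc _) => a b /= ->; rewrite oppr0.
exists (adjmx U *m s).
exact: gram_conj eM Ds.
Qed.

(** With M = N (adj N) the hypothesis says that (adj N) X has zero Gram matrix. *)
Lemma psd_kernel n (M : 'M[C]_n) k (X : 'M[C]_(n, k)) :
  psd M -> adjmx X *m M *m X = 0 -> M *m X = 0.
Proof.
move=> /psd_factor[N ->] XMX.
have /gram_eq0 : (adjmx X *m N) *m adjmx (adjmx X *m N) = 0.
  by rewrite adjmx_mul adjmxK -XMX !mulmxA.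
move=> /(congr1 (@adjmx R _ _)); rewrite adjmx_mul adjmxK adjmx0 => XN.
by rewrite -mulmxA XN mulmx0.
Qed.

End Adjoint.

(** * Decreasing sequences of positive semidefinite matrices *)

Section PsdLimits.
Variable R : realType.
Local Notation C := R[i].

Definition imagC : C := 'i%C.

Lemma Re_sum (I : Type) (r : seq I) (F : I -> C) :
  complex.Re (\sum_(i <- r) F i) = \sum_(i <- r) complex.Re (F i).
Proof. by apply: (big_morph (@complex.Re R)) => // -[a b] [c e]. Qed.

Lemma Im_sum (I : Type) (r : seq I) (F : I -> C) :
  complex.Im (\sum_(i <- r) F i) = \sum_(i <- r) complex.Im (F i).
Proof. by apply: (big_morph (@complex.Im R)) => // -[a b] [c e]. Qed.

Lemma cReM (x y : C) : complex.Re (x * y) =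
  complex.Re x * complex.Re y - complex.Im x * complex.Im y.
Proof. by case: x; case: y. Qed.

Lemma cImM (x y : C) : complex.Im (x * y) =
  complex.Re x * complex.Im y + complex.Im x * complex.Re y.
Proof. by case: x; case: y. Qed.

Lemma cReN (x : C) : complex.Re (- x) = - complex.Re x.
Proof. by case: x. Qed.

Lemma cImN (x : C) : complex.Im (- x) = - complex.Im x.
Proof. by case: x. Qed.

Lemma cReD (x y : C) : complex.Re (x + y) = complex.Re x + complex.Re y.
Proof. by case: x; case: y. Qed.

Lemma cImD (x y : C) : complex.Im (x + y) = complex.Im x + complex.Im y.
Proof. by case: x; case: y. Qed.

Fact real_polarization (z a b c e : C) : complex.Im a = 0 -> complex.Im b = 0 ->
  complex.Im c = 0 -> complex.Im e = 0 -> 4 * z = a - b + imagC * (c - e) ->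
  z = ((complex.Re a - complex.Re b) / 4) +i* ((complex.Re c - complex.Re e) / 4).
Proof.
case: a b c e => [a ?] [b ?] [c ?] [e ?] /= -> -> -> ->.
have -> : (4 : C) = 4%:C by rewrite rmorph_nat.
case: z => x y [].
rewrite !mul0r !subrr !mulr0 mul1r !subr0 !addr0 !add0r => e1 e2.
by rewrite -e1 -e2 ![4 * _]mulrC !mulfK.
Qed.

(** Polarization with real values only, in a form that passes to limits. *)
Lemma psd_polar n (M : 'M[C]_n) i j (q := fun c => complex.Re (qform M (delta2 i j c))) :
  psd M -> M i j = ((q 1 - q (-1)) / 4) +i* ((q imagC - q (- imagC)) / 4).
Proof.
move=> pM; have q_real c : complex.Im (qform M (delta2 i j c)) = 0.
  exact: ger0_Im (pM (delta2 i j c)).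
exact: real_polarization (q_real _) (q_real _) (q_real _) (q_real _)
  (polarization M i j (@imag_sqr R) (@imag_conj R)).
Qed.

Lemma Re_qformE n (M : 'M[C]_n) v : complex.Re (qform M v) =
  \sum_j \sum_i (complex.Re (v 0 i * conjc (v 0 j)) * complex.Re (M i j) -
                 complex.Im (v 0 i * conjc (v 0 j)) * complex.Im (M i j)).
Proof.
rewrite /qform mxE Re_sum; apply: eq_bigr => j _.
rewrite !mxE mulr_suml Re_sum; apply: eq_bigr => i _.
by rewrite -cReM mulrAC.
Qed.

Lemma cvgn_sum (I : Type) (r : seq I) (F : I -> nat -> R) (l : I -> R) :
  (forall i, F i n @[n --> \oo] --> l i) ->
  \sum_(i <- r) F i n @[n --> \oo] --> \sum_(i <- r) l i.
Proof.
move=> Fl; elim: r => [|i r IH].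
  by under eq_cvg do rewrite big_nil; rewrite big_nil; exact: cvg_cst.
by under eq_cvg do rewrite big_cons; rewrite big_cons; exact: cvgD.
Qed.

(** The quadratic forms decrease to limits, and polarization carries the
    convergence over to the entries.  The convergence is recorded as: every lower
    bound of the forms along the sequence is one of the form of the limit. *)
Lemma psd_decreasing_limit n (P : nat -> 'M[C]_n) :
  (forall k, psd (P k)) -> (forall k, psd (P k - P k.+1)) ->
  exists Q : 'M[C]_n, [/\ psd Q, (forall k, psd (P k - Q)) &
    forall v x, (forall k, x <= complex.Re (qform (P k) v)) ->
      x <= complex.Re (qform Q v)].
Proof.
move=> pP dP.
have dq v : nonincreasing_seq (fun k => complex.Re (qform (P k) v)).
  apply/nonincreasing_seqP => k; have := dP k v.
  by rewrite qformB subr_ge0 lecE => /andP[].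
have cq v : cvgn (fun k => complex.Re (qform (P k) v)).
  apply: nonincreasing_is_cvgn; first exact: dq.
  by exists 0 => _ [k _ <-]; have := pP k v; rewrite lecE => /andP[].
pose Q : 'M[C]_n := \matrix_(i, j) clim (fun k => P k i j).
have cRe i j : complex.Re (P k i j) @[k --> \oo] --> complex.Re (Q i j).
  rewrite mxE /=; suff: cvgn (fun k => complex.Re (P k i j)) by [].
  rewrite (_ : (fun k => _) = (fun k => (complex.Re (qform (P k) (delta2 i j 1)) -
    complex.Re (qform (P k) (delta2 i j (-1)))) / 4)); last first.
    by apply/funext => k; rewrite psd_polar.
  by apply: is_cvgM; [apply: is_cvgB; exact: cq | exact: is_cvg_cst].
have cIm i j : complex.Im (P k i j) @[k --> \oo] --> complex.Im (Q i j).
  rewrite mxE /=; suff: cvgn (fun k => complex.Im (P k i j)) by [].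
  rewrite (_ : (fun k => _) = (fun k => (complex.Re (qform (P k) (delta2 i j imagC)) -
    complex.Re (qform (P k) (delta2 i j (- imagC)))) / 4)); last first.
    by apply/funext => k; rewrite psd_polar.
  by apply: is_cvgM; [apply: is_cvgB; exact: cq | exact: is_cvg_cst].
have cQ v : complex.Re (qform (P k) v) @[k --> \oo] --> complex.Re (qform Q v).
  rewrite (_ : (fun k => _) = (fun k => \sum_j \sum_i (complex.Re (v 0 i * conjc (v 0 j)) * complex.Re (P k i j) -
                 complex.Im (v 0 i * conjc (v 0 j)) * complex.Im (P k i j)))); last first.
    by apply/funext => k; rewrite Re_qformE.
  rewrite Re_qformE.
  apply: cvgn_sum => j; apply: cvgn_sum => i.
  by apply: cvgB; apply: cvgM => //; exact: cvg_cst.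
have hQ : adjmx Q = Q.
  apply/matrixP => i j; rewrite mxE; apply/eqP; rewrite eq_complex.
  have hP k : P k i j = conjc (P k j i) by rewrite -[in LHS](psd_hermitian (pP k)) mxE.
  have := cIm i j; have := cRe i j.
  rewrite (_ : (fun k => complex.Re (P k i j)) = (fun k => complex.Re (P k j i))); last first.
    by apply/funext => k; rewrite hP; case: (P k j i).
  rewrite (_ : (fun k => complex.Im (P k i j)) = (fun k => - complex.Im (P k j i))); last first.
    by apply/funext => k; rewrite hP; case: (P k j i).
  move=> /cvg_lim - /(_ (@Rhausdorff R)) eRe /cvg_lim - /(_ (@Rhausdorff R)) eIm.
  have := cvg_lim (@Rhausdorff R) (cRe j i); have := cvg_lim (@Rhausdorff R) (cvgN (cIm j i)).
  rewrite -/(-%R \o _) /comp eRe eIm => -> ->.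
  by case: (Q j i) => a b /=; rewrite !eqxx.
have cI v : complex.Im (qform Q v) = 0.
  have := qform_adj Q v; rewrite hQ; case: (qform Q v) => a b [] /= ?; lra.
have lb v x : (forall k, x <= complex.Re (qform (P k) v)) ->
    x <= complex.Re (qform Q v).
  by move=> H; apply: (cvgr_to_ge (cQ v)); near=> k; exact: H.
exists Q; split; last exact: lb.
  move=> v; rewrite lecE cI eqxx /=; apply: lb => k.
  by have := pP k v; rewrite lecE => /andP[].
move=> k v; rewrite qformB lecE cImD cImN cI oppr0 addr0 (ger0_Im (pP k v)) eqxx /=.
rewrite cReD cReN subr_ge0; apply: (cvgr_to_le (cQ v)).
by near=> l; apply: dq; near: l; exists k.
Unshelve. all: by end_near.
Qed.

End PsdLimits.

(** * The Riccati equation *)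

Section Riccati.
Variables (R : realType) (N d : nat).
Local Notation C := R[i].
Variables (F Q : 'M[C]_N) (H : 'M[C]_(d, N)).
Hypothesis psdQ : psd Q.

(** Covariance of the next prediction error when the current one has covariance
    P and the filter applies the gain K. *)
Definition riccati_update (K : 'M[C]_(N, d)) (P : 'M[C]_N) : 'M[C]_N :=
  F *m ((1%:M - K *m H) *m P *m adjmx (1%:M - K *m H)) *m adjmx F + Q.

(** The normal equation, which replaces K = P (adj H) (H P (adj H))^{-1} since the
    innovation covariance H P (adj H) may be singular. *)
Definition optimal_gain (P : 'M[C]_N) (K : 'M[C]_(N, d)) : Prop :=
  K *m (H *m P *m adjmx H) = P *m adjmx H.

Lemma riccati_update_psd K P : psd P -> psd (riccati_update K P).
Proof. by move=> pP; apply: psdD => //; do 2! apply: psd_congr. Qed.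

Lemma riccati_update_qform K P v : qform (riccati_update K P) v =
  qform P (v *m (F *m (1%:M - K *m H))) + qform Q v.
Proof. by rewrite qformD !qform_congr mulmxA. Qed.

Lemma psd_subP (M P : 'M[C]_N) : psd M -> psd P ->
  (forall v, complex.Re (qform M v) <= complex.Re (qform P v)) -> psd (P - M).
Proof.
move=> pM pP le v; rewrite qformB subr_ge0 lecE le andbT.
by rewrite !(ger0_Im (pM v), ger0_Im (pP v)).
Qed.

Fact subDr_cancel (V : zmodType) (a b c : V) : a + c - (b + c) = a - b.
Proof. by rewrite opprD addrACA subrr addr0. Qed.

Lemma riccati_updateB K P P' : riccati_update K P - riccati_update K P' =
  (F *m (1%:M - K *m H)) *m (P - P') *m adjmx (F *m (1%:M - K *m H)).
Proof.
rewrite /riccati_update subDr_cancel adjmx_mul; move: (1%:M - K *m H) => X.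
by rewrite !mulmxA mulmxBr !mulmxBl.
Qed.

(** A pseudoinverse of H P (adj H) solves the normal equation: if H P (adj H) x = 0 then
    the form of P vanishes at (adj H) x, hence P (adj H) x = 0. *)
Lemma optimal_gain_exists P : psd P -> exists K, optimal_gain P K.
Proof.
move=> pP; exists (P *m adjmx H *m pinvmx (H *m P *m adjmx H)).
rewrite /optimal_gain mulmxKpV // submxE -(mulmxA P).
set V := H *m P *m adjmx H; apply/eqP; apply: psd_kernel => //.
have -> : adjmx (adjmx H *m cokermx V) *m P *m (adjmx H *m cokermx V) =
          adjmx (cokermx V) *m (V *m cokermx V).
  by rewrite adjmx_mul adjmxK /V !mulmxA.
by rewrite mulmx_coker mulmx0.
Qed.

Lemma optimal_gain_orth P K : optimal_gain P K ->
  (1%:M - K *m H) *m P *m adjmx H = 0.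
Proof. by move=> oK; rewrite -mulmxA mulmxBl mul1mx -[in X in _ - X]mulmxA [H *m _]mulmxA oK subrr. Qed.

(** Completing the square: with an optimal gain K the cross terms vanish and the
    difference is the congruence of P by F (K' - K) H. *)
Lemma riccati_update_min P K K' : psd P -> optimal_gain P K ->
  psd (riccati_update K' P - riccati_update K P).
Proof.
move=> pP oK; pose D := K' - K.
have e0 := optimal_gain_orth oK.
have e0' : H *m P *m adjmx (1%:M - K *m H) = 0.
  have := congr1 (@adjmx R _ _) e0.
  by rewrite 2!adjmx_mul adjmxK adjmx0 (psd_hermitian pP) mulmxA.
have eK : 1%:M - K' *m H = (1%:M - K *m H) - D *m H.
  by rewrite /D mulmxBl opprB addrA subrK.
suff -> : riccati_update K' P - riccati_update K P =
          (F *m (D *m H)) *m P *m adjmx (F *m (D *m H)) by exact: psd_congr.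
rewrite /riccati_update subDr_cancel eK.
set X := 1%:M - K *m H in e0 e0' *; set Y := D *m H.
have XY : X *m P *m adjmx Y = 0 by rewrite adjmx_mul mulmxA e0 mul0mx.
have YX : Y *m P *m adjmx X = 0 by rewrite -[Y *m P]mulmxA -mulmxA e0' mulmx0.
have -> : F *m Y *m P *m adjmx (F *m Y) = F *m (Y *m P *m adjmx Y) *m adjmx F.
  by rewrite adjmx_mul !mulmxA.
rewrite -mulmxBl -mulmxBr adjmxB; congr (_ *m _ *m _).
clearbody X Y; rewrite mulmxBr !mulmxBl XY YX subr0 sub0r opprK.
by rewrite [LHS]addrAC subrr add0r.
Qed.

(** The Riccati recursion started above its solution decreases; its limit is
    a fixed point because the update with the optimal gain is an infimum of
    the affine updates with arbitrary gains. *)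
Theorem riccati_fixed_point P0 : psd P0 -> P0 = F *m P0 *m adjmx F + Q ->
  exists P K, [/\ psd P, psd (P0 - P), optimal_gain P K & riccati_update K P = P].
Proof.
move=> pP0 eP0.
have [g og] : exists g : 'M[C]_N -> 'M[C]_(N, d),
    forall P, psd P -> optimal_gain P (g P).
  have ex P : exists K, psd P -> optimal_gain P K.
    have [pP|npP] := pselect (psd P); last by exists 0.
    by have [K oK] := optimal_gain_exists pP; exists K.
  by have [g og] := choice ex; exists g.
pose f P := riccati_update (g P) P.
have fp P : psd P -> psd (f P) by exact: riccati_update_psd.
have fmin K P : psd P -> psd (riccati_update K P - f P).
  by move=> pP; apply: riccati_update_min (og _ pP).
have umono K P P' : psd (P' - P) -> psd (riccati_update K P' - riccati_update K P).
  by move=> pPP'; rewrite riccati_updateB; exact: psd_congr.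
have fmono P P' : psd P -> psd (P' - P) -> psd (f P' - f P).
  by move=> pP pPP'; apply: psd_trans (fmin (g P') P pP) (umono _ _ _ pPP').
pose P k := iter k f P0.
have pP k : psd (P k) by elim: k => [|k]; [exact: pP0 | exact: fp].
have dP k : psd (P k - P k.+1).
  elim: k => [|k IH]; last exact: (fmono _ _ (pP _) IH).
  (* P0 is its own update with gain 0, and optimal gains only decrease it *)
  suff {1}-> : P 0%N = riccati_update 0 P0 by exact: fmin.
  by rewrite /riccati_update mul0mx subr0 adjmx1 mul1mx mulmx1 -eP0.
have [L [pL LP Lglb]] := psd_decreasing_limit pP dP.
have PL0 : psd (P0 - L) by exact: (LP 0%N).
exists L, (g L); split; [exact: pL | exact: PL0 | exact: og |].
have pfL : psd (f L) by exact: fp.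
apply: psd_antisym.
  apply: (psd_subP pL pfL) => v.
  rewrite riccati_update_qform cReD -lerBlDr; apply: Lglb => k.
  rewrite lerBlDr -cReD -riccati_update_qform.
  have := psd_trans (LP k.+1) (fmin (g L) _ (pP k)).
  by move=> /(_ v); rewrite qformB subr_ge0 lecE => /andP[].
apply: (psd_subP pfL pL) => v.
apply: Lglb => k; have := psd_trans (fmono _ _ pL (LP k)) (dP k).
by move=> /(_ v); rewrite qformB subr_ge0 lecE => /andP[].
Qed.

End Riccati.

(** * Square integrable real variables *)

Section RealSecondOrder.
Context (disp : measure_display) (T : measurableType disp) (R : realType).
Variable P : probability T R.
Implicit Types X Y Z : T -> R.

Definition sqint X : Prop :=
  measurable_fun setT X /\ P.-integrable setT (EFin \o (fun w => X w ^+ 2)).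

(** The inner product of L^2. *)
Definition ip X Y : R := (\int[P]_w (X w * Y w))%R.

Lemma le_integrable_EFin (f g : T -> R) : measurable_fun setT f ->
  (forall w, `|f w| <= g w) -> P.-integrable setT (EFin \o g) ->
  P.-integrable setT (EFin \o f).
Proof.
move=> mf fg ig; apply: le_integrable ig => //; first exact/measurable_EFinP.
by move=> w _ /=; rewrite lee_fin (le_trans (fg w)) ?ler_norm.
Qed.

Lemma sqint_mul X Y : sqint X -> sqint Y ->
  P.-integrable setT (EFin \o (fun w => X w * Y w)).
Proof.
move=> [mX iX] [mY iY].
apply: (@le_integrable_EFin _ (fun w => X w ^+ 2 + Y w ^+ 2)).
- exact: measurable_funM.
- move=> w; rewrite normrM -(real_normK (num_real (X w))) -(real_normK (num_real (Y w))).
  move: (`|X w|) (`|Y w|) (normr_ge0 (X w)) (normr_ge0 (Y w)) => a b a0 b0.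
  nra.
- exact: (integrableD measurableT iX iY).
Qed.

Lemma sqint0 : sqint (fun=> 0).
Proof.
split; first exact: measurable_cst.
rewrite (_ : _ \o _ = cst 0%E); first exact: integrable0.
by apply/funext => w /=; rewrite expr0n.
Qed.

Lemma sqintD X Y : sqint X -> sqint Y -> sqint (fun w => X w + Y w).
Proof.
move=> sX sY; have iXY := sqint_mul sX sY; move: sX sY => [mX iX] [mY iY].
split; first exact: measurable_funD.
apply: (@le_integrable_EFin _ (fun w => X w ^+ 2 + Y w ^+ 2 + 2 * (X w * Y w))).
- by apply: (@measurable_funX _ _ _ _ _ 2); exact: measurable_funD.
- by move=> w; rewrite ger0_norm ?sqr_ge0 //; lra.
- have i2 := integrableZl measurableT 2 iXY.
  have := integrableD measurableT (integrableD measurableT iX iY) i2.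
  by congr (integrable _ _ _); apply/funext => w /=; rewrite !EFinD EFinM.
Qed.

Lemma sqintZ a X : sqint X -> sqint (fun w => a * X w).
Proof.
move=> [mX iX]; split; first exact: measurable_funM.
have := integrableZl measurableT (a ^+ 2) iX.
by congr (integrable _ _ _); apply/funext => w /=; rewrite exprMn EFinM.
Qed.

Lemma sqintN X : sqint X -> sqint (fun w => - X w).
Proof.
move=> /(sqintZ (-1)); rewrite (_ : (fun w => -1 * X w) = (fun w => - X w)) //.
by apply/funext => w; rewrite mulN1r.
Qed.

Lemma sqintB X Y : sqint X -> sqint Y -> sqint (fun w => X w - Y w).
Proof. by move=> sX sY; apply: sqintD => //; exact: sqintN. Qed.

Lemma sqint_cst a : sqint (fun=> a).
Proof.
split; first exact: measurable_cst.
rewrite (_ : _ \o _ = cst (a ^+ 2)%:E) //.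
by apply: finite_measure_integrable_cst.
Qed.

Lemma sqint_ltyP X : measurable_fun setT X ->
  ((\int[P]_w (X w ^+ 2)%:E < +oo)%E <-> sqint X).
Proof.
move=> mX; have mX2 : measurable_fun setT (EFin \o (fun w => X w ^+ 2)).
  by apply/measurable_EFinP; exact: measurable_funX.
have e : (\int[P]_w (X w ^+ 2)%:E = \int[P]_w `|(X w ^+ 2)%:E|)%E.
  by apply: eq_integral => w _; rewrite gee0_abs // lee_fin sqr_ge0.
split=> [fX|[_ /integrableP[_]]]; last by rewrite e.
by split => //; apply/integrableP; split => //; rewrite -e.
Qed.

Lemma sqint_ae_eq X Y : sqint X -> measurable_fun setT Y ->
  {ae P, forall w, X w = Y w} -> sqint Y.
Proof.
move=> sX mY XY; apply/sqint_ltyP => //.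
have [mX iX] := sX; have /(sqint_ltyP mX) := sX.
congr (_ < _)%E; apply: ae_eq_integral => //.
- by apply/measurable_EFinP; exact: measurable_funX.
- by apply/measurable_EFinP; exact: measurable_funX.
- by apply: filterS XY => w -> _.
Qed.

Lemma ipC X Y : ip X Y = ip Y X.
Proof. by congr fine; apply: eq_integral => w _; rewrite mulrC. Qed.

Lemma ipDl X Y Z : sqint X -> sqint Y -> sqint Z ->
  ip (fun w => X w + Y w) Z = ip X Z + ip Y Z.
Proof.
move=> sX sY sZ; rewrite /ip -RintegralD //; try exact: sqint_mul.
by congr fine; apply: eq_integral => w _; rewrite mulrDl.
Qed.

Lemma ipZl a X Z : sqint X -> sqint Z ->
  ip (fun w => a * X w) Z = a * ip X Z.
Proof.
move=> sX sZ; rewrite /ip -RintegralZl //; try exact: sqint_mul.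
by congr fine; apply: eq_integral => w _; rewrite mulrA.
Qed.

Lemma ipNl X Z : sqint X -> sqint Z -> ip (fun w => - X w) Z = - ip X Z.
Proof.
move=> sX sZ; rewrite -mulN1r -ipZl //; congr fine.
by apply: eq_integral => w _; rewrite mulN1r.
Qed.

Lemma ipBl X Y Z : sqint X -> sqint Y -> sqint Z ->
  ip (fun w => X w - Y w) Z = ip X Z - ip Y Z.
Proof. by move=> sX sY sZ; rewrite ipDl ?ipNl //; exact: sqintN. Qed.

Lemma ipDr X Y Z : sqint X -> sqint Y -> sqint Z ->
  ip Z (fun w => X w + Y w) = ip Z X + ip Z Y.
Proof. by move=> sX sY sZ; rewrite ipC ipDl // !(ipC _ Z). Qed.

Lemma ipZr a X Z : sqint X -> sqint Z ->
  ip Z (fun w => a * X w) = a * ip Z X.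
Proof. by move=> sX sZ; rewrite ipC ipZl // (ipC Z). Qed.

Lemma ipBr X Y Z : sqint X -> sqint Y -> sqint Z ->
  ip Z (fun w => X w - Y w) = ip Z X - ip Z Y.
Proof. by move=> sX sY sZ; rewrite ipC ipBl // !(ipC _ Z). Qed.

Lemma ip_ge0 X : 0 <= ip X X.
Proof. by apply: Rintegral_ge0 => w _; rewrite -expr2 sqr_ge0. Qed.

Lemma ip0l X : ip (fun=> 0) X = 0.
Proof.
rewrite /ip (_ : (fun w => _) = fun=> 0); first by rewrite Rintegral_cst // mul0r.
by apply/funext => w; rewrite mul0r.
Qed.

Lemma ip_cauchy_schwarz X Y : sqint X -> sqint Y ->
  ip X Y ^+ 2 <= ip X X * ip Y Y.
Proof.
move=> sX sY.
have H a b : 0 <= a ^+ 2 * ip X X + 2 * a * b * ip X Y + b ^+ 2 * ip Y Y.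
  have := ip_ge0 (fun w => a * X w + b * Y w).
  have saX := sqintZ a sX; have sbY := sqintZ b sY; have s := sqintD saX sbY.
  rewrite ipDl // !ipDr // !ipZl // !ipZr // (ipC Y X).
  by congr (_ <= _); ring.
have := ip_ge0 X; have := ip_ge0 Y.
move: (ip X X) (ip X Y) (ip Y Y) H => x c y H y0 x0.
(* The first instance is the inequality times y; the others settle y = 0. *)
have := H y (- c); have := H c (- x); have := H 1 (-1); have := H 1 1.
have [y1|y1] := ltrP 0 y; first by nra.
have {y0 y1}-> : y = 0 by apply/le_anti; rewrite y0 y1.
have [x1|x1] := ltrP 0 x; first by nra.
have {x0 x1}-> : x = 0 by apply/le_anti; rewrite x0 x1.
by move=> *; have -> : c = 0 by lra.
Qed.

End RealSecondOrder.

(** * Square integrable complex vectors *)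

Section ComplexSecondOrder.
Context (disp : measure_display) (T : measurableType disp) (R : realType).
Variable P : probability T R.
Local Notation C := R[i].
Local Notation sqint := (sqint P).
Local Notation ip := (ip P).

Definition csqint (X : T -> C) : Prop :=
  sqint (fun w => complex.Re (X w)) /\ sqint (fun w => complex.Im (X w)).

(** E[X conj(Y)], written with real inner products. *)
Definition cip (X Y : T -> C) : C :=
  (ip (fun w => complex.Re (X w)) (fun w => complex.Re (Y w)) +
   ip (fun w => complex.Im (X w)) (fun w => complex.Im (Y w))) +i*
  (ip (fun w => complex.Im (X w)) (fun w => complex.Re (Y w)) -
   ip (fun w => complex.Re (X w)) (fun w => complex.Im (Y w))).

Fact Re_fun_add (X Y : T -> C) : (fun w => complex.Re (X w + Y w)) =
  (fun w => complex.Re (X w) + complex.Re (Y w)).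
Proof. by apply/funext => w; rewrite cReD. Qed.

Fact Im_fun_add (X Y : T -> C) : (fun w => complex.Im (X w + Y w)) =
  (fun w => complex.Im (X w) + complex.Im (Y w)).
Proof. by apply/funext => w; rewrite cImD. Qed.

Fact Re_fun_scale (c : C) (X : T -> C) : (fun w => complex.Re (c * X w)) =
  (fun w => complex.Re c * complex.Re (X w) - complex.Im c * complex.Im (X w)).
Proof. by apply/funext => w; rewrite cReM. Qed.

Fact Im_fun_scale (c : C) (X : T -> C) : (fun w => complex.Im (c * X w)) =
  (fun w => complex.Re c * complex.Im (X w) + complex.Im c * complex.Re (X w)).
Proof. by apply/funext => w; rewrite cImM. Qed.

Lemma csqint_cst c : csqint (fun=> c).
Proof. by split; exact: sqint_cst. Qed.

Lemma csqintD X Y : csqint X -> csqint Y -> csqint (fun w => X w + Y w).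
Proof.
move=> [X1 X2] [Y1 Y2]; split.
  by rewrite Re_fun_add; exact: sqintD.
by rewrite Im_fun_add; exact: sqintD.
Qed.

Lemma csqintZ c X : csqint X -> csqint (fun w => c * X w).
Proof.
move=> [X1 X2]; split.
  by rewrite Re_fun_scale; apply: sqintB; exact: sqintZ.
by rewrite Im_fun_scale; apply: sqintD; exact: sqintZ.
Qed.

Lemma csqint_sum (I : Type) (r : seq I) (F : I -> T -> C) :
  (forall i, csqint (F i)) -> csqint (fun w => \sum_(i <- r) F i w).
Proof.
move=> sF; elim: r => [|i r IH].
  by under eq_fun do rewrite big_nil; exact: csqint_cst.
by under eq_fun do rewrite big_cons; exact: csqintD.
Qed.

Lemma cipC X Y : cip Y X = conjc (cip X Y).
Proof.
rewrite /cip /=; congr (_ +i* _); first by rewrite ipC; congr (_ + _); rewrite ipC.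
by rewrite opprB ipC; congr (_ - _); rewrite ipC.
Qed.

Lemma cipDl X Y Z : csqint X -> csqint Y -> csqint Z ->
  cip (fun w => X w + Y w) Z = cip X Z + cip Y Z.
Proof.
move=> [X1 X2] [Y1 Y2] [Z1 Z2]; rewrite /cip.
rewrite Re_fun_add Im_fun_add.
by rewrite !ipDl //; apply/eqP; rewrite eq_complex /=; apply/andP; split; apply/eqP; ring.
Qed.

Lemma cipZl c X Z : csqint X -> csqint Z ->
  cip (fun w => c * X w) Z = c * cip X Z.
Proof.
move=> [X1 X2] [Z1 Z2]; rewrite /cip.
rewrite Re_fun_scale Im_fun_scale.
have := (sqintZ (complex.Re c) X1, sqintZ (complex.Re c) X2).
have := (sqintZ (complex.Im c) X1, sqintZ (complex.Im c) X2).
move=> [? ?] [? ?].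
rewrite !ipDl // ?ipNl //; do ?exact: sqintN.
rewrite !ipZl //; apply/eqP; rewrite eq_complex cReM cImM /=.
by apply/andP; split; apply/eqP; ring.
Qed.

Lemma cip0l Z : cip (fun=> 0) Z = 0.
Proof. by rewrite /cip /= !ip0l addr0 subr0. Qed.

Lemma cip_suml (I : Type) (r : seq I) (F : I -> T -> C) Z :
  (forall i, csqint (F i)) -> csqint Z ->
  cip (fun w => \sum_(i <- r) F i w) Z = \sum_(i <- r) cip (F i) Z.
Proof.
move=> sF sZ; elim: r => [|i r IH].
  by under eq_fun do rewrite big_nil; rewrite big_nil cip0l.
under eq_fun do rewrite big_cons; rewrite big_cons cipDl // ?IH //.
exact: csqint_sum.
Qed.

Definition sqint_vec n (U : T -> 'cV[C]_n) : Prop :=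
  forall i, csqint (fun w => U w i 0).

(** The uncentred second moment E[U W^H].  It is the covariance when the means
    vanish, and the mean of U when W = 1; all orthogonality statements below,
    those about means included, thus concern a single bilinear operation. *)
Definition cov n k (U : T -> 'cV[C]_n) (W : T -> 'cV[C]_k) : 'M[C]_(n, k) :=
  \matrix_(i, j) cip (fun w => U w i 0) (fun w => W w j 0).

Definition one_vec : T -> 'cV[C]_1 := fun=> 1%:M.

Lemma sqint_vec_cst n (c : 'cV[C]_n) : sqint_vec (fun=> c).
Proof. by move=> i; exact: csqint_cst. Qed.

Lemma sqint_vecD n (U W : T -> 'cV[C]_n) :
  sqint_vec U -> sqint_vec W -> sqint_vec (fun w => U w + W w).
Proof. by move=> sU sW i; under eq_fun do rewrite mxE; exact: csqintD. Qed.

Lemma sqint_vecM n k (M : 'M[C]_(k, n)) (U : T -> 'cV[C]_n) :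
  sqint_vec U -> sqint_vec (fun w => M *m U w).
Proof.
move=> sU i; under eq_fun do rewrite mxE.
by apply: csqint_sum => j; exact: csqintZ.
Qed.

Lemma cov_adj n k (U : T -> 'cV[C]_n) (W : T -> 'cV[C]_k) :
  adjmx (cov U W) = cov W U.
Proof. by apply/matrixP => i j; rewrite !mxE -cipC. Qed.

Lemma covDl n k (U U' : T -> 'cV[C]_n) (W : T -> 'cV[C]_k) :
  sqint_vec U -> sqint_vec U' -> sqint_vec W ->
  cov (fun w => U w + U' w) W = cov U W + cov U' W.
Proof.
move=> sU sU' sW; apply/matrixP => i j; rewrite !mxE.
by under eq_fun do rewrite mxE; exact: cipDl.
Qed.

Lemma covMl n n' k (M : 'M[C]_(n', n)) (U : T -> 'cV[C]_n) (W : T -> 'cV[C]_k) :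
  sqint_vec U -> sqint_vec W ->
  cov (fun w => M *m U w) W = M *m cov U W.
Proof.
move=> sU sW; apply/matrixP => i j; rewrite !mxE.
under eq_fun do rewrite mxE; rewrite cip_suml // => [|l]; last exact: csqintZ.
by apply: eq_bigr => l _; rewrite cipZl // mxE.
Qed.

Lemma covDr n k (U U' : T -> 'cV[C]_n) (W : T -> 'cV[C]_k) :
  sqint_vec U -> sqint_vec U' -> sqint_vec W ->
  cov W (fun w => U w + U' w) = cov W U + cov W U'.
Proof. by move=> sU sU' sW; rewrite -!(cov_adj _ W) covDl // adjmxD. Qed.

Lemma covMr n n' k (M : 'M[C]_(n', n)) (U : T -> 'cV[C]_n) (W : T -> 'cV[C]_k) :
  sqint_vec U -> sqint_vec W ->
  cov W (fun w => M *m U w) = cov W U *m adjmx M.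
Proof. by move=> sU sW; rewrite -!(cov_adj _ W) covMl // adjmx_mul. Qed.

Lemma cov_cst0l n k (W : T -> 'cV[C]_k) : cov (fun=> (0 : 'cV[C]_n)) W = 0.
Proof.
apply/matrixP => i j; rewrite !mxE -[RHS](cip0l (fun w => W w j 0)).
by congr cip; apply/funext => w; rewrite mxE.
Qed.

Lemma qform_cov n (U : T -> 'cV[C]_n) v : sqint_vec U ->
  qform (cov U U) v = cov (fun w => v *m U w) (fun w => v *m U w) 0 0.
Proof.
by move=> sU; rewrite covMl ?covMr ?mulmxA //; exact: sqint_vecM.
Qed.

Lemma psd_cov n (U : T -> 'cV[C]_n) : sqint_vec U -> psd (cov U U).
Proof.
move=> sU v; rewrite qform_cov // mxE /cip lecE /=.
by rewrite addr_ge0 ?ip_ge0 // andbT ipC subrr.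
Qed.

Lemma mexpectation_cov n (U : T -> 'cV[C]_n) :
  mexpectation P U = cov U one_vec.
Proof.
apply/matrixP => i j; rewrite !mxE ord1 /cexpectation !unlock /cip /one_vec mxE /=.
have H (f : T -> R) : fine (\int[P]_w (f w)%:E)%E = ip f (fun=> 1).
  by congr fine; apply: eq_integral => w _; rewrite mulr1.
by rewrite !H ![ip _ (fun=> 0)]ipC !ip0l addr0 subr0.
Qed.

Lemma ip_intE (X Y : T -> R) :
  fine ('E_P[fun w => X w * Y w]) = ip X Y.
Proof. by rewrite unlock. Qed.

Lemma ccovariance_cov n (U W : T -> 'cV[C]_n) : sqint_vec U -> sqint_vec W ->
  cov U one_vec = 0 -> cov W one_vec = 0 -> ccovariance P U W = cov U W.
Proof.
move=> sU sW U0 W0; rewrite /ccovariance !mexpectation_cov U0 W0.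
apply/matrixP => i j; rewrite !mxE.
have [U1 U2] := sU i; have [W1 W2] := sW j.
rewrite /cexpectation (_ : (fun w => complex.Re _) = fun w =>
  complex.Re (U w i 0) * complex.Re (W w j 0) +
  complex.Im (U w i 0) * complex.Im (W w j 0)); last first.
  apply/funext => w; rewrite !subr0 mxE big_ord1 !mxE.
  by case: (U w i 0) => a b; case: (W w j 0) => c e /=; rewrite mulrN opprK.
rewrite (_ : (fun w => complex.Im _) = fun w =>
  complex.Im (U w i 0) * complex.Re (W w j 0) -
  complex.Re (U w i 0) * complex.Im (W w j 0)); last first.
  apply/funext => w; rewrite !subr0 mxE big_ord1 !mxE.
  by case: (U w i 0) => a b; case: (W w j 0) => c e /=; rewrite mulrN addrC.
rewrite unlock; congr (_ +i* _).
  by apply: RintegralD => //; exact: sqint_mul.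
by apply: RintegralB => //; exact: sqint_mul.
Qed.

Lemma sqint_vec_crandom n (U : T -> 'cV[C]_n) : sqint_vec U ->
  crandom_vector U /\ square_integrable P U.
Proof.
move=> sU; split; first by move=> i; have [[? _] [? _]] := sU i.
rewrite /square_integrable unlock; apply: integrable_lty => //.
rewrite /cvec_normsq.
rewrite (_ : (fun _ => _) = fun w => (\sum_(i < n) ((complex.Re (U w i 0) ^+ 2)%:E + (complex.Im (U w i 0) ^+ 2)%:E))%E).
  apply: integrable_sum => // i _; have [[_ i1] [_ i2]] := sU i.
  exact: integrableD.
apply/funext => w; rewrite sumEFin; congr (_%:E).
Qed.

End ComplexSecondOrder.

(** * Limits in probability *)

Section ConvergenceInProbability.
Context (disp : measure_display) (T : measurableType disp) (R : realType).
Variable P : probability T R.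
Implicit Types X Y : T -> R.

Definition tends_in_prob (Xn : nat -> T -> R) X : Prop :=
  forall e, 0 < e -> exists N, forall n, (N <= n)%N ->
    (P [set w | (e <= `|Xn n w - X w|)%R] <= e%:E)%E.

Lemma measurable_norm_ge e X : measurable_fun setT X ->
  measurable [set w | e <= `|X w|].
Proof.
move=> mX; have mn : measurable_fun setT (fun w => `|X w|).
  by apply: measurableT_comp => //.
have := mn measurableT `[e, +oo[%classic (measurable_itv _).
by rewrite setTI; congr measurable; apply/seteqP; split => w /=; rewrite in_itv /= andbT.
Qed.

Lemma tends_in_prob_cst X : tends_in_prob (fun=> X) X.
Proof.
move=> e e0; exists 0%N => n _.
rewrite (_ : [set _ | _] = set0) ?measure0 ?lee_fin ?ltW //.
by apply/seteqP; split => // w /=; rewrite subrr normr0 leNgt e0.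
Qed.

Lemma tends_in_probD (Xn Yn : nat -> T -> R) X Y :
  (forall n, measurable_fun setT (Xn n)) -> (forall n, measurable_fun setT (Yn n)) ->
  measurable_fun setT X -> measurable_fun setT Y ->
  tends_in_prob Xn X -> tends_in_prob Yn Y ->
  tends_in_prob (fun n w => Xn n w + Yn n w) (fun w => X w + Y w).
Proof.
move=> mXn mYn mX mY cX cY e e0.
have e2 : 0 < e / 2 by rewrite divr_gt0.
have [N1 H1] := cX _ e2; have [N2 H2] := cY _ e2; exists (maxn N1 N2) => n.
rewrite geq_max => /andP[n1 n2].
have m1 : measurable [set w | e / 2 <= `|Xn n w - X w|].
  by apply: measurable_norm_ge; exact: measurable_funB.
have m2 : measurable [set w | e / 2 <= `|Yn n w - Y w|].
  by apply: measurable_norm_ge; exact: measurable_funB.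
have m3 : measurable [set w | e <= `|Xn n w + Yn n w - (X w + Y w)|].
  by apply: measurable_norm_ge; apply: measurable_funB; exact: measurable_funD.
have -> : (e%:E = (e / 2)%:E + (e / 2)%:E)%E by rewrite -EFinD; congr EFin; lra.
apply: le_trans (leeD (H1 _ n1) (H2 _ n2)).
apply: le_trans (measureU2 _ m1 m2).
apply: le_measure; rewrite ?inE //; first exact: measurableU.
move=> w /= H; have [h|h] := lerP (e / 2) `|Xn n w - X w|; [by left|right].
have := ler_normD (Xn n w - X w) (Yn n w - Y w).
by rewrite addrACA -opprD; lra.
Qed.

Lemma tends_in_probZ a (Xn : nat -> T -> R) X :
  (forall n, measurable_fun setT (Xn n)) -> measurable_fun setT X ->
  tends_in_prob Xn X -> tends_in_prob (fun n w => a * Xn n w) (fun w => a * X w).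
Proof.
move=> mXn mX cX e e0; have a0 : 0 < `|a| + 1 by rewrite ltr_pwDr.
have [N H] := cX (Num.min e (e / (`|a| + 1))) ltac:(by rewrite lt_min e0 divr_gt0).
exists N => n Nn; apply: le_trans (_ : _ <= (Num.min e (e / (`|a| + 1)))%:E)%E _; last first.
  by rewrite lee_fin ge_min lexx.
apply: le_trans (H _ Nn); apply: le_measure; rewrite ?inE.
- by apply: measurable_norm_ge; apply: measurable_funB; exact: measurable_funM.
- by apply: measurable_norm_ge; exact: measurable_funB.
move=> w /=; rewrite -mulrBr normrM => h; rewrite ge_min; apply/orP; right.
rewrite ler_pdivrMr // mulrC; apply: le_trans h _.
by rewrite ler_wpM2r // lerDl.
Qed.

Lemma tends_in_prob_sum (I : Type) (r : seq I) (Xn : I -> nat -> T -> R) (X : I -> T -> R) :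
  (forall i n, measurable_fun setT (Xn i n)) -> (forall i, measurable_fun setT (X i)) ->
  (forall i, tends_in_prob (Xn i) (X i)) ->
  tends_in_prob (fun n w => \sum_(i <- r) Xn i n w) (fun w => \sum_(i <- r) X i w).
Proof.
move=> mXn mX cX; elim: r => [|i r IH].
  rewrite (_ : (fun n w => _) = fun _ w => 0); last first.
    by apply/funext => n; apply/funext => w; rewrite big_nil.
  rewrite (_ : (fun w => _) = fun w => 0); first exact: tends_in_prob_cst.
  by apply/funext => w; rewrite big_nil.
rewrite (_ : (fun n w => _) = fun n w => Xn i n w + \sum_(j <- r) Xn j n w); last first.
  by apply/funext => n; apply/funext => w; rewrite big_cons.
rewrite (_ : (fun w => _) = fun w => X i w + \sum_(j <- r) X j w); last first.
  by apply/funext => w; rewrite big_cons.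
apply: tends_in_probD => // [n|]; exact: measurable_sum.
Qed.

Lemma EFin_ip X : sqint P X -> ((ip P X X)%:E = \int[P]_w (X w ^+ 2)%:E)%E.
Proof.
move=> sX; rewrite /ip /Rintegral fineK.
  by apply: eq_integral => w _; rewrite expr2.
exact: (integrable_fin_num measurableT (sqint_mul sX sX)).
Qed.

(** A limit in probability of an L^2-bounded sequence lies in L^2: truncate at
    level K, where X^2 <= 2 Z^2 + 2 a^2 unless Z is a-far from X, and let first
    a and then K tend to their limits. *)
Lemma sqint_tends_in_prob (Zn : nat -> T -> R) X c :
  (forall n, sqint P (Zn n)) -> (forall n, ip P (Zn n) (Zn n) <= c) ->
  measurable_fun setT X -> tends_in_prob Zn X ->
  sqint P X /\ ip P X X <= 2 * c.
Proof.
move=> sZ bZ mX cX.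
have mX2 : measurable_fun setT (fun w => X w ^+ 2) by exact: measurable_funX.
pose tr K w := (Num.min (X w ^+ 2) K%:R)%:E : \bar R.
have mtr K : measurable_fun setT (tr K).
  by apply/measurable_EFinP; apply: measurable_minr => //; exact: measurable_cst.
have tr0 K w : (0 <= tr K w)%E by rewrite lee_fin le_min sqr_ge0 ler0n.
have trle K : (\int[P]_w tr K w <= (2 * c)%:E)%E.
  apply/lee_addgt0Pr => e e0; rewrite -EFinD.
  pose a := Num.min 1 (e / (2 + K%:R)).
  have K0 : 0 <= K%:R :> R by [].
  have a0 : 0 < a by rewrite lt_min ltr01 /= divr_gt0 // ltr_pwDl.
  have a0' : 0 <= a by exact: ltW.
  have a1 : a <= 1 by rewrite ge_min lexx.
  have ae : a * (2 + K%:R) <= e by rewrite -ler_pdivlMr ?ltr_pwDl // ge_min lexx orbT.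
  have [n /(_ _ (leqnn n)) PA] := cX a a0.
  set A := [set w | _] in PA.
  have mA : measurable A by apply: measurable_norm_ge; apply: measurable_funB => //; case: (sZ n).
  have mZ : measurable_fun setT (fun w => (Zn n w ^+ 2)%:E).
    by apply/measurable_EFinP; apply: measurable_funX; case: (sZ n).
  have mI : measurable_fun setT (fun w => (\1_A w)%:E : \bar R).
    by apply/measurable_EFinP; exact: measurable_indic.
  apply: (@le_trans _ _ (\int[P]_w (2%:E * (Zn n w ^+ 2)%:E +
      ((2 * a ^+ 2)%:E + K%:R%:E * (\1_A w)%:E)))%E).
    apply: ge0_le_integral => //.
      apply: emeasurable_funD; first exact: measurable_funeM.
      by apply: emeasurable_funD; [exact: measurable_cst|exact: measurable_funeM].
    move=> w _; rewrite -!EFinM -!EFinD lee_fin indicE.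
    have [wA|wA] := boolP (w \in A).
      rewrite mulr1 ge_min; apply/orP; right.
      by have := sqr_ge0 (Zn n w); have := sqr_ge0 a; lra.
    rewrite mulr0 addr0 ge_min; apply/orP; left.
    have : `|Zn n w - X w| < a by rewrite ltNge; apply: contra wA => h; rewrite inE.
    rewrite ltr_norml => /andP[h1 h2].
    have := sqr_ge0 (2 * Zn n w - X w).
    have : 0 <= (a - (Zn n w - X w)) * (a + (Zn n w - X w)) by apply: mulr_ge0; lra.
    by move: (Zn n w) (X w) => z x; nra.
  rewrite ge0_integralD //; first last.
  - by apply: emeasurable_funD; [exact: measurable_cst|exact: measurable_funeM].
  - move=> w _; rewrite -EFinM -EFinD lee_fin indicE addr_ge0 ?mulr_ge0 ?sqr_ge0 //.
  - exact: measurable_funeM.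
  - by move=> w _; rewrite -EFinM lee_fin mulr_ge0 ?sqr_ge0.
  rewrite ge0_integralD //; first last.
  - exact: measurable_funeM.
  - by move=> w _; rewrite lee_fin mulr_ge0 ?sqr_ge0.
  have -> : (\int[P]_w (2 * a ^+ 2)%:E = (2 * a ^+ 2)%:E)%E.
    by have := expectation_cst P (2 * a ^+ 2); rewrite unlock.
  rewrite ge0_integralZl_EFin //; first last.
    by move=> w _; rewrite lee_fin sqr_ge0.
  rewrite ge0_integralZl_EFin //.
  rewrite integral_indic // setIT -EFin_ip //.
  apply: (@le_trans _ _ (2%:E * (ip P (Zn n) (Zn n))%:E + ((2 * a ^+ 2)%:E + K%:R%:E * a%:E))%E).
    by apply: leeD => //; apply: leeD => //; apply: lee_wpmul2l.
  rewrite -!EFinM -!EFinD lee_fin; have := bZ n.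
  nra.
have lim : (\int[P]_w (X w ^+ 2)%:E <= (2 * c)%:E)%E.
  have := @cvg_monotone_convergence _ _ _ P setT measurableT tr mtr (fun K w _ => tr0 K w).
  have nd w : [set: T] w -> nondecreasing_seq (tr^~ w).
    move=> _; apply/nondecreasing_seqP => K; rewrite lee_fin le_min ge_min lexx /=.
    by rewrite ge_min; apply/orP; right; rewrite ler_nat.
  move=> /(_ nd).
  rewrite (_ : (\int[P]_(x in _) _ = \int[P]_w (X w ^+ 2)%:E)%E); last first.
    apply: eq_integral => w _; apply/cvg_lim => //.
    apply: cvg_near_cst; have [k _ hk] := nbhs_infty_ger (X w ^+ 2).
    by exists k => // j /hk /= h; rewrite /tr; congr EFin; apply/min_idPl.
  move=> cv; apply: (cvge_to_le cv); near=> K; exact: trle.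
have sX : sqint P X by apply/sqint_ltyP => //; apply: le_lt_trans lim _; rewrite ltry.
by split => //; rewrite -lee_fin EFin_ip.
Unshelve. all: by end_near.
Qed.

End ConvergenceInProbability.

(** * Laws and independence *)

Section LawsAndIndependence.
Context (disp : measure_display) (T : measurableType disp) (R : realType).
Variable P : probability T R.
Implicit Types X Y : T -> R.

Definition same_law X Y : Prop :=
  forall A : set R, measurable A -> P (X @^-1` A) = P (Y @^-1` A).

Definition independent_pair X Y : Prop :=
  forall A B : set R, measurable A -> measurable B ->
    P (X @^-1` A `&` Y @^-1` B) = (P (X @^-1` A) * P (Y @^-1` B))%E.

Lemma same_law_ge0 X Y (f : R -> R) : measurable_fun setT X -> measurable_fun setT Y ->
  same_law X Y -> measurable_fun setT f -> (forall x, 0 <= f x) ->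
  (\int[P]_w (f (X w))%:E = \int[P]_w (f (Y w))%:E)%E.
Proof.
move=> mX mY XY mf f0.
pose X' : {mfun T >-> R} := HB.pack X (isMeasurableFun.Build _ _ _ _ _ mX).
pose Y' : {mfun T >-> R} := HB.pack Y (isMeasurableFun.Build _ _ _ _ _ mY).
have mEf : measurable_fun setT (EFin \o f) by apply/measurable_EFinP.
have eX := @ge0_integral_distribution _ _ _ _ _ P X' (EFin \o f) mEf (fun y => f0 y).
have eY := @ge0_integral_distribution _ _ _ _ _ P Y' (EFin \o f) mEf (fun y => f0 y).
rewrite -[LHS]eX -[RHS]eY; apply: eq_measure_integral => A mA _; exact: XY.
Qed.

(** The joint law of an independent pair is the product of the laws, so that
    Tonelli's theorem applies. *)
Lemma independent_ge0_mul X Y (f g : R -> R) :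
  measurable_fun setT X -> measurable_fun setT Y -> independent_pair X Y ->
  measurable_fun setT f -> measurable_fun setT g ->
  (forall x, 0 <= f x) -> (forall x, 0 <= g x) ->
  (\int[P]_w (f (X w) * g (Y w))%:E =
   (\int[P]_w (f (X w))%:E) * \int[P]_w (g (Y w))%:E)%E.
Proof.
move=> mX mY XY mf mg f0 g0.
pose X' : {mfun T >-> R} := HB.pack X (isMeasurableFun.Build _ _ _ _ _ mX).
pose Y' : {mfun T >-> R} := HB.pack Y (isMeasurableFun.Build _ _ _ _ _ mY).
pose Z := fun w => (X w, Y w).
have mZ : measurable_fun setT Z by exact: measurable_fun_pair.
pose Z' : {mfun T >-> (R * R)%type} := HB.pack Z (isMeasurableFun.Build _ _ _ _ _ mZ).
have mEf : measurable_fun setT (EFin \o f) by apply/measurable_EFinP.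
have mEg : measurable_fun setT (EFin \o g) by apply/measurable_EFinP.
pose k (z : R * R) : \bar R := (f z.1 * g z.2)%:E.
have mk : measurable_fun setT k.
  apply/measurable_EFinP; apply: measurable_funM.
    by apply: measurableT_comp => //; exact: measurable_fst.
  by apply: measurableT_comp => //; exact: measurable_snd.
have k0 z : (0 <= k z)%E by rewrite lee_fin mulr_ge0.
have eX := @ge0_integral_distribution _ _ _ _ _ P X' (EFin \o f) mEf (fun y => f0 y).
have eY := @ge0_integral_distribution _ _ _ _ _ P Y' (EFin \o g) mEg (fun y => g0 y).
have eZ := @ge0_integral_distribution _ _ _ _ _ P Z' k mk k0.
have uniq := @product_measure_unique _ _ _ _ _ (distribution P X') (distribution P Y')
  (distribution P Z').
have prodE : (\int[distribution P Z']_z k z =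
    \int[distribution P X' \x distribution P Y']_z k z)%E.
  apply: eq_measure_integral => A mA _; exact/esym/uniq.
rewrite -[LHS]eZ prodE fubini_tonelli1 // -[in RHS]eX -[in RHS]eY /fubini_F /k /=.
have gi : (0 <= \int[distribution P Y']_y (g y)%:E)%E.
  by apply: integral_ge0 => y _; rewrite lee_fin.
under eq_integral.
  move=> x _; under eq_integral do rewrite EFinM.
  rewrite ge0_integralZl_EFin //; last by move=> y _; rewrite lee_fin.
  over.
rewrite ge0_integralZr //; by move=> x _; rewrite lee_fin.
Qed.

(* Signed variables are reduced to nonnegative ones by these parts. *)
Definition pos_part (x : R) := Num.max x 0.
Definition neg_part (x : R) := Num.max (- x) 0.

Lemma pos_neg_part x : x = pos_part x - neg_part x.
Proof. rewrite /pos_part /neg_part !maxElt; case: ifP; case: ifP; lra. Qed.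

Lemma pos_part_ge0 x : 0 <= pos_part x.
Proof. by rewrite le_max lexx orbT. Qed.

Lemma neg_part_ge0 x : 0 <= neg_part x.
Proof. by rewrite le_max lexx orbT. Qed.

Lemma measurable_pos_part : measurable_fun setT pos_part.
Proof. by apply: measurable_maxr. Qed.

Lemma measurable_neg_part : measurable_fun setT neg_part.
Proof. by apply: measurable_maxr => //; exact: measurable_oppr. Qed.

Lemma sqint_dominated X Y : measurable_fun setT Y -> (forall w, `|Y w| <= `|X w|) ->
  sqint P X -> sqint P Y.
Proof.
move=> mY YX [mX iX]; split => //; apply: le_integrable_EFin iX.
  exact: measurable_funX.
by move=> w; rewrite normrX -(real_normK (num_real (X w))) lerXn2r ?nnegrE.
Qed.

Lemma sqint_pos_part X : sqint P X -> sqint P (fun w => pos_part (X w)).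
Proof.
move=> sX; apply: sqint_dominated (sX).
  by apply: measurableT_comp; [exact: measurable_pos_part | case: sX].
move=> w; rewrite (ger0_norm (pos_part_ge0 _)) /pos_part ge_max normr_ge0 andbT.
exact: ler_norm.
Qed.

Lemma sqint_neg_part X : sqint P X -> sqint P (fun w => neg_part (X w)).
Proof.
move=> sX; apply: sqint_dominated (sX).
  by apply: measurableT_comp; [exact: measurable_neg_part | case: sX].
move=> w; rewrite (ger0_norm (neg_part_ge0 _)) /neg_part ge_max normr_ge0 andbT.
by rewrite -normrN ler_norm.
Qed.

Lemma same_law_sqint X Y : sqint P X -> measurable_fun setT Y -> same_law X Y ->
  sqint P Y /\ ip P Y Y = ip P X X.
Proof.
move=> sX mY XY; have [mX _] := sX.
have e : (\int[P]_w (X w ^+ 2)%:E = \int[P]_w (Y w ^+ 2)%:E)%E.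
  apply: (@same_law_ge0 _ _ (fun x => x ^+ 2)) => // x; exact: sqr_ge0.
have sY : sqint P Y by apply/(sqint_ltyP P mY); rewrite -e; apply/sqint_ltyP.
by split => //; apply: EFin_inj; rewrite !EFin_ip.
Qed.

Definition mean X : R := ip P X (fun=> 1).

Lemma mean_ge0E X : (fine (\int[P]_w (X w)%:E))%E = mean X.
Proof. by congr fine; apply: eq_integral => w _; rewrite mulr1. Qed.

Lemma mean_parts X : sqint P X -> mean X =
  mean (fun w => pos_part (X w)) - mean (fun w => neg_part (X w)).
Proof.
move=> sX; rewrite /mean -ipBl; [|exact: sqint_pos_part|exact: sqint_neg_part|exact: sqint_cst].
by congr ip; apply/funext => w; rewrite -pos_neg_part.
Qed.

Lemma same_law_mean X Y : sqint P X -> measurable_fun setT Y -> same_law X Y ->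
  mean Y = mean X.
Proof.
move=> sX mY XY; have [mX _] := sX; have [sY _] := same_law_sqint sX mY XY.
rewrite (mean_parts sX) (mean_parts sY) -!mean_ge0E.
rewrite (same_law_ge0 mX mY XY measurable_pos_part pos_part_ge0).
by rewrite (same_law_ge0 mX mY XY measurable_neg_part neg_part_ge0).
Qed.

Lemma independent_ip X Y : sqint P X -> sqint P Y -> independent_pair X Y ->
  ip P X Y = mean X * mean Y.
Proof.
move=> sX sY XY; have [mX _] := sX; have [mY _] := sY.
have spX := sqint_pos_part sX; have snX := sqint_neg_part sX.
have spY := sqint_pos_part sY; have snY := sqint_neg_part sY.
have H (f g : R -> R) : measurable_fun setT f -> measurable_fun setT g ->
    (forall x, 0 <= f x) -> (forall x, 0 <= g x) ->
    sqint P (fun w => f (X w)) -> sqint P (fun w => g (Y w)) ->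
    ip P (fun w => f (X w)) (fun w => g (Y w)) =
    mean (fun w => f (X w)) * mean (fun w => g (Y w)).
  move=> mf mg f0 g0 sf sg; rewrite -!mean_ge0E -fineM.
  - by rewrite -independent_ge0_mul.
  - have := sqint_mul sf (sqint_cst P 1) => /(integrable_fin_num measurableT).
    by congr (_ \is a fin_num); apply: eq_integral => w _ /=; rewrite mulr1.
  - have := sqint_mul sg (sqint_cst P 1) => /(integrable_fin_num measurableT).
    by congr (_ \is a fin_num); apply: eq_integral => w _ /=; rewrite mulr1.
rewrite (mean_parts sX) (mean_parts sY).
rewrite (_ : ip P X Y = ip P (fun w => pos_part (X w) - neg_part (X w))
  (fun w => pos_part (Y w) - neg_part (Y w))); last first.
  by congr ip; apply/funext => w; rewrite -pos_neg_part.
have sB := sqintB spY snY.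
rewrite ipBl // !ipBr // !H //; try exact: measurable_pos_part; try exact: measurable_neg_part;
  try exact: pos_part_ge0; try exact: neg_part_ge0.
ring.
Qed.

End LawsAndIndependence.

(** * Second moments of Levy increments *)

Section LevyMoments.
Context (disp : measure_display) (T : measurableType disp) (R : realType).
Variable P : probability T R.
Implicit Types X Y : T -> R.

Lemma ip_sqrD X Y : sqint P X -> sqint P Y ->
  ip P (fun w => X w + Y w) (fun w => X w + Y w) =
  ip P X X + 2 * ip P X Y + ip P Y Y.
Proof.
move=> sX sY; have sXY := sqintD sX sY.
by rewrite ipDl // !ipDr // (ipC P Y X); ring.
Qed.

Lemma ip11 : ip P (fun=> 1) (fun=> 1) = 1.
Proof. by have := expectation_cst P 1; rewrite -ip_intE /= mulr1 => ->. Qed.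

Lemma ip_cstr X c : sqint P X -> ip P X (fun=> c) = c * mean P X.
Proof.
move=> sX; rewrite /mean -ipZr //; last exact: sqint_cst.
by rewrite mulr1.
Qed.

Lemma mean_cst c : mean P (fun=> c) = c.
Proof. by rewrite /mean ipC ip_cstr ?/mean ?ip11 ?mulr1 //; exact: sqint_cst. Qed.

Lemma measurable_norm_le (e : R) Y : measurable_fun setT Y ->
  measurable [set w | `|Y w| <= e].
Proof.
move=> mY; have mn : measurable_fun setT (fun w => `|Y w|) by apply: measurableT_comp.
have := mn measurableT `]-oo, e]%classic (measurable_itv _).
by rewrite setTI; congr measurable; apply/seteqP; split => w /=; rewrite in_itv.
Qed.

(** Almost every value of Y is finite, so some bound holds with positive probability. *)
Lemma bounded_event_pos Y : measurable_fun setT Y ->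
  exists K : nat, (0 < P [set w | (`|Y w| <= K%:R)%R])%E.
Proof.
move=> mY; apply: contrapT => H.
have mA K := measurable_norm_le K%:R mY.
have PA K : P [set w | `|Y w| <= K%:R] = 0%E.
  apply/eqP; rewrite -measure_le0 leNgt; apply/negP => h; apply: H; by exists K.
have : P (\bigcup_K [set w | `|Y w| <= K%:R]) = 0%E.
  apply: measure_negligible; first by apply: bigcup_measurable => K _; exact: mA.
  by apply: negligible_bigcup => K; apply/negligibleP; [exact: mA|exact: PA].
rewrite (_ : \bigcup_K _ = setT); first by rewrite probability_setT => -[] /eqP; rewrite oner_eq0.
apply/seteqP; split => // w _; exists (Num.truncn `|Y w|).+1 => //=.
by apply: ltW; exact: truncnS_gt.
Qed.

(** If X + Y is square integrable and Y is independent of X, restricting to an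
    event on which Y is bounded shows that X is square integrable. *)
Lemma independent_sum_sqint X Y : measurable_fun setT X -> measurable_fun setT Y ->
  independent_pair P X Y -> sqint P (fun w => X w + Y w) -> sqint P X.
Proof.
move=> mX mY XY sXY; have [K K0] := bounded_event_pos mY.
pose g (y : R) : R := \1_[set z : R | `|z| <= K%:R] y.
have mI : measurable [set z : R | `|z| <= K%:R].
  have := @normr_measurable R setT measurableT `]-oo, K%:R]%classic (measurable_itv _).
  by rewrite setTI; congr measurable; apply/seteqP; split => w /=; rewrite in_itv /=.
have mg : measurable_fun setT g by exact: measurable_indic.
have g0 y : 0 <= g y by rewrite /g indicE.
have mX2 : measurable_fun setT (fun w => (X w ^+ 2)%:E).
  by apply/measurable_EFinP; exact: measurable_funX.
have /= E := @independent_ge0_mul _ _ _ P X Y (fun x => x ^+ 2) g mX mY XY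
  (@exprn_measurable _ _ _) mg (fun x => sqr_ge0 x) g0.
have Eg : (\int[P]_w (g (Y w))%:E = P [set w | (`|Y w| <= K%:R)%R])%E.
  by rewrite -[X in P X]setIT -integral_indic //; exact: measurable_norm_le.
have bound : (\int[P]_w (X w ^+ 2 * g (Y w))%:E < +oo)%E.
  apply: (integrable_lty (mu := P) measurableT).
  have [mS iS] := sXY.
  apply: (@le_integrable_EFin _ _ _ P _ (fun w => 2 * (X w + Y w) ^+ 2 + 2 * K%:R ^+ 2)).
  - apply: measurable_funM; first exact: measurable_funX.
    exact: measurableT_comp mg mY.
  - move=> w; rewrite /g indicE; have [|_] := boolP (Y w \in _); last first.
      by rewrite mulr0 normr0 addr_ge0 // mulr_ge0 // sqr_ge0.
    move=> /set_mem hY; have {hY} : `|Y w| <= K%:R by [].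
    rewrite ler_norml => /andP[h1 h2]; rewrite mulr1 ger0_norm ?sqr_ge0 //.
    have : 0 <= (K%:R - Y w) * (K%:R + Y w) by apply: mulr_ge0; lra.
    have := sqr_ge0 (X w + 2 * Y w).
    by move: (X w) (Y w) (K%:R : R) => x y k; nra.
  - have := integrableD measurableT (integrableZl measurableT 2 iS)
      (finite_measure_integrable_cst P (2 * K%:R ^+ 2) measurableT).
    by congr (integrable _ _ _); apply/funext => w /=; rewrite EFinD EFinM.
apply/sqint_ltyP => //; rewrite ltey; apply/eqP => Xoo.
by move: bound; rewrite E Eg Xoo gt0_mulye.
Qed.

Variables (m : nat) (L : R -> T -> 'cV[R]_m).
Hypothesis hL : levy_process P L.
Hypothesis hL2 : ('E_P[fun w => (\sum_(i < m) (L 1 w i 0) ^+ 2)%R] < +oo)%E.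
Hypothesis hL1 : forall i : 'I_m, ('E_P[fun w => L 1%R w i 0%R] = 0)%E.

Definition incr (s t : R) (i : 'I_m) (w : T) : R := L t w i 0 - L s w i 0.

Lemma measurable_incr s t i : measurable_fun setT (incr s t i).
Proof. by apply: measurable_funB; exact: (levy_measurable hL). Qed.

(** Besides the coordinates, their pairwise sums are needed: the mixed moments
    of two coordinates are recovered from them by polarization. *)
Lemma borel_cV_coord (f : 'cV[R]_m -> R) (A : set R) :
  (exists i, f = fun v => v i 0) \/ (exists i j, f = fun v => v i 0 + v j 0) ->
  measurable A -> borel_cV (f @^-1` A).
Proof.
pose G : set (set 'cV[R]_m) := [set C | exists (i : 'I_m) (A : set R),
         measurable A /\ C = [set v : 'cV[R]_m | A (v i 0)]].
pose GT := g_sigma_algebraType G.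
have mc i : measurable_fun setT (fun v : GT => (v : 'cV[R]_m) i 0).
  move=> _ B mB; rewrite setTI; apply: sub_sigma_algebra; by exists i, B.
have mf (g : GT -> R) B : measurable_fun setT g -> measurable B -> borel_cV (g @^-1` B).
  by move=> mg mB; have := mg measurableT B mB; rewrite setTI.
by case=> [[i ->]|[i [j ->]]] mA; apply: mf => //; exact: measurable_funD.
Qed.

Lemma incr_same_law s t h i : s <= t ->
  same_law P (incr (s + h) (t + h) i) (incr s t i).
Proof.
move=> st A mA.
have := levy_stationary hL h st (@borel_cV_coord (fun v => v i 0) A (or_introl (ex_intro _ i erefl)) mA).
rewrite (_ : [set w | _] = incr (s + h) (t + h) i @^-1` A); last first.
  by apply/seteqP; split => w /=; rewrite !mxE.
rewrite (_ : [set w | _] = incr s t i @^-1` A) //.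
by apply/seteqP; split => w /=; rewrite !mxE.
Qed.

Lemma incr_sum_same_law s t h i j : s <= t ->
  same_law P (fun w => incr (s + h) (t + h) i w + incr (s + h) (t + h) j w)
             (fun w => incr s t i w + incr s t j w).
Proof.
move=> st A mA.
have := levy_stationary hL h st (@borel_cV_coord (fun v => v i 0 + v j 0) A
  (or_intror (ex_intro _ i (ex_intro _ j erefl))) mA).
rewrite (_ : [set w | _] = (fun w => incr (s + h) (t + h) i w + incr (s + h) (t + h) j w) @^-1` A); last first.
  by apply/seteqP; split => w /=; rewrite !mxE.
rewrite (_ : [set w | _] = (fun w => incr s t i w + incr s t j w) @^-1` A) //.
by apply/seteqP; split => w /=; rewrite !mxE.
Qed.

Lemma incr_independent a b c e i j : a <= b -> b <= c -> c <= e ->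
  independent_pair P (incr a b i) (incr c e j).
Proof.
move=> ab bc ce A B mA mB.
(* The gap between the two intervals is a third increment, with the sure event. *)
pose t k := nth e [:: a; b; c] k.
pose D k : set 'cV[R]_m := nth setT [:: [set v | A (v i 0)]; setT; [set v | B (v j 0)]] k.
have tm k : (k < 3)%N -> t k <= t k.+1 by case: k => [|[|[|]]].
have mT : borel_cV (setT : set 'cV[R]_m).
  exact: (@measurableT _ (g_sigma_algebraType
    [set C | exists (i : 'I_m) (A : set R),
         measurable A /\ C = [set v : 'cV[R]_m | A (v i 0)]])).
have mD k : borel_cV (D k).
  case: k => [|[|[|k]]] /=.
  - exact: (@borel_cV_coord (fun v => v i 0) A (or_introl (ex_intro _ i erefl)) mA).
  - exact: mT.
  - exact: (@borel_cV_coord (fun v => v j 0) B (or_introl (ex_intro _ j erefl)) mB).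
  - by rewrite /D /= nth_nil.
have := levy_independent hL tm mD.
rewrite !big_ord_recl big_ord0 /= /t /D /= mule1.
rewrite probability_setT mul1e.
rewrite (_ : \bigcap_(_ in _) _ = incr a b i @^-1` A `&` incr c e j @^-1` B); last first.
  apply/seteqP; split => w /=.
    by move=> H; have := H 0%N isT; have := H 2%N isT; rewrite /= !mxE.
  by case=> h1 h2 [|[|[|k]]] //= _; rewrite !mxE.
rewrite (_ : [set w | _] = incr a b i @^-1` A); last first.
  by apply/seteqP; split => w /=; rewrite !mxE.
rewrite (_ : [set w | _] = incr c e j @^-1` B) //.
by apply/seteqP; split => w /=; rewrite !mxE.
Qed.

Lemma sqint_L1 i : sqint P (fun w => L 1 w i 0).
Proof.
have mL t k : measurable_fun setT (fun w => L t w k 0) by exact: (levy_measurable hL).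
apply/sqint_ltyP; first exact: mL.
apply: le_lt_trans hL2; rewrite unlock; apply: ge0_le_integral => //.
- by move=> w _; rewrite lee_fin sqr_ge0.
- by apply/measurable_EFinP; apply: measurable_funX; exact: mL.
- by apply/measurable_EFinP; apply: measurable_sum => k; apply: measurable_funX; exact: mL.
- move=> w _; rewrite lee_fin (bigD1 i) //= lerDl sumr_ge0 // => k _; exact: sqr_ge0.
Qed.

Lemma L0_ae i : {ae P, forall w, L 0 w i 0 = 0}.
Proof. by have := levy0 hL; apply: filterS => w ->; rewrite mxE. Qed.

Lemma sqint_incr01 i : sqint P (incr 0 1 i) /\ mean P (incr 0 1 i) = 0.
Proof.
have s1 := sqint_L1 i; have ae : {ae P, forall w, L 1 w i 0 = incr 0 1 i w}.
  by have := L0_ae i; apply: filterS => w e; rewrite /incr e subr0.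
have s01 := sqint_ae_eq s1 (measurable_incr 0 1 i) ae.
split => //; rewrite -mean_ge0E.
rewrite (_ : (\int[P]_w (incr 0 1 i w)%:E = 0)%E) //.
rewrite -(hL1 i) unlock; apply: ae_eq_integral => //.
- by apply/measurable_EFinP; exact: measurable_incr.
- by apply/measurable_EFinP; case: s1.
- by apply: filterS ae => w -> _.
Qed.

Lemma incrD s t u i w : incr s u i w = incr s t i w + incr t u i w.
Proof. by rewrite /incr [RHS]addrC addrA subrK. Qed.

(** The increment over [0, 1] is the sum of this one and of an independent one. *)
Lemma sqint_incr_unit u i : 0 <= u -> u <= 1 -> sqint P (incr 0 u i).
Proof.
move=> u0 u1; apply: (@independent_sum_sqint _ (incr u 1 i)).
- exact: measurable_incr.
- exact: measurable_incr.
- exact: incr_independent.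
- have [s _] := sqint_incr01 i; rewrite (_ : (fun w => _) = incr 0 1 i) //.
  by apply/funext => w; rewrite -incrD.
Qed.

Lemma sqint_incr s t i : s <= t -> sqint P (incr s t i).
Proof.
move=> st.
have shift u v : 0 <= v -> sqint P (incr 0 v i) -> sqint P (incr u (v + u) i).
  move=> v0 sv; have sl := incr_same_law u i v0.
  rewrite add0r in sl; have sl' : same_law P (incr 0 v i) (incr u (v + u) i).
    by move=> A mA; rewrite sl.
  by have [] := same_law_sqint sv (measurable_incr _ _ _) sl'.
have mult n v : 0 <= v -> v <= 1 -> sqint P (incr 0 (n%:R * v) i).
  move=> v0 v1; elim: n => [|n IH].
    rewrite mul0r (_ : incr 0 0 i = fun=> 0); first exact: sqint0.
    by apply/funext => w; rewrite /incr subrr.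
  rewrite (_ : incr 0 _ i = fun w => incr 0 (n%:R * v) i w + incr (n%:R * v) (n.+1%:R * v) i w).
    apply: sqintD => //; rewrite -natr1 mulrDl mul1r addrC.
    by apply: shift => //; exact: sqint_incr_unit.
  by apply/funext => w; rewrite -incrD.
have d0 : 0 <= t - s by rewrite subr_ge0.
rewrite -(subrK s t); apply: shift => //.
pose n := (Num.truncn (t - s)).+1.
have n0 : 0 < n%:R :> R by rewrite ltr0n.
rewrite -[t - s]mulr1 -(divff (lt0r_neq0 n0)) mulrCA.
apply: mult; first by rewrite divr_ge0 // ltW.
by rewrite ler_pdivrMr // mul1r ltW // truncnS_gt.
Qed.

Definition imean i u := mean P (incr 0 u i).
Definition ivar i u := ip P (incr 0 u i) (incr 0 u i) - imean i u ^+ 2.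

Lemma incr_mean_shift s t i : s <= t -> mean P (incr s t i) = imean i (t - s).
Proof.
move=> st; have d0 : 0 <= t - s by rewrite subr_ge0.
have := incr_same_law s i d0; rewrite add0r subrK => sl.
exact: esym (same_law_mean (sqint_incr i st) (measurable_incr _ _ _) sl).
Qed.

Lemma imeanD i u v : 0 <= u -> 0 <= v -> imean i (u + v) = imean i u + imean i v.
Proof.
move=> u0 v0; have uv : u <= u + v by rewrite lerDl.
have := incr_mean_shift i uv; rewrite addrAC subrr add0r => <-.
rewrite /mean -ipDl; [|exact: sqint_incr|exact: sqint_incr|exact: sqint_cst].
by congr ip; apply/funext => w; rewrite -incrD.
Qed.

Lemma ivarD i u v : 0 <= u -> 0 <= v -> ivar i (u + v) = ivar i u + ivar i v.
Proof.
move=> u0 v0; have uv : u <= u + v by rewrite lerDl.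
have su := sqint_incr i u0; have sv := sqint_incr i v0; have suv := sqint_incr i uv.
have sl : same_law P (incr 0 v i) (incr u (u + v) i).
  have := incr_same_law u i v0; rewrite add0r addrC => sl A mA; by rewrite sl.
have [_ e1] := same_law_sqint sv (measurable_incr _ _ _) sl.
have e2 := same_law_mean sv (measurable_incr _ _ _) sl.
rewrite /ivar imeanD // (_ : incr 0 (u + v) i = fun w => incr 0 u i w + incr u (u + v) i w).
  have ind : independent_pair P (incr 0 u i) (incr u (u + v) i).
    by apply: incr_independent.
  by rewrite ip_sqrD // (independent_ip su suv ind) e1 e2 /imean; ring.
by apply/funext => w; rewrite -incrD.
Qed.

Lemma ivar_ge0 i u : 0 <= u -> 0 <= ivar i u.
Proof.
move=> u0; have := ip_cauchy_schwarz (sqint_incr i u0) (sqint_cst P 1).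
rewrite -/(mean P _) -/(imean i u) subr_ge0 => /le_trans; apply.
by rewrite ip11 mulr1.
Qed.

Lemma imean0 i : imean i 0 = 0.
Proof. by have := imeanD i (lexx 0) (lexx 0); rewrite addr0; lra. Qed.

Lemma imeanMn i u n : 0 <= u -> imean i (n%:R * u) = n%:R * imean i u.
Proof.
move=> u0; elim: n => [|n IH]; first by rewrite !mul0r imean0.
by rewrite -!natr1 !mulrDl !mul1r imeanD ?IH // mulr_ge0.
Qed.

Lemma ivar0 i : ivar i 0 = 0.
Proof. by have := ivarD i (lexx 0) (lexx 0); rewrite addr0; lra. Qed.

Lemma ivarMn i u n : 0 <= u -> ivar i (n%:R * u) = n%:R * ivar i u.
Proof.
move=> u0; elim: n => [|n IH]; first by rewrite !mul0r ivar0.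
by rewrite -!natr1 !mulrDl !mul1r ivarD ?IH // mulr_ge0.
Qed.

Lemma ivar_le i u v : 0 <= u -> u <= v -> ivar i u <= ivar i v.
Proof.
move=> u0 uv; rewrite -(subrK u v) addrC ivarD ?subr_ge0 //.
by rewrite lerDl ivar_ge0 // subr_ge0.
Qed.

Lemma imean_rat i a b : (0 < b)%N -> imean i (a%:R / b%:R) = 0.
Proof.
move=> b0; have bR : 0 < b%:R :> R by rewrite ltr0n.
have h0 : 0 <= b%:R^-1 :> R by rewrite invr_ge0 ltW.
rewrite imeanMn //; have := imeanMn i b h0.
rewrite divff ?lt0r_neq0 // (_ : imean i 1 = 0); last by have [] := sqint_incr01 i.
by move=> /esym/eqP; rewrite mulf_eq0 gt_eqF //= => /eqP ->; rewrite mulr0.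
Qed.

(** The means are additive in the length of the interval, hence vanish on
    rational lengths.  Were the mean at u equal to c, there would be positive
    lengths tending to 0 with mean -c and variance tending to 0; as the paths
    are right continuous, Fatou's lemma gives c = 0. *)
Lemma imean_eq0 i u : 0 <= u -> imean i u = 0.
Proof.
move=> u0; set c := imean i u.
pose del k : R := (Num.truncn (u * k.+1%:R)).+1%:R / k.+1%:R - u.
have del0 k : 0 < del k.
  rewrite subr_gt0 ltr_pdivlMr ?ltr0n //; exact: truncnS_gt.
have del1 k : del k <= k.+1%:R^-1.
  rewrite lerBlDr ler_pdivrMr ?ltr0n // mulrDl mulVf // -natr1 addrC lerD2l.
  by rewrite truncn_le mulr_ge0.
have delc k : imean i (del k) = - c.
  have := imeanD i u0 (ltW (del0 k)); rewrite -/c addrC subrK imean_rat //; lra.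
have delv k : ip P (incr 0 (del k) i) (incr 0 (del k) i) <= c ^+ 2 + ivar i 1 / k.+1%:R.
  have h0 : 0 <= k.+1%:R^-1 :> R by rewrite invr_ge0.
  have := ivarMn i k.+1 h0; rewrite divff // => e.
  have := ivar_le i (ltW (del0 k)) (del1 k).
  rewrite -[X in _ <= X](mulKf (_ : k.+1%:R != 0)) // -e [_^-1 * _]mulrC.
  by rewrite {1}/ivar delc sqrrN lerBlDl.
pose f k w := ((incr 0 (del k) i w + c) ^+ 2)%:E.
have mf k : measurable_fun setT (f k).
  apply/measurable_EFinP; apply: measurable_funX; apply: measurable_funD => //.
  exact: measurable_incr.
have If k : (\int[P]_w f k w <= (ivar i 1 / k.+1%:R)%:E)%E.
  have sk := sqint_incr i (ltW (del0 k)); have sc := sqint_cst P c.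
  rewrite -EFin_ip; last exact: sqintD.
  rewrite lee_fin ip_sqrD // !ip_cstr // mean_cst -/(imean i (del k)) delc.
  have := delv k; set A := ip _ _ _ => dk.
  by rewrite (_ : _ + c * c = A - c ^+ 2) ?lerBlDl //; ring.
pose g k w := (Num.min ((incr 0 (del k) i w + c) ^+ 2) 1)%:E.
have mg k : measurable_fun setT (g k).
  apply/measurable_EFinP; apply: measurable_minr; last exact: measurable_cst.
  by apply/measurable_EFinP; exact: mf.
have g0 k w : (0 <= g k w)%E by rewrite lee_fin le_min sqr_ge0 ler01.
have g1 k w : (`|g k w| <= 1%:E)%E by rewrite gee0_abs // lee_fin ge_min lexx orbT.
have gc : {ae P, forall w, [set: T] w -> g ^~ w @ \oo --> (Num.min (c ^+ 2) 1)%:E}.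
  have ae0 := L0_ae i; apply: filterS2 (levy_cadlag hL) ae0 => w cad e0 _.
  have [+ _] := cad 0 i; move=> /cvg_at_rightP /(_ del) cv.
  have dc : del k @[k --> \oo] --> 0.
    apply: (@squeeze_cvgr _ _ _ _ (fun=> 0) (fun k => k.+1%:R^-1)).
    - by near=> k; rewrite ltW //= del1.
    - exact: cvg_cst.
    - exact: cvg_harmonic.
  have {cv dc} cv := cv (conj del0 dc).
  apply: cvg_EFin; first by near=> k.
  have lin : incr 0 (del k) i w + c @[k --> \oo] --> c.
    suff : L (del k) w i 0 - L 0 w i 0 + c @[k --> \oo] --> L 0 w i 0 - L 0 w i 0 + c.
      by rewrite subrr add0r.
    by apply: cvgD; [apply: cvgB => //; exact: cvg_cst | exact: cvg_cst].
  have sq : (incr 0 (del k) i w + c) ^+ 2 @[k --> \oo] --> c ^+ 2.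
    by rewrite expr2; under eq_cvg do rewrite expr2; exact: cvgM.
  rewrite minr_absE (_ : _ \o _ = fun k => ((incr 0 (del k) i w + c) ^+ 2 + 1 -
      `|(incr 0 (del k) i w + c) ^+ 2 - 1|) / 2); last first.
    by apply/funext => k; rewrite /= minr_absE.
  apply: cvgM; last exact: cvg_cst.
  by apply: cvgB; [|apply: cvg_norm]; apply: cvgD => //; exact: cvg_cst.
have [_ _ cv] := dominated_convergence measurableT mg (measurable_cst _) gc
  (finite_measure_integrable_cst P 1 measurableT)
  (aeW P (fun w k _ => g1 k w)).
have Ic : (\int[P]_w (Num.min (c ^+ 2) 1)%:E = (Num.min (c ^+ 2) 1)%:E)%E.
  by have := expectation_cst P (Num.min (c ^+ 2) 1); rewrite unlock.
rewrite Ic in cv.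
suff : Num.min (c ^+ 2) 1 <= 0.
  by rewrite ge_min ler10 orbF => h; apply/eqP; rewrite -sqrf_eq0 eq_le h sqr_ge0.
apply/ler_addgt0Pr => e e0; rewrite add0r -lee_fin; apply: (cvge_to_le cv).
near=> k; rewrite /=; apply: (@le_trans _ _ (ivar i 1 / k.+1%:R)%:E).
  apply: le_trans (If k); apply: ge0_le_integral => //.
  by move=> w _; rewrite lee_fin ge_min lexx.
rewrite lee_fin ler_pdivrMr // mulrC -ler_pdivrMr //.
by apply: le_trans (_ : k%:R <= _); [near: k; exact: nbhs_infty_ger | rewrite ler_nat].
Unshelve. all: by end_near.
Qed.

Lemma incr_mean0 s t i : s <= t -> mean P (incr s t i) = 0.
Proof. by move=> st; rewrite incr_mean_shift // imean_eq0 // subr_ge0. Qed.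

Lemma incr_uncorrelated a b c e i j : a <= b -> b <= c -> c <= e ->
  ip P (incr a b i) (incr c e j) = 0.
Proof.
move=> ab bc ce; have sX := sqint_incr i ab; have sY := sqint_incr j ce.
by rewrite (independent_ip sX sY) ?incr_mean0 ?mul0r //; exact: incr_independent.
Qed.

(** Polarization: the square of the sum of two coordinates has a stationary mean. *)
Lemma incr_ip_shift s t h i j : s <= t ->
  ip P (incr (s + h) (t + h) i) (incr (s + h) (t + h) j) =
  ip P (incr s t i) (incr s t j).
Proof.
move=> st; have sth : s + h <= t + h by rewrite lerD2r.
have same k : ip P (incr (s + h) (t + h) k) (incr (s + h) (t + h) k) =
              ip P (incr s t k) (incr s t k).
  have [_ -> //] := same_law_sqint (sqint_incr k sth) (measurable_incr s t k)
    (incr_same_law h k st).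
have s1 := sqint_incr i sth; have s2 := sqint_incr j sth.
have s3 := sqint_incr i st; have s4 := sqint_incr j st.
have [_ e] := same_law_sqint (sqintD s1 s2)
  (measurable_funD (measurable_incr s t i) (measurable_incr s t j))
  (incr_sum_same_law h i j st).
have {}e : ip P (fun w => incr s t i w + incr s t j w)
                (fun w => incr s t i w + incr s t j w) = _ := e.
by rewrite (ip_sqrD s1 s2) (ip_sqrD s3 s4) !same in e; lra.
Qed.

Definition dL (s t : R) (w : T) : 'cV[R[i]]_m := toC (L t w - L s w).

Lemma dLE s t w i : dL s t w i 0 = (incr s t i w)%:C.
Proof. by rewrite !mxE. Qed.

Lemma dL_fun s t i : (fun w => dL s t w i 0) = (fun w => (incr s t i w)%:C).
Proof. by apply/funext => w; rewrite dLE. Qed.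

Lemma cip_real (X Y : T -> R) :
  cip P (fun w => (X w)%:C) (fun w => (Y w)%:C) = (ip P X Y)%:C.
Proof.
rewrite /cip /= ip0l [ip P X (fun=> 0)]ipC ip0l addr0 subr0.
by rewrite ip0l.
Qed.

Lemma sqint_dL s t : s <= t -> sqint_vec P (dL s t).
Proof.
by move=> st i; rewrite dL_fun; split; [exact: sqint_incr | exact: sqint_cst].
Qed.

Lemma cov_dL_mean s t : s <= t -> cov P (dL s t) (@one_vec _ T R) = 0.
Proof.
move=> st; apply/matrixP => i j; rewrite !mxE dL_fun ord1.
rewrite (_ : (fun w : T => one_vec R w 0 0) = fun=> 1%:C); last by apply/funext => w; rewrite mxE.
by rewrite cip_real -/(mean P _) incr_mean0 // mxE.
Qed.

Lemma cov_dL_disjoint a b c e : a <= b -> b <= c -> c <= e ->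
  cov P (dL a b) (dL c e) = 0.
Proof.
move=> ab bc ce; apply/matrixP => i j; rewrite !mxE !dL_fun cip_real.
by rewrite incr_uncorrelated.
Qed.

Lemma cov_dL_shift s t h : s <= t ->
  cov P (dL (s + h) (t + h)) (dL (s + h) (t + h)) = cov P (dL s t) (dL s t).
Proof.
move=> st; apply/matrixP => i j; rewrite !mxE !dL_fun !cip_real.
exact: (congr1 (fun x => x%:C) (incr_ip_shift h i j st)).
Qed.

Lemma dLD s t u w : dL s u w = dL s t w + dL t u w.
Proof.
apply/matrixP => i j; rewrite ord1 dLE mxE !dLE -rmorphD.
by congr (_%:C); exact: incrD.
Qed.

End LevyMoments.

(** * The matrix exponential *)

Section MatrixExponential.
Variables (R : realType) (d : nat).
Local Notation C := R[i].
Implicit Types M N : 'M[C]_d.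

(** The l^1 norm on the plane: submultiplicative, and compatible with the
    componentwise limits that define the exponential. *)
Definition modc (z : C) : R := `|complex.Re z| + `|complex.Im z|.

Lemma modc_ge0 z : 0 <= modc z.
Proof. exact: addr_ge0. Qed.

Lemma modc0 : modc 0 = 0.
Proof. by rewrite /modc normr0 addr0. Qed.

Lemma modc_le0 z : modc z <= 0 -> z = 0.
Proof.
move=> h; have : modc z == 0 by rewrite eq_le h modc_ge0.
rewrite /modc paddr_eq0 ?normr_ge0 // !normr_eq0 => /andP[/eqP a /eqP b].
by apply/eqP; rewrite eq_complex a b !eqxx.
Qed.

Lemma modcD y z : modc (y + z) <= modc y + modc z.
Proof. by rewrite /modc cReD cImD addrACA lerD // ler_normD. Qed.

Lemma modcM y z : modc (y * z) <= modc y * modc z.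
Proof.
rewrite /modc cReM cImM mulrDl !mulrDr -!normrM.
apply: le_trans (lerD (ler_normB _ _) (ler_normD _ _)) _.
by rewrite addrACA lerD // addrC.
Qed.

Lemma modc_nat_inv n : modc (n%:R^-1 : C) = n%:R^-1.
Proof.
rewrite (_ : (n%:R^-1 : C) = (n%:R^-1)%:C); last by rewrite fmorphV rmorph_nat.
by rewrite /modc /= normr0 addr0 ger0_norm // invr_ge0.
Qed.

Lemma modc_sum (I : Type) (r : seq I) (Q : pred I) (F : I -> C) :
  modc (\sum_(i <- r | Q i) F i) <= \sum_(i <- r | Q i) modc (F i).
Proof.
elim/big_ind2 : _ => //; first by rewrite modc0.
by move=> x1 x2 y1 y2 h1 h2; apply: le_trans (modcD _ _) _; exact: lerD.
Qed.

Definition mxmod a b (M : 'M[C]_(a, b)) : R := \sum_i \sum_j modc (M i j).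

Lemma mxmod_ge0 a b (M : 'M[C]_(a, b)) : 0 <= mxmod M.
Proof. by apply: sumr_ge0 => i _; apply: sumr_ge0 => j _; exact: modc_ge0. Qed.

Lemma modc_le_mxmod a b (M : 'M[C]_(a, b)) i j : modc (M i j) <= mxmod M.
Proof.
rewrite /mxmod (bigD1 i) //= (bigD1 j) //= -addrA lerDl addr_ge0 //.
  by apply: sumr_ge0 => l _; exact: modc_ge0.
by apply: sumr_ge0 => l _; apply: sumr_ge0 => k _; exact: modc_ge0.
Qed.

Lemma modc_mulmx a b e (M : 'M[C]_(a, b)) (N : 'M[C]_(b, e)) i j (x : R) :
  0 <= x -> (forall l, modc (N l j) <= x) -> modc ((M *m N) i j) <= mxmod M * x.
Proof.
move=> x0 Nx; rewrite mxE; apply: le_trans (modc_sum _ _ _) _.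
apply: (@le_trans _ _ ((\sum_l modc (M i l)) * x)).
  rewrite mulr_suml; apply: ler_sum => l _; apply: le_trans (modcM _ _) _.
  by rewrite ler_wpM2l ?modc_ge0.
apply: ler_wpM2r => //.
rewrite /mxmod (bigD1 i) //= lerDl; apply: sumr_ge0 => k _.
by apply: sumr_ge0 => k' _; exact: modc_ge0.
Qed.

Lemma modc_expr M k i j : modc ((M ^+ k : 'M[C]_d) i j) <= mxmod M ^+ k.
Proof.
elim: k i j => [|k IH] i j.
  rewrite !expr0 mxE /modc; case: (i == j) => /=; first by rewrite normr1 normr0 addr0.
  by rewrite !normr0 addr0.
rewrite !exprS; apply: modc_mulmx => [|l]; last exact: IH.
by rewrite exprn_ge0 ?mxmod_ge0.
Qed.

Definition ccvg (u : nat -> C) (l : C) : Prop :=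
  (complex.Re (u n) @[n --> \oo] --> complex.Re l) /\
  (complex.Im (u n) @[n --> \oo] --> complex.Im l).

Lemma ccvgD u v l k : ccvg u l -> ccvg v k -> ccvg (fun n => u n + v n) (l + k).
Proof.
move=> [u1 u2] [v1 v2]; split.
  rewrite cReD; under eq_cvg do rewrite cReD; exact: cvgD.
rewrite cImD; under eq_cvg do rewrite cImD; exact: cvgD.
Qed.

Lemma ccvgM u v l k : ccvg u l -> ccvg v k -> ccvg (fun n => u n * v n) (l * k).
Proof.
move=> [u1 u2] [v1 v2]; split.
  rewrite cReM; under eq_cvg do rewrite cReM; apply: cvgB; exact: cvgM.
rewrite cImM; under eq_cvg do rewrite cImM; apply: cvgD; exact: cvgM.
Qed.

Lemma ccvg_cst l : ccvg (fun=> l) l.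
Proof. by split; exact: cvg_cst. Qed.

Lemma ccvgN u l : ccvg u l -> ccvg (fun n => - u n) (- l).
Proof.
move=> [u1 u2]; split.
  rewrite cReN; under eq_cvg do rewrite cReN; exact: cvgN.
rewrite cImN; under eq_cvg do rewrite cImN; exact: cvgN.
Qed.

Lemma ccvg_sum (I : Type) (r : seq I) (F : I -> nat -> C) (l : I -> C) :
  (forall i, ccvg (F i) (l i)) ->
  ccvg (fun n => \sum_(i <- r) F i n) (\sum_(i <- r) l i).
Proof.
move=> Fl; elim: r => [|i r IH].
  by rewrite big_nil; under eq_fun do rewrite big_nil; exact: ccvg_cst.
by rewrite big_cons; under eq_fun do rewrite big_cons; exact: ccvgD.
Qed.

Lemma ccvg_unique u l k : ccvg u l -> ccvg u k -> l = k.
Proof.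
move=> [u1 u2] [v1 v2]; apply/eqP; rewrite eq_complex.
by rewrite (cvg_unique (@Rhausdorff R) u1 v1) (cvg_unique (@Rhausdorff R) u2 v2) !eqxx.
Qed.

Lemma ccvg_modc u l : ccvg u l -> modc (u n) @[n --> \oo] --> modc l.
Proof. by move=> [u1 u2]; apply: cvgD; exact: cvg_norm. Qed.

Lemma ccvg_squeeze0 u (b : nat -> R) : (forall n, modc (u n) <= b n) ->
  b n @[n --> \oo] --> 0 -> ccvg u 0.
Proof.
move=> ub b0.
have nb : (fun n => - b n) n @[n --> \oo] --> 0 by rewrite -oppr0; exact: cvgN.
split; apply: (squeeze_cvgr _ nb b0); near=> n; rewrite -ler_norml.
  by apply: le_trans (ub n); rewrite lerDl.
by apply: le_trans (ub n); rewrite lerDr.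
Unshelve. all: by end_near.
Qed.

Definition pexp n M : 'M[C]_d := \sum_(0 <= k < n) (k`!%:R)^-1 *: (M ^+ k).

Lemma pexpE n M i j : pexp n M i j =
  \sum_(0 <= k < n) (k`!%:R)^-1 * (M ^+ k : 'M[C]_d) i j.
Proof. by rewrite /pexp summxE; apply: eq_bigr => k _; rewrite mxE. Qed.

Lemma modc_pexp_term M i j k :
  modc ((k`!%:R)^-1 * (M ^+ k : 'M[C]_d) i j) <= exp_coeff (mxmod M) k.
Proof.
apply: le_trans (modcM _ _) _; rewrite modc_nat_inv /exp_coeff /= mulrC.
by rewrite ler_wpM2r ?invr_ge0 // modc_expr.
Qed.

Lemma series_dominated_cvg (u v : nat -> R) : (forall k, `|u k| <= v k) ->
  cvgn (series v) -> cvgn (series u).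
Proof.
move=> uv cv; apply: normed_cvg; apply: series_le_cvg cv => k //=; exact: le_trans (normr_ge0 _) (uv k).
Qed.

Lemma expm_cvg M i j : ccvg (fun n => pexp n M i j) (expm M i j).
Proof.
pose u k := (k`!%:R)^-1 * (M ^+ k : 'M[C]_d) i j.
have eRe : (fun n => complex.Re (\sum_(0 <= k < n) u k)) = series (fun k => complex.Re (u k)).
  by apply/funext => n; rewrite Re_sum.
have eIm : (fun n => complex.Im (\sum_(0 <= k < n) u k)) = series (fun k => complex.Im (u k)).
  by apply/funext => n; rewrite Im_sum.
rewrite mxE /clim; under eq_fun do rewrite pexpE; split; rewrite -/u /=.
  rewrite eRe; apply: series_dominated_cvg (is_cvg_series_exp_coeff (mxmod M)) => k.
  by apply: le_trans (modc_pexp_term M i j k); rewrite /modc lerDl.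
rewrite eIm; apply: series_dominated_cvg (is_cvg_series_exp_coeff (mxmod M)) => k.
by apply: le_trans (modc_pexp_term M i j k); rewrite /modc lerDr.
Qed.

Fact triangular_sum (V : zmodType) (G : nat -> nat -> V) n :
  \sum_(0 <= k < n) \sum_(0 <= a < k.+1) G a (k - a)%N =
  \sum_(0 <= a < n) \sum_(0 <= b < n - a) G a b.
Proof.
elim: n => [|n IH]; first by rewrite !big_geq.
rewrite big_nat_recr //= IH [RHS]big_nat_recr //= subSnn big_nat1.
rewrite [in LHS]big_nat_recr //= subnn addrA; congr (_ + _).
rewrite -big_split /=; apply: eq_big_nat => a /andP[_ an].
by rewrite subSn ?(ltnW an) // big_nat_recr.
Qed.

Fact square_minus_triangle (V : zmodType) (G : nat -> nat -> V) n :
  \sum_(0 <= a < n) \sum_(0 <= b < n) G a b -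
  \sum_(0 <= k < n) \sum_(0 <= a < k.+1) G a (k - a)%N =
  \sum_(0 <= a < n) \sum_(n - a <= b < n) G a b.
Proof.
rewrite triangular_sum -sumrB; apply: eq_big_nat => a _.
by rewrite (@big_cat_nat _ _ _ (n - a)) //= ?leq_subr // addrC addrK.
Qed.

Fact exprD_over_fact (K : numFieldType) (x y : K) k :
  (k`!%:R)^-1 * (x + y) ^+ k =
  \sum_(0 <= a < k.+1) (a`!%:R)^-1 * x ^+ a * ((k - a)`!%:R^-1 * y ^+ (k - a)).
Proof.
rewrite addrC exprDn mulr_sumr big_mkord; apply: eq_bigr => -[a /= ak] _.
have n0 l : l`!%:R != 0 :> K by rewrite pnatr_eq0 -lt0n fact_gt0.
rewrite -mulr_natr -(@bin_fact k a) // !natrM.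
have b0 : 'C(k, a)%:R != 0 :> K by rewrite pnatr_eq0 -lt0n bin_gt0.
by field; rewrite b0 !n0.
Qed.

Lemma exprZmx (x : C) M k : (x *: M) ^+ k = x ^+ k *: (M ^+ k : 'M[C]_d).
Proof.
elim: k => [|k IH]; first by rewrite !expr0 scale1r.
by rewrite !exprS IH -[_ * _]/(_ *m _) -scalemxAl -scalemxAr scalerA.
Qed.

(* The general term of the double series e^x e^y. *)
Definition exp_term (K : fieldType) (x y : K) a b : K :=
  (a`!%:R)^-1 * x ^+ a * (b`!%:R^-1 * y ^+ b).

Lemma pexpM n (x y : C) M : pexp n (x *: M) *m pexp n (y *: M) =
  \sum_(0 <= a < n) \sum_(0 <= b < n) exp_term x y a b *: (M ^+ (a + b) : 'M[C]_d).
Proof.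
rewrite /pexp mulmx_suml; apply: eq_bigr => a _.
rewrite mulmx_sumr; apply: eq_bigr => b _.
rewrite !exprZmx !scalerA -scalemxAl -scalemxAr scalerA exprD.
by [].
Qed.

Lemma pexpD n (x y : C) M : pexp n ((x + y) *: M) =
  \sum_(0 <= k < n) \sum_(0 <= a < k.+1)
    exp_term x y a (k - a) *: (M ^+ (a + (k - a)) : 'M[C]_d).
Proof.
apply: eq_bigr => k _; rewrite exprZmx scalerA exprD_over_fact scaler_suml.
by apply: eq_big_nat => a /andP[_ ak]; rewrite subnKC.
Qed.

Lemma exp_coeff_mul n (x y : R) : series (exp_coeff x) n * series (exp_coeff y) n =
  \sum_(0 <= a < n) \sum_(0 <= b < n) exp_term x y a b.
Proof.
rewrite /series /= mulr_suml; apply: eq_bigr => a _.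
rewrite mulr_sumr; apply: eq_bigr => b _.
by rewrite /exp_coeff /exp_term /= ![_^-1 * _]mulrC.
Qed.

Lemma exp_coeff_add n (x y : R) : series (exp_coeff (x + y)) n =
  \sum_(0 <= k < n) \sum_(0 <= a < k.+1) exp_term x y a (k - a).
Proof.
by rewrite /series /=; apply: eq_bigr => k _; rewrite /exp_coeff /= mulrC exprD_over_fact.
Qed.

Lemma modcX (z : C) k : modc (z ^+ k) <= modc z ^+ k.
Proof.
elim: k => [|k IH]; first by rewrite !expr0 /modc /= normr1 normr0 addr0.
rewrite !exprS; apply: le_trans (modcM _ _) _.
by rewrite ler_wpM2l ?modc_ge0.
Qed.

Lemma modc_exp_term (x y : C) M a b i j :
  modc ((exp_term x y a b *: (M ^+ (a + b) : 'M[C]_d)) i j) <=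
  exp_term (modc x * mxmod M) (modc y * mxmod M) a b.
Proof.
rewrite mxE; apply: le_trans (modcM _ _) _.
have h z k : modc ((k`!%:R)^-1 * z ^+ k) <= (k`!%:R)^-1 * modc z ^+ k.
  apply: le_trans (modcM _ _) _; rewrite modc_nat_inv.
  by rewrite ler_wpM2l ?invr_ge0 // modcX.
apply: (@le_trans _ _ (((a`!%:R)^-1 * modc x ^+ a) * ((b`!%:R)^-1 * modc y ^+ b) *
   mxmod M ^+ (a + b))).
  apply: ler_pM; rewrite ?modc_ge0 ?modc_expr //.
  apply: le_trans (modcM _ _) _.
  by apply: ler_pM; rewrite ?modc_ge0 ?h.
by rewrite /exp_term !exprMn exprD le_eqVlt; apply/orP; left; apply/eqP; ring.
Qed.

(** The Cauchy product: the defect between the product of the partial sums and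
    the partial sum of the exponential of x + y is dominated, term by term, by
    the corresponding defect for the scalar exponential, which tends to 0. *)
Lemma expmD (x y : C) M : expm (x *: M) *m expm (y *: M) = expm ((x + y) *: M).
Proof.
apply/matrixP => i j.
pose D n := (pexp n (x *: M) *m pexp n (y *: M) - pexp n ((x + y) *: M)) i j.
have cD : ccvg D ((expm (x *: M) *m expm (y *: M)) i j - expm ((x + y) *: M) i j).
  have -> : D = fun n => (pexp n (x *: M) *m pexp n (y *: M)) i j +
      - pexp n ((x + y) *: M) i j.
    by apply/funext => n; rewrite /D mxE [X in _ + X]mxE.
  apply: ccvgD; last by apply: ccvgN; exact: expm_cvg.
  rewrite mxE; under eq_fun do rewrite mxE.
  by apply: ccvg_sum => l; apply: ccvgM; exact: expm_cvg.
suff D0 : ccvg D 0.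
  by apply/eqP; rewrite -subr_eq0; apply/eqP; exact: ccvg_unique cD D0.
pose s := modc x * mxmod M; pose t := modc y * mxmod M.
apply: (@ccvg_squeeze0 _ (fun n => series (exp_coeff s) n * series (exp_coeff t) n -
    series (exp_coeff (s + t)) n)) => [n|].
  rewrite exp_coeff_mul exp_coeff_add square_minus_triangle.
  rewrite /D pexpM pexpD (square_minus_triangle (fun a b => exp_term x y a b *: (M ^+ (a + b)))).
  rewrite summxE; apply: le_trans (modc_sum _ _ _) _; apply: ler_sum => a _.
  rewrite summxE; apply: le_trans (modc_sum _ _ _) _; apply: ler_sum => b _.
  exact: modc_exp_term.
rewrite (_ : 0 = expR s * expR t - expR (s + t)); last by rewrite expRD subrr.
apply: cvgB; last exact: is_cvg_series_exp_coeff.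
by apply: cvgM; exact: is_cvg_series_exp_coeff.
Qed.

(** Comparison of the exponential series without its first term with the scalar
    one at the norm of M. *)
Lemma expm_near1 M i j : modc (expm M i j - (1%:M : 'M[C]_d) i j) <= expR (mxmod M) - 1.
Proof.
have c1 : ccvg (fun n => pexp n M i j - (1%:M : 'M[C]_d) i j)
               (expm M i j - (1%:M : 'M[C]_d) i j).
  by apply: ccvgD; [exact: expm_cvg | exact: ccvg_cst].
apply: (cvgr_to_le (ccvg_modc c1)); exists 1%N => // -[//|n] _ /=.
rewrite pexpE big_nat_recl // expr0 fact0 invr1 mul1r addrAC subrr add0r.
apply: le_trans (modc_sum _ _ _) _.
apply: (@le_trans _ _ (series (exp_coeff (mxmod M)) n.+1 - 1)).
  rewrite /series /= big_nat_recl // {1}/exp_coeff /= expr0 fact0 divr1 addrAC subrr add0r.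
  by apply: ler_sum => k _; exact: modc_pexp_term.
rewrite lerD2r; apply: nondecreasing_cvgn_le; last exact: is_cvg_series_exp_coeff.
apply/nondecreasing_seqP => k; rewrite /series /= big_nat_recr //= lerDl.
by rewrite exp_coeff_ge0 // mxmod_ge0.
Qed.

Lemma expm0 M : expm (0%:C *: M) = 1%:M.
Proof.
have h i j : modc (expm (0%:C *: M) i j - (1%:M : 'M[C]_d) i j) <= 0.
  apply: le_trans (expm_near1 _ _ _) _.
  rewrite scale0r (_ : mxmod _ = 0) ?expR0 ?subrr //.
  by apply: big1 => k _; apply: big1 => l _; rewrite mxE modc0.
apply/matrixP => i j; apply/eqP; rewrite -subr_eq0; apply/eqP.
exact: modc_le0.
Qed.

End MatrixExponential.

(** * Limits in mean square *)

Section MeanSquareLimits.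
Context (disp : measure_display) (T : measurableType disp) (R : realType).
Variable P : probability T R.

Lemma sqr_cvg0 (u v : nat -> R) : (forall n, u n ^+ 2 <= v n) ->
  v n @[n --> \oo] --> 0 -> u n @[n --> \oo] --> 0.
Proof.
move=> uv v0; apply/cvgrPdist_le => e e0.
have e2 : 0 < e ^+ 2 by rewrite exprn_gt0.
move/cvgrPdist_le : v0 => /(_ _ e2); apply: filterS => n.
rewrite !sub0r !normrN => vn.
rewrite -(ler_sqr (normr_ge0 _) (ltW e0)) real_normK ?num_real //.
by apply: le_trans (uv n) (le_trans (ler_norm _) vn).
Qed.

Definition l2cvg (Xn : nat -> T -> R) (X : T -> R) : Prop :=
  [/\ forall n, sqint P (Xn n), sqint P X &
      ip P (fun w => Xn n w - X w) (fun w => Xn n w - X w) @[n --> \oo] --> 0].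

Lemma l2cvg_ip (Xn Yn : nat -> T -> R) X Y : l2cvg Xn X -> l2cvg Yn Y ->
  ip P (Xn n) (Yn n) @[n --> \oo] --> ip P X Y.
Proof.
move=> [sXn sX cX] [sYn sY cY].
pose U n w := Xn n w - X w; pose V n w := Yn n w - Y w.
have sU n : sqint P (U n) by exact: sqintB.
have sV n : sqint P (V n) by exact: sqintB.
have c1 : ip P (U n) (V n) @[n --> \oo] --> 0.
  apply: (@sqr_cvg0 _ (fun n => ip P (U n) (U n) * ip P (V n) (V n))).
    by move=> n; exact: ip_cauchy_schwarz.
  by rewrite -(mulr0 0); exact: cvgM.
have c2 : ip P (U n) Y @[n --> \oo] --> 0.
  apply: (@sqr_cvg0 _ (fun n => ip P (U n) (U n) * ip P Y Y)).
    by move=> n; exact: ip_cauchy_schwarz.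
  by rewrite -(mul0r (ip P Y Y)); apply: cvgM => //; exact: cvg_cst.
have c3 : ip P X (V n) @[n --> \oo] --> 0.
  apply: (@sqr_cvg0 _ (fun n => ip P X X * ip P (V n) (V n))).
    by move=> n; exact: ip_cauchy_schwarz.
  by rewrite -(mulr0 (ip P X X)); apply: cvgM => //; exact: cvg_cst.
have -> : (fun n => ip P (Xn n) (Yn n)) =
    (fun n => ip P (U n) (V n) + ip P (U n) Y + ip P X (V n) + ip P X Y).
  apply/funext => n.
  have sUV := sU n; have sVV := sV n; have sXnn := sXn n; have sYnn := sYn n.
  by rewrite !ipBl // !ipBr //; ring.
rewrite [X in _ --> X](_ : _ = 0 + 0 + 0 + ip P X Y); last by rewrite !add0r.
by apply: cvgD; [apply: cvgD => //; apply: cvgD | exact: cvg_cst].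
Qed.

End MeanSquareLimits.

Section VectorMeanSquareLimits.
Context (disp : measure_display) (T : measurableType disp) (R : realType).
Variable P : probability T R.
Local Notation C := R[i].

Definition cl2cvg (Xs : nat -> T -> C) (X : T -> C) : Prop :=
  l2cvg P (fun k w => complex.Re (Xs k w)) (fun w => complex.Re (X w)) /\
  l2cvg P (fun k w => complex.Im (Xs k w)) (fun w => complex.Im (X w)).

Lemma l2cvg_cip (Xs Ys : nat -> T -> C) X Y : cl2cvg Xs X -> cl2cvg Ys Y ->
  ccvg (fun n => cip P (Xs n) (Ys n)) (cip P X Y).
Proof.
move=> [x1 x2] [y1 y2]; rewrite /cip; split => /=.
  by apply: cvgD; exact: l2cvg_ip.
by apply: cvgB; exact: l2cvg_ip.
Qed.

Definition l2cvg_vec n (Xs : nat -> T -> 'cV[C]_n) (X : T -> 'cV[C]_n) : Prop :=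
  forall i, cl2cvg (fun k w => Xs k w i 0) (fun w => X w i 0).

Lemma l2cvg_vec_cst n (X : T -> 'cV[C]_n) : sqint_vec P X -> l2cvg_vec (fun=> X) X.
Proof.
move=> sX i; have [s1 s2] := sX i; split; split => //.
  rewrite (_ : (fun n => ip _ _ _) = fun=> 0); first exact: cvg_cst.
  apply/funext => k; rewrite -[RHS](ip0l P (fun=> 0)).
  by congr ip; apply/funext => w; rewrite subrr.
rewrite (_ : (fun n => ip _ _ _) = fun=> 0); first exact: cvg_cst.
apply/funext => k; rewrite -[RHS](ip0l P (fun=> 0)).
by congr ip; apply/funext => w; rewrite subrr.
Qed.

Lemma l2cvg_vec_sqint n (Xs : nat -> T -> 'cV[C]_n) X : l2cvg_vec Xs X -> sqint_vec P X.
Proof. by move=> c i; have [[_ ? _] [_ ? _]] := c i. Qed.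

(** By continuity of the inner product; second moments of stochastic integrals
    are computed on their discrete approximations and transferred by this lemma. *)
Lemma cov_limit_eq a b (Xs : nat -> T -> 'cV[C]_a) X (Ys : nat -> T -> 'cV[C]_b) Y
   (Xs' : nat -> T -> 'cV[C]_a) X' (Ys' : nat -> T -> 'cV[C]_b) Y' :
  l2cvg_vec Xs X -> l2cvg_vec Ys Y -> l2cvg_vec Xs' X' -> l2cvg_vec Ys' Y' ->
  (forall n, cov P (Xs n) (Ys n) = cov P (Xs' n) (Ys' n)) ->
  cov P X Y = cov P X' Y'.
Proof.
move=> cX cY cX' cY' e; apply/matrixP => i j; rewrite !mxE.
have c1 := l2cvg_cip (cX i) (cY j); have c2 := l2cvg_cip (cX' i) (cY' j).
apply: ccvg_unique c1 _; rewrite (_ : (fun n => _) =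
  (fun n => cip P (fun w => Xs' n w i 0) (fun w => Ys' n w j 0))) //.
by apply/funext => n; have /matrixP/(_ i j) := e n; rewrite !mxE.
Qed.

End VectorMeanSquareLimits.

(** * Innovations of the steady-state filter *)

Section SteadyStateFilter.
Context (disp : measure_display) (T : measurableType disp) (R : realType).
Variable P : probability T R.
Local Notation C := R[i].
Variables (N d p : nat) (F Q S : 'M[C]_N) (H : 'M[C]_(d, N)) (K : 'M[C]_(N, d)).
Hypothesis p_gt0 : (0 < p)%N.
Hypothesis Fp0 : F ^+ p = 0.
Hypothesis gainK : optimal_gain H S K.
Hypothesis fixS : riccati_update F Q H K S = S.

(* w 0 is the initial prediction error and w n, for positive n, the noise; one
   sequence for both makes their joint uncorrelatedness a single hypothesis. *)
Variable w : nat -> T -> 'cV[C]_N.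
Hypothesis sqint_w : forall n, sqint_vec P (w n).
Hypothesis mean_w : forall n, cov P (w n) (@one_vec _ T R) = 0.
Hypothesis cov_w : forall n k, n != k -> cov P (w n) (w k) = 0.
Hypothesis cov_w0 : cov P (w 0%N) (w 0%N) = S.
Hypothesis cov_wn : forall n, cov P (w n.+1) (w n.+1) = Q.

(** The error of the one-step prediction of the state.  Driving it directly by the
    noise defines the innovations without a sequence of predictors. *)
Fixpoint pred_error (n : nat) : T -> 'cV[C]_N :=
  if n is k.+1 then
    fun z => (F *m (1%:M - K *m H)) *m pred_error k z + w k.+1 z
  else w 0%N.

Definition innovation (n : nat) (z : T) : 'cV[C]_d := H *m pred_error n z.

Lemma sqint_pred_error n : sqint_vec P (pred_error n).
Proof.
elim: n => [|n IH] /=; first exact: sqint_w.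
by apply: sqint_vecD; [exact: sqint_vecM | exact: sqint_w].
Qed.

Lemma cov_pred_error_noise n k : (n < k)%N -> cov P (pred_error n) (w k) = 0.
Proof.
elim: n => [|n IH] nk /=; first by rewrite cov_w // ltn_eqF.
have sp := sqint_pred_error n; have sw := sqint_w.
rewrite covDl //; last exact: sqint_vecM.
by rewrite covMl // IH ?(ltnW nk) // mulmx0 add0r cov_w // ltn_eqF.
Qed.

(** Stationarity: S is a fixed point of the Riccati update. *)
Lemma cov_pred_error n : cov P (pred_error n) (pred_error n) = S.
Proof.
elim: n => [|n IH] //=; have sp := sqint_pred_error n; have sw := sqint_w.
set A := F *m _; have sA : sqint_vec P (fun z => A *m pred_error n z) by exact: sqint_vecM.
have c0 := cov_pred_error_noise (ltnSn n).
have c0' : cov P (w n.+1) (pred_error n) = 0 by rewrite -cov_adj c0 adjmx0.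
rewrite covDl ?covDr //; try exact: sqint_vecD.
rewrite !covMl // !covMr // c0 c0' IH mulmx0 mul0mx addr0 add0r cov_wn.
by rewrite -[RHS]fixS /riccati_update /A adjmx_mul !mulmxA.
Qed.

(** The optimal gain makes the filtered error orthogonal to the innovation. *)
Lemma cov_pred_error_innovation n k : (n < k)%N ->
  cov P (pred_error k) (innovation n) = 0.
Proof.
have sp := sqint_pred_error; have sw := sqint_w.
elim: k => // k IH; rewrite ltnS leq_eqVlt => nk /=.
have si : sqint_vec P (innovation n) by exact: sqint_vecM.
rewrite covDl //; last exact: sqint_vecM.
have -> : cov P (w k.+1) (innovation n) = 0.
  rewrite covMr // -cov_adj cov_pred_error_noise ?adjmx0 ?mul0mx //.
  by rewrite ltnS leq_eqVlt.
rewrite addr0 covMl //; case/orP: nk => [/eqP <-|nk]; last by rewrite IH ?mulmx0.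
rewrite covMr // cov_pred_error -!mulmxA (mulmxA _ S).
by rewrite (optimal_gain_orth gainK) mulmx0.
Qed.

(** Innovations are orthogonal because later prediction errors are orthogonal to
    earlier innovations, and their covariance H S (adj H) does not depend on time. *)
Lemma innovation_white : weak_white_noise P innovation.
Proof.
have sp := sqint_pred_error; have sw := sqint_w.
have si n : sqint_vec P (innovation n) by exact: sqint_vecM.
have mp n : cov P (pred_error n) (@one_vec _ T R) = 0.
  elim: n => [|n IH] /=; first exact: mean_w.
  have s1 : sqint_vec P (@one_vec _ T R) by exact: sqint_vec_cst.
  by rewrite covDl ?covMl ?IH ?mulmx0 ?add0r ?mean_w //; exact: sqint_vecM.
have mi n : cov P (innovation n) (@one_vec _ T R) = 0.
  by rewrite covMl ?mp ?mulmx0 //; exact: sqint_vec_cst.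
split.
- move=> n _; have [c1 c2] := sqint_vec_crandom (si n).
  by split => //; rewrite mexpectation_cov.
- move=> n k _ _ nk; rewrite ccovariance_cov //.
  have : (n < k)%N || (k < n)%N by rewrite -neq_ltn.
  case/orP => lt.
    by rewrite -cov_adj covMl // cov_pred_error_innovation // mulmx0 adjmx0.
  by rewrite covMl // cov_pred_error_innovation // mulmx0.
- exists (H *m S *m adjmx H) => n _; rewrite ccovariance_cov //.
  by rewrite covMl // covMr // cov_pred_error mulmxA.
Qed.

(* Starting the state at 0 instead of a stationary value is harmless: F forgets
   the initial value after p steps. *)
Fixpoint state (n : nat) : T -> 'cV[C]_N :=
  if n is k.+1 then fun z => F *m state k z + w k.+1 z else fun=> 0.

Lemma state_sum n z : state n z = \sum_(0 <= j < n) F ^+ j *m w (n - j) z.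
Proof.
elim: n => [|n IH] /=; first by rewrite big_geq.
rewrite IH big_nat_recl // subn0 expr0 mul1mx addrC; congr (_ + _).
rewrite mulmx_sumr; apply: eq_bigr => j _.
by rewrite subSS exprS mulmxA.
Qed.

(** The predicted state is fed by the innovations only. *)
Lemma predicted_stateS n z : state n.+1 z - pred_error n.+1 z =
  F *m (state n z - pred_error n z) + F *m K *m innovation n z.
Proof.
rewrite /= /innovation opprD addrACA subrr addr0.
move: (state n z) (pred_error n z) => x e.
by rewrite !mulmxBr !mulmxBl mulmx1 opprB addrCA addrC !mulmxA.
Qed.

Lemma predicted_state_sum n z : state n z - pred_error n z =
  - (F ^+ n *m w 0%N z) + \sum_(0 <= j < n) F ^+ j.+1 *m K *m innovation (n - j.+1) z.
Proof.
elim: n => [|n IH]; first by rewrite big_geq // addr0 expr0 mul1mx /= add0r.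
rewrite predicted_stateS IH mulmxDr mulmxN mulmxA exprS -addrA; congr (_ + _).
rewrite big_nat_recl //= subn1 expr1 addrC; congr (_ + _).
rewrite mulmx_sumr; apply: eq_bigr => j _.
by rewrite subSS [in RHS]exprS !mulmxA.
Qed.

Lemma nilpotent_ge n : (p <= n)%N -> F ^+ n = 0.
Proof. by move=> pn; rewrite -(subnK pn) exprD Fp0 mulr0. Qed.

(** H F^j is applied to the past innovations weighted by the gain; at lag 0 the
    innovation is the prediction error of the observation itself. *)
Definition ma_coef (j : nat) : 'M[C]_d := if j == 0%N then 1%:M else H *m F ^+ j *m K.

(** The predicted state is driven by the past innovations through the nilpotent
    matrix F, which forgets its initial value after p steps. *)
Lemma innovation_representation n z : (p <= n)%N ->
  \sum_(j < p) H *m F ^+ j *m w (n - j) z = backshift_poly p.-1 ma_coef innovation n z.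
Proof.
move=> pn; rewrite /backshift_poly prednK //.
have trunc (V : zmodType) (G : nat -> V) : (forall j, (p <= j)%N -> G j = 0) ->
    \sum_(0 <= j < n) G j = \sum_(0 <= j < p) G j.
  move=> G0; rewrite (@big_cat_nat _ _ _ p) //= [X in _ + X]big_nat_cond.
  by rewrite [X in _ + X]big1 ?addr0 // => j /andP[/andP[pj _] _]; exact: G0.
have Hx : \sum_(j < p) H *m F ^+ j *m w (n - j) z = H *m state n z.
  rewrite state_sum mulmx_sumr trunc => [|j pj].
    by rewrite big_mkord; apply: eq_bigr => j _; rewrite mulmxA.
  by rewrite nilpotent_ge // mul0mx mulmx0.
rewrite {}Hx -[state n z](subrK (pred_error n z)) predicted_state_sum.
rewrite nilpotent_ge // mul0mx oppr0 add0r trunc => [|j pj]; last first.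
  by rewrite nilpotent_ge ?mul0mx // (leq_trans pj).
rewrite mulmxDr mulmx_sumr addrC -(big_mkord xpredT (fun j => ma_coef j *m innovation (n - j) z)).
rewrite -(prednK p_gt0) [RHS]big_nat_recl // {1}/ma_coef eqxx mul1mx subn0.
congr (_ + _); rewrite big_nat_recr //= prednK // Fp0 mul0mx mul0mx mulmx0 addr0.
by apply: eq_bigr => j _; rewrite /ma_coef /= !mulmxA.
Qed.

End SteadyStateFilter.

(** * Sums over uniform partitions *)

Section GridSums.
Context (disp : measure_display) (T : measurableType disp) (R : realType).
Variable P : probability T R.
Local Notation C := R[i].
Variables (m : nat) (L : R -> T -> 'cV[R]_m).
Hypothesis hL : levy_process P L.
Hypothesis hL2 : ('E_P[fun w => (\sum_(i < m) (L 1 w i 0) ^+ 2)%R] < +oo)%E.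
Hypothesis hL1 : forall i : 'I_m, ('E_P[fun w => L 1%R w i 0%R] = 0)%E.
Variables (h : R) (h_gt0 : 0 < h).

Definition gridpt (M k : nat) : R := k%:R * (h / M%:R).

Definition dLgrid (M k : nat) : T -> 'cV[C]_m := dL L (gridpt M k) (gridpt M k.+1).

Lemma gridpt_le M k l : (k <= l)%N -> gridpt M k <= gridpt M l.
Proof. by move=> kl; rewrite ler_wpM2r ?ler_nat // divr_ge0 // ltW. Qed.

Lemma sqint_dLgrid M k : sqint_vec P (dLgrid M k).
Proof. by apply: (sqint_dL hL hL2 hL1); exact: gridpt_le. Qed.

Lemma cov_dLgrid M k l : k != l -> cov P (dLgrid M k) (dLgrid M l) = 0.
Proof.
move=> kl; have : (k < l)%N || (l < k)%N by rewrite -neq_ltn.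
case/orP => lt.
  by apply: (cov_dL_disjoint hL hL2 hL1); exact: gridpt_le.
by rewrite -cov_adj (cov_dL_disjoint hL hL2 hL1) ?adjmx0 //; exact: gridpt_le.
Qed.

Definition cov_step M := cov P (dLgrid M 0) (dLgrid M 0).

Lemma cov_dLgrid_diag M k : cov P (dLgrid M k) (dLgrid M k) = cov_step M.
Proof.
have e0 : gridpt M 0 + gridpt M k = gridpt M k by rewrite /gridpt mul0r add0r.
have e1 : gridpt M 1 + gridpt M k = gridpt M k.+1.
  by rewrite /gridpt -mulrDl -natrD add1n.
have := cov_dL_shift hL hL2 hL1 (gridpt M k) (gridpt_le M (leq0n 1)).
by rewrite e0 e1.
Qed.

Lemma cov_suml a b (I : Type) (r : seq I) (U : I -> T -> 'cV[C]_a) (W : T -> 'cV[C]_b) :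
  (forall i, sqint_vec P (U i)) -> sqint_vec P W ->
  sqint_vec P (fun w => \sum_(i <- r) U i w) /\
  cov P (fun w => \sum_(i <- r) U i w) W = \sum_(i <- r) cov P (U i) W.
Proof.
move=> sU sW; elim: r => [|i r [IH1 IH2]].
  rewrite (_ : (fun w => _) = fun=> 0); last by apply/funext => w; rewrite big_nil.
  by rewrite big_nil cov_cst0l; split => //; exact: sqint_vec_cst.
rewrite (_ : (fun w => _) = fun w => U i w + \sum_(j <- r) U j w); last first.
  by apply/funext => w; rewrite big_cons.
by split; [exact: sqint_vecD | rewrite covDl // IH2 big_cons].
Qed.

Lemma cov_sumr a b (I : Type) (r : seq I) (U : I -> T -> 'cV[C]_a) (W : T -> 'cV[C]_b) :
  (forall i, sqint_vec P (U i)) -> sqint_vec P W ->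
  cov P W (fun w => \sum_(i <- r) U i w) = \sum_(i <- r) cov P W (U i).
Proof.
move=> sU sW; rewrite -cov_adj (cov_suml r sU sW).2.
elim: r => [|i r IH]; first by rewrite !big_nil adjmx0.
by rewrite !big_cons adjmxD IH cov_adj.
Qed.

(** The piece of the partition of step h / M lying in [n h, (n + 1) h]: it starts
    at the grid point of index n M. *)
Definition gridsum D (n M : nat) (phi : nat -> 'M[C]_(D, m)) (w : T) : 'cV[C]_D :=
  \sum_(0 <= j < M) phi j *m dLgrid M (n * M + j) w.

Lemma sqint_gridsum D n M (phi : nat -> 'M[C]_(D, m)) : sqint_vec P (gridsum n M phi).
Proof.
have s1 : sqint_vec P (@one_vec _ T R) by exact: sqint_vec_cst.
apply: (cov_suml (index_iota 0 M) (U := fun j w => phi j *m dLgrid M (n * M + j) w) _ s1).1.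
by move=> j; apply: sqint_vecM; exact: sqint_dLgrid.
Qed.

Lemma cov_gridsum D D' n n' M (phi : nat -> 'M[C]_(D, m)) (psi : nat -> 'M[C]_(D', m)) :
  cov P (gridsum n M phi) (gridsum n' M psi) =
  if n == n' then \sum_(0 <= j < M) phi j *m cov_step M *m adjmx (psi j) else 0.
Proof.
have sd j : sqint_vec P (dLgrid M j) by exact: sqint_dLgrid.
have sp k j : sqint_vec P (fun w => phi j *m dLgrid M (k * M + j) w) by exact: sqint_vecM.
have sq k j : sqint_vec P (fun w => psi j *m dLgrid M (k * M + j) w) by exact: sqint_vecM.
have sg := sqint_gridsum.
rewrite {1}/gridsum (cov_suml _ (sp n) (sg _ n' M psi)).2.
have E j : cov P (fun w => phi j *m dLgrid M (n * M + j) w) (gridsum n' M psi) =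
    \sum_(0 <= l < M) phi j *m cov P (dLgrid M (n * M + j)) (dLgrid M (n' * M + l)) *m adjmx (psi l).
  rewrite /gridsum (cov_sumr _ (sq n') (sp n j)); apply: eq_bigr => l _.
  by rewrite covMr // covMl // mulmxA.
rewrite (eq_bigr _ (fun j _ => E j)).
have [<-|nn'] := eqVneq n n'.
  apply: eq_big_nat => j /andP[_ jM].
  rewrite (bigD1_seq j) ?mem_index_iota ?iota_uniq //= cov_dLgrid_diag big1 ?addr0 // => l lj.
  by rewrite cov_dLgrid ?mulmx0 ?mul0mx // eqn_add2l eq_sym.
rewrite big_nat_cond big1 // => j /andP[/andP[_ jM] _].
rewrite big_nat_cond big1 // => l /andP[/andP[_ lM] _].
rewrite cov_dLgrid ?mulmx0 ?mul0mx //.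
apply: contra nn' => /eqP e; have M0 : (0 < M)%N by exact: leq_ltn_trans jM.
have := congr1 (divn^~ M) e.
by rewrite !divnMDl // !divn_small // !addn0 => ->.
Qed.

Lemma cov_gridsum_mean D n M (phi : nat -> 'M[C]_(D, m)) :
  cov P (gridsum n M phi) (@one_vec _ T R) = 0.
Proof.
have s1 : sqint_vec P (@one_vec _ T R) by exact: sqint_vec_cst.
have sd j : sqint_vec P (dLgrid M j) by exact: sqint_dLgrid.
have sp j : sqint_vec P (fun w => phi j *m dLgrid M (n * M + j) w) by exact: sqint_vecM.
rewrite (cov_suml _ sp s1).2 big1 // => j _.
by rewrite covMl // (cov_dL_mean hL hL2 hL1) ?mulmx0 //; exact: gridpt_le.
Qed.

Lemma cov_gridsum_past D D' n M (phi : nat -> 'M[C]_(D, m)) (U : T -> 'cV[C]_D') :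
  sqint_vec P U -> (forall k, cov P (dLgrid M k) U = 0) ->
  cov P (gridsum n M phi) U = 0.
Proof.
move=> sU U0.
have sd j : sqint_vec P (dLgrid M j) by exact: sqint_dLgrid.
have sp j : sqint_vec P (fun w => phi j *m dLgrid M (n * M + j) w) by exact: sqint_vecM.
by rewrite (cov_suml _ sp sU).2 big1 // => j _; rewrite covMl // U0 mulmx0.
Qed.

Lemma dLgrid_telescope M a b w : (a <= b)%N ->
  \sum_(a <= j < b) dLgrid M j w = dL L (gridpt M a) (gridpt M b) w.
Proof.
move=> ab; rewrite -(subnKC ab); elim: (b - a)%N => [|k IH].
  rewrite addn0 big_geq //; apply/matrixP => i j.
  by rewrite !mxE subrr.
by rewrite addnS big_nat_recr ?leq_addr //= IH /dLgrid -dLD.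
Qed.

Lemma gridpt_refine N r k : (0 < r)%N -> gridpt (N * r) (k * r) = gridpt N k.
Proof.
move=> r0; rewrite /gridpt natrM natrM invfM.
have : r%:R != 0 :> R by rewrite pnatr_eq0 -lt0n.
have [->|N0] := eqVneq N 0%N; first by rewrite invr0 mul0r !mulr0.
have : N%:R != 0 :> R by rewrite pnatr_eq0.
by move=> *; field; apply/andP.
Qed.

Lemma dLgrid_refine N r k w : (0 < r)%N ->
  dLgrid N k w = \sum_(k * r <= j < k.+1 * r) dLgrid (N * r) j w.
Proof.
move=> r0; rewrite dLgrid_telescope ?leq_mul2r ?leqnSn ?orbT //.
by rewrite !gridpt_refine.
Qed.

(** Increments over coarse pieces add up from fine ones; sums over nested partitions
    can then be compared integrand by integrand. *)
Lemma gridsum_refine D n N r (phi : nat -> 'M[C]_(D, m)) w : (0 < r)%N ->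
  gridsum n N phi w = gridsum n (N * r) (fun j => phi (j %/ r)%N) w.
Proof.
move=> r0; rewrite /gridsum big_nat_mul; apply: eq_big_nat => j /andP[_ jN].
rewrite (dLgrid_refine _ _ _ r0) mulmx_sumr.
have -> : ((n * N + j) * r = j * r + n * (N * r))%N by rewrite mulnDl addnC mulnA.
have -> : ((n * N + j).+1 * r = j.+1 * r + n * (N * r))%N.
  by rewrite -addnS mulnDl addnC mulnA.
rewrite big_addn addnK; apply: eq_big_nat => i /andP[i1 i2].
have -> : (i %/ r = j)%N by apply/eqP; rewrite eqn_leq leq_divRL // i1 -ltnS ltn_divLR // i2.
by rewrite addnC.
Qed.

Lemma cov_stepM M : (0 < M)%N -> cov P (dL L 0 h) (dL L 0 h) = cov_step M *+ M.
Proof.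
move=> M0; have e : dL L 0 h = gridsum 0 M (fun=> 1%:M : 'M[C]_m).
  apply/funext => w; rewrite /gridsum; under eq_bigr do rewrite mul1mx add0n.
  rewrite dLgrid_telescope // /gridpt mul0r mulrCA divff ?mulr1 //.
  by rewrite pnatr_eq0 -lt0n.
rewrite e cov_gridsum eqxx; under eq_bigr do rewrite adjmx1 mulmx1 mul1mx.
by rewrite sumr_const_nat subn0.
Qed.

End GridSums.

(** * Modulus of continuity of the integrand *)

Section IntegrandModulus.
Variables (R : realType) (d m : nat).
Local Notation C := R[i].
Implicit Types (S : 'M[C]_d) (Cm : 'M[C]_(d, m)).

Fact mxBE a b (M N : 'M[C]_(a, b)) i j : (M - N) i j = M i j - N i j.
Proof. by rewrite !mxE. Qed.

Lemma mxmod_realZ a b (u : R) (M : 'M[C]_(a, b)) : mxmod (u%:C *: M) <= `|u| * mxmod M.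
Proof.
rewrite /mxmod mulr_sumr; apply: ler_sum => i _.
rewrite mulr_sumr; apply: ler_sum => j _; rewrite mxE.
apply: le_trans (modcM _ _) _.
by rewrite {1}/modc /= normr0 addr0.
Qed.

Lemma mxmod_bound a b (M : 'M[C]_(a, b)) (x : R) :
  (forall i j, modc (M i j) <= x) -> mxmod M <= (a * b)%:R * x.
Proof.
move=> Mx; apply: (@le_trans _ _ (\sum_(i < a) \sum_(j < b) x)).
  by apply: ler_sum => i _; apply: ler_sum => j _.
by rewrite !sumr_const !card_ord -mulrnA mulr_natl mulnC.
Qed.

Lemma expm_diff1_bound S (u e : R) i j : 0 <= u -> u <= e ->
  modc ((expm (u%:C *: S) - 1%:M) i j) <= expR (e * mxmod S) - 1.
Proof.
move=> u0 ue; rewrite mxBE.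
apply: le_trans (expm_near1 _ _ _) _; rewrite lerD2r ler_expR.
apply: le_trans (mxmod_realZ _ _) _; rewrite ger0_norm //.
by rewrite ler_wpM2r ?mxmod_ge0.
Qed.

Lemma expm_bound S (u e : R) i j : 0 <= u -> u <= e ->
  modc (expm (u%:C *: S) i j) <= expR (e * mxmod S).
Proof.
move=> u0 ue.
have -> : expm (u%:C *: S) i j = (expm (u%:C *: S) - 1%:M) i j + (1%:M : 'M[C]_d) i j.
  by rewrite mxBE subrK.
have i1 : modc ((1%:M : 'M[C]_d) i j) <= 1.
  rewrite mxE /modc; case: (i == j) => /=; first by rewrite normr1 normr0 addr0.
  by rewrite !normr0 addr0.
apply: le_trans (modcD _ _) _; rewrite -[X in _ <= X](subrK 1).
by apply: lerD i1; exact: expm_diff1_bound.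
Qed.

Definition modulus_const S Cm (h : R) : R :=
  (d * d)%:R * ((d * d)%:R * expR (h * mxmod S) * mxmod Cm).

(** exp (u S) - exp (u' S) = (exp ((u - u') S) - 1) exp (u' S), and the second factor
    is bounded on [0, h]. *)
Lemma expm_mul_modulus S Cm (h u u' e : R) i b : 0 <= u' -> u' <= u -> u <= h -> u - u' <= e ->
  modc ((expm (u%:C *: S) *m Cm - expm (u'%:C *: S) *m Cm) i b) <=
  modulus_const S Cm h * (expR (e * mxmod S) - 1).
Proof.
move=> u'0 u'u uh ue; have u0 : 0 <= u - u' by rewrite subr_ge0.
have -> : expm (u%:C *: S) *m Cm - expm (u'%:C *: S) *m Cm =
    (expm ((u - u')%:C *: S) - 1%:M) *m (expm (u'%:C *: S) *m Cm).
  have := expmD (u - u')%:C u'%:C S; rewrite -rmorphD subrK => <-.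
  by rewrite mulmxBl mul1mx -mulmxA.
apply: le_trans (@modc_mulmx _ _ _ _ _ _ _ _
  ((d * d)%:R * expR (h * mxmod S) * mxmod Cm) _ _) _.
- by rewrite !mulr_ge0 ?mxmod_ge0 ?expR_ge0.
- move=> l; apply: le_trans (modc_mulmx (x := mxmod Cm) _ _ _ _) _.
  + exact: mxmod_ge0.
  + by move=> k; exact: modc_le_mxmod.
  rewrite ler_wpM2r ?mxmod_ge0 //; apply: mxmod_bound => k k'.
  by apply: expm_bound => //; exact: le_trans uh.
rewrite /modulus_const [X in _ <= X]mulrAC.
rewrite ler_wpM2r ?mulr_ge0 ?mxmod_ge0 ?expR_ge0 //.
by apply: mxmod_bound => k k'; exact: expm_diff1_bound.
Qed.

End IntegrandModulus.

Section Integrand.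
Variables (R : realType) (d m p : nat).
Local Notation C := R[i].
Variables (S : 'I_p -> 'M[C]_d) (Cm : 'I_p -> 'M[C]_(d, m)) (h : R).
Hypothesis h_gt0 : 0 < h.

Definition integrand (u : R) : 'M[C]_(\sum_(k < p) d, m) :=
  \mxcol_(k < p) (expm (u%:C *: S k) *m Cm k).

Definition phi (N j : nat) := integrand (h - gridpt h N j).

(** A modulus of continuity common to all entries, for arguments at distance h / N. *)
Definition omega (N : nat) : R :=
  \sum_(k < p) modulus_const (S k) (Cm k) h * (expR (h / N%:R * mxmod (S k)) - 1).

Fact omega_term_ge0 N k :
  0 <= modulus_const (S k) (Cm k) h * (expR (h / N%:R * mxmod (S k)) - 1).
Proof.
rewrite mulr_ge0 ?subr_ge0 -?[X in X <= _]expR0 ?ler_expR //.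
  by rewrite /modulus_const !mulr_ge0 ?mxmod_ge0 ?expR_ge0.
by rewrite mulr_ge0 ?mxmod_ge0 // divr_ge0 // ltW.
Qed.

Lemma omega_ge0 N : 0 <= omega N.
Proof. by apply: sumr_ge0 => k _; exact: omega_term_ge0. Qed.

Lemma omega_cvg0 : omega N.+1 @[N --> \oo] --> 0.
Proof.
rewrite [X in _ --> X](_ : 0 = \sum_(k < p) 0 :> R); last by rewrite big1.
apply: cvgn_sum => k.
rewrite [X in _ --> X](_ : 0 = modulus_const (S k) (Cm k) h * (expR (h * 0 * mxmod (S k)) - 1)); last first.
  by rewrite mulr0 mul0r expR0 subrr mulr0.
apply: cvgM; first exact: cvg_cst.
apply: cvgB; last exact: cvg_cst.
apply: (@continuous_cvg _ _ _ _ _ _ (@expR R)); first exact: continuous_expR.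
apply: cvgM; last exact: cvg_cst.
by apply: cvgM; [exact: cvg_cst | exact: cvg_harmonic].
Qed.

Lemma phi_modulus N r j a b : (0 < N)%N -> (0 < r)%N -> (j < N * r)%N ->
  modc ((phi N (j %/ r) - phi (N * r) j) a b) <= omega N.
Proof.
move=> N0 r0 jNr.
have NR : 0 < N%:R :> R by rewrite ltr0n.
have g1 : gridpt h N (j %/ r) <= gridpt h (N * r) j.
  rewrite -(gridpt_refine h N (j %/ r) r0); apply: gridpt_le => //.
  exact: leq_trunc_div.
have g2 : gridpt h (N * r) j <= gridpt h N (j %/ r).+1.
  rewrite -(gridpt_refine h N _ r0); apply: gridpt_le => //.
  by rewrite ltnW // -ltn_divLR.
have g3 : gridpt h N (j %/ r).+1 - gridpt h N (j %/ r) = h / N%:R.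
  by rewrite /gridpt -natr1 mulrDl mul1r addrAC subrr add0r.
have g0 : 0 <= gridpt h N (j %/ r).
  by rewrite /gridpt mulr_ge0 // divr_ge0 // ltW.
have g4 : gridpt h (N * r) j <= h.
  have NrR : 0 < (N * r)%:R :> R by rewrite ltr0n muln_gt0 N0.
  rewrite /gridpt mulrCA ler_piMr ?(ltW h_gt0) // ler_pdivrMr // mul1r ler_nat.
  exact: ltnW.
set k := tagnat.sig1 a.
have -> : (phi N (j %/ r) - phi (N * r) j) a b =
    (expm ((h - gridpt h N (j %/ r))%:C *: S k) *m Cm k -
     expm ((h - gridpt h (N * r) j)%:C *: S k) *m Cm k) (tagnat.sig2 a) b.
  by rewrite !mxBE; congr (_ - _); rewrite /phi /integrand [LHS]mxE.
apply: le_trans (@expm_mul_modulus _ _ _ _ _ h _ _ (h / N%:R) _ _ _ _ _ _) _.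
- by rewrite subr_ge0.
- by rewrite lerD2l lerN2.
- by rewrite gerDl oppr_le0.
- by rewrite opprB addrC addrA subrK -g3 lerD2r.
rewrite /omega (bigD1 k) //= lerDl sumr_ge0 // => l _.
exact: omega_term_ge0.
Qed.

End Integrand.

(** * Uniform sums in mean square *)

Section GridApproximation.
Context (disp : measure_display) (T : measurableType disp) (R : realType).
Variable P : probability T R.
Local Notation C := R[i].
Variables (m : nat) (L : R -> T -> 'cV[R]_m).
Hypothesis hL : levy_process P L.
Hypothesis hL2 : ('E_P[fun w => (\sum_(i < m) (L 1 w i 0) ^+ 2)%R] < +oo)%E.
Hypothesis hL1 : forall i : 'I_m, ('E_P[fun w => L 1%R w i 0%R] = 0)%E.
Variables (h : R) (h_gt0 : 0 < h).

Lemma modcMn (z : C) k : modc (z *+ k) = k%:R * modc z.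
Proof.
have RM l : complex.Re (z *+ l) = complex.Re z *+ l.
  by elim: l => [//|l IH]; rewrite !mulrS cReD IH.
have IM l : complex.Im (z *+ l) = complex.Im z *+ l.
  by elim: l => [//|l IH]; rewrite !mulrS cImD IH.
by rewrite /modc RM IM !normrMn -mulrnDl mulr_natl.
Qed.

(** For fixed N the differences X (N.+1 * r.+1).-1 - X N, bounded by b N in mean
    square, converge in probability to W - X N as r grows, so that W - X N obeys
    the same bound up to a factor 2 (sqint_tends_in_prob). *)
Lemma refinement_l2cvg (X : nat -> T -> R) (W : T -> R) (b : nat -> R) :
  (forall N, sqint P (X N)) -> measurable_fun setT W -> tends_in_prob P X W ->
  (forall N r, ip P (fun w => X (N.+1 * r.+1).-1 w - X N w)
                    (fun w => X (N.+1 * r.+1).-1 w - X N w) <= b N) ->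
  b N @[N --> \oo] --> 0 -> l2cvg P X W.
Proof.
move=> sX mW cX Xb b0.
have [sD bD] : (forall N, sqint P (fun w => W w - X N w)) /\
    (forall N, ip P (fun w => W w - X N w) (fun w => W w - X N w) <= 2 * b N).
  have key N : sqint P (fun w => W w - X N w) /\
    ip P (fun w => W w - X N w) (fun w => W w - X N w) <= 2 * b N.
    apply: (sqint_tends_in_prob
      (Zn := fun r w => X (N.+1 * r.+1).-1 w - X N w)) => //.
    - by move=> r; exact: sqintB.
    - by apply: measurable_funB => //; have [] := sX N.
    - move=> e e0; have [N0 H] := cX _ e0; exists N0 => r Nr.
      have le : (N0 <= (N.+1 * r.+1).-1)%N.
        by rewrite -ltnS prednK ?muln_gt0 // (leq_trans _ (leq_pmull _ _)).
      move: (H _ le); congr (P _ <= _)%E.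
      by apply/seteqP; split => w /=; rewrite opprB addrA subrK.
  by split => N; have [] := key N.
have sW : sqint P W.
  have := sqintD (sD 0%N) (sX 0%N).
  by rewrite (_ : (fun w => _) = W) //; apply/funext => w; rewrite subrK.
split => //.
apply: (@squeeze_cvgr _ _ _ _ (fun=> 0) (fun N => 2 * b N)); last 2 first.
- exact: cvg_cst.
- by rewrite -[X in _ --> X](mulr0 2); apply: cvgM => //; exact: cvg_cst.
apply: nearW => N; rewrite ip_ge0 /=; apply: le_trans (bD N).
rewrite le_eqVlt; apply/orP; left; apply/eqP; rewrite /ip; congr fine.
by apply: eq_integral => w _; rewrite -opprB mulrNN.
Qed.

Lemma modc_sandwich a k (A : 'M[C]_(a, k)) (G : 'M[C]_k) (e : R) i :
  0 <= e -> (forall l, modc (A i l) <= e) ->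
  modc ((A *m G *m adjmx A) i i) <= e ^+ 2 * mxmod G.
Proof.
move=> e0 Ae; rewrite mxE; apply: le_trans (modc_sum _ _ _) _.
rewrite /mxmod exchange_big /= mulr_sumr; apply: ler_sum => l _.
apply: le_trans (modcM _ _) _; rewrite mxE.
apply: (@le_trans _ _ ((\sum_k0 e * modc (G k0 l)) * e)).
  apply: ler_pM; rewrite ?modc_ge0 //.
    apply: le_trans (modc_sum _ _ _) _; apply: ler_sum => l' _.
    apply: le_trans (modcM _ _) _; by rewrite ler_wpM2r ?modc_ge0.
  by rewrite mxE (_ : modc (conjc (A i l)) = modc (A i l)) // /modc; case: (A i l) => x y /=; rewrite normrN.
by rewrite -mulr_sumr mulrAC expr2.
Qed.

(** The bound does not involve the number M of pieces, because the covariances of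
    the increments over the pieces add up to the covariance over [0, h]. *)
Lemma gridsum_small D n M (phi : nat -> 'M[C]_(D, m)) (e : R) a : (0 < M)%N -> 0 <= e ->
  (forall j b, (j < M)%N -> modc (phi j a b) <= e) ->
  let Z := fun w => gridsum L h n M phi w a 0 in
  ip P (fun w => complex.Re (Z w)) (fun w => complex.Re (Z w)) <=
    e ^+ 2 * mxmod (cov P (dL L 0 h) (dL L 0 h)) /\
  ip P (fun w => complex.Im (Z w)) (fun w => complex.Im (Z w)) <=
    e ^+ 2 * mxmod (cov P (dL L 0 h) (dL L 0 h)).
Proof.
move=> M0 e0 pe Z.
have cE : cip P Z Z = (cov P (gridsum L h n M phi) (gridsum L h n M phi)) a a.
  by rewrite mxE.
have le : complex.Re (cip P Z Z) <= e ^+ 2 * mxmod (cov P (dL L 0 h) (dL L 0 h)).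
  rewrite cE (cov_gridsum hL hL2 hL1 h_gt0) eqxx summxE.
  set G := cov_step P L h M.
  have -> : mxmod (cov P (dL L 0 h) (dL L 0 h)) = M%:R * mxmod G.
    rewrite (cov_stepM hL hL2 hL1 h_gt0 M0) -/G /mxmod mulr_sumr; apply: eq_bigr => i _.
    rewrite mulr_sumr; apply: eq_bigr => j _; rewrite mulmxnE.
    exact: modcMn.
  apply: (@le_trans _ _ (modc (\sum_(0 <= i < M) (phi i *m G *m adjmx (phi i)) a a))).
    by rewrite /modc (le_trans (ler_norm _)) // lerDl.
  apply: le_trans (modc_sum _ _ _) _.
  apply: (@le_trans _ _ (\sum_(0 <= i < M) e ^+ 2 * mxmod G)).
    rewrite big_nat [X in _ <= X]big_nat; apply: ler_sum => j /andP[_ jM].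
    by apply: modc_sandwich => // l; exact: pe.
  by rewrite sumr_const_nat subn0 mulrCA mulr_natl.
have i1 := ip_ge0 P (fun w => complex.Re (Z w)).
have i2 := ip_ge0 P (fun w => complex.Im (Z w)).
by split; apply: le_trans le; rewrite /cip /= ?lerDl ?lerDr.
Qed.

Lemma gridsumB D n M (phi psi : nat -> 'M[C]_(D, m)) w :
  gridsum L h n M (fun j => phi j - psi j) w = gridsum L h n M phi w - gridsum L h n M psi w.
Proof. by rewrite /gridsum -sumrB; apply: eq_bigr => j _; rewrite mulmxBl. Qed.

Variables (d p : nat) (S : 'I_p -> 'M[C]_d) (Cm : 'I_p -> 'M[C]_(d, m)).
Local Notation phi := (phi S Cm h).
Local Notation omega := (omega S Cm h).

(* N + 1 pieces, so that the partition is never empty. *)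
Definition approx n N := gridsum L h n N.+1 (phi N.+1).

Lemma approx_refine n N r a :
  let Z := fun w => (approx n (N.+1 * r.+1).-1 w a 0 - approx n N w a 0) in
  ip P (fun w => complex.Re (Z w)) (fun w => complex.Re (Z w)) <=
    omega N.+1 ^+ 2 * mxmod (cov P (dL L 0 h) (dL L 0 h)) /\
  ip P (fun w => complex.Im (Z w)) (fun w => complex.Im (Z w)) <=
    omega N.+1 ^+ 2 * mxmod (cov P (dL L 0 h) (dL L 0 h)).
Proof.
pose M := (N.+1 * r.+1)%N.
have M0 : (0 < M)%N by rewrite muln_gt0.
have -> : (fun w => approx n M.-1 w a 0 - approx n N w a 0) =
  (fun w => gridsum L h n M (fun j => phi M j - phi N.+1 (j %/ r.+1)%N) w a 0).
  apply/funext => w; rewrite gridsumB /approx prednK //.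
  by rewrite (gridsum_refine L h n N.+1 (phi N.+1) w (ltn0Sn r)) mxBE.
apply: gridsum_small => // [|j b jM].
  exact: omega_ge0.
rewrite -opprB mxE (_ : modc (- _) = modc ((phi N.+1 (j %/ r.+1)%N - phi M j) a b)).
  exact: phi_modulus.
by rewrite /modc cReN cImN !normrN.
Qed.

(** Here the bound for the refinements is a multiple of the square of omega. *)
Lemma approx_l2cvg n (W : T -> 'cV[C]_(\sum_(k < p) d)) :
  (forall a, measurable_fun setT (fun w => complex.Re (W w a 0))) ->
  (forall a, measurable_fun setT (fun w => complex.Im (W w a 0))) ->
  (forall a, tends_in_prob P (fun N w => complex.Re (approx n N w a 0)) (fun w => complex.Re (W w a 0))) ->
  (forall a, tends_in_prob P (fun N w => complex.Im (approx n N w a 0)) (fun w => complex.Im (W w a 0))) ->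
  l2cvg_vec P (approx n) W.
Proof.
move=> mR mI cR cI a.
set G := mxmod (cov P (dL L 0 h) (dL L 0 h)).
have b0 : omega N.+1 ^+ 2 * G @[N --> \oo] --> 0.
  rewrite [X in _ --> X](_ : 0 = 0 * 0 * G); last by rewrite !mul0r.
  by apply: cvgM; [apply: cvgM; exact: omega_cvg0 | exact: cvg_cst].
have sa N : sqint_vec P (approx n N) by exact: (sqint_gridsum hL hL2 hL1 h_gt0).
split.
  apply: (refinement_l2cvg _ (mR a) (cR a) _ b0) => N; first by have [] := sa N a.
  move=> r; have [+ _] := approx_refine n N r a.
  by under eq_fun do rewrite cReD cReN.
apply: (refinement_l2cvg _ (mI a) (cI a) _ b0) => N; first by have [] := sa N a.
move=> r; have [_ +] := approx_refine n N r a.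
by under eq_fun do rewrite cImD cImN.
Qed.

End GridApproximation.

(** * Limits in probability of vectors *)

Section VectorConvergenceInProbability.
Context (disp : measure_display) (T : measurableType disp) (R : realType).
Variable P : probability T R.
Local Notation C := R[i].

Lemma crandomD n (U W : T -> 'cV[C]_n) : crandom_vector U -> crandom_vector W ->
  crandom_vector (fun w => U w + W w).
Proof.
move=> mU mW i; have [u1 u2] := mU i; have [w1 w2] := mW i.
split.
  by under eq_fun do rewrite mxE cReD; exact: measurable_funD.
by under eq_fun do rewrite mxE cImD; exact: measurable_funD.
Qed.

Lemma crandomM n k (M : 'M[C]_(k, n)) (U : T -> 'cV[C]_n) : crandom_vector U ->
  crandom_vector (fun w => M *m U w).
Proof.
move=> mU i; split.
  under eq_fun do rewrite mxE Re_sum.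
  apply: measurable_sum => j; have [u1 u2] := mU j.
  by under eq_fun do rewrite cReM; apply: measurable_funB; exact: measurable_funM.
under eq_fun do rewrite mxE Im_sum.
apply: measurable_sum => j; have [u1 u2] := mU j.
by under eq_fun do rewrite cImM; apply: measurable_funD; exact: measurable_funM.
Qed.

(** Measurability is part of the convergence, so that sums and matrix products
    carry no side conditions. *)
Definition vtends_in_prob n (Xs : nat -> T -> 'cV[C]_n) (X : T -> 'cV[C]_n) : Prop :=
  [/\ forall N, crandom_vector (Xs N), crandom_vector X &
    forall i,
      tends_in_prob P (fun N w => complex.Re (Xs N w i 0)) (fun w => complex.Re (X w i 0)) /\
      tends_in_prob P (fun N w => complex.Im (Xs N w i 0)) (fun w => complex.Im (X w i 0))].

Fact tends_in_prob_ext (Xs Ys : nat -> T -> R) (X Y : T -> R) :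
  (forall N w, Xs N w = Ys N w) -> (forall w, X w = Y w) ->
  tends_in_prob P Xs X -> tends_in_prob P Ys Y.
Proof.
move=> XY xy; suff -> : Xs = Ys by suff -> : X = Y by []; apply/funext.
by apply/funext => N; apply/funext => w.
Qed.

Lemma vtends_in_probD n (Us Ws : nat -> T -> 'cV[C]_n) U W :
  vtends_in_prob Us U -> vtends_in_prob Ws W ->
  vtends_in_prob (fun N w => Us N w + Ws N w) (fun w => U w + W w).
Proof.
move=> [mUs mU cU] [mWs mW cW]; split; first by move=> N; exact: crandomD.
  exact: crandomD.
move=> i; have [u1 u2] := cU i; have [w1 w2] := cW i; split.
  apply: (tends_in_prob_ext _ _ (tends_in_probD _ _ _ _ u1 w1)).
  - by move=> N w; rewrite mxE cReD.
  - by move=> w; rewrite mxE cReD.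
  - by move=> N; have [] := mUs N i.
  - by move=> N; have [] := mWs N i.
  - by have [] := mU i.
  - by have [] := mW i.
apply: (tends_in_prob_ext _ _ (tends_in_probD _ _ _ _ u2 w2)).
- by move=> N w; rewrite mxE cImD.
- by move=> w; rewrite mxE cImD.
- by move=> N; have [] := mUs N i.
- by move=> N; have [] := mWs N i.
- by have [] := mU i.
- by have [] := mW i.
Qed.

Lemma vtends_in_probM n k (M : 'M[C]_(k, n)) (Us : nat -> T -> 'cV[C]_n) U :
  vtends_in_prob Us U ->
  vtends_in_prob (fun N w => M *m Us N w) (fun w => M *m U w).
Proof.
move=> [mUs mU cU]; split; first by move=> N; exact: crandomM.
  exact: crandomM.
have mR N j : measurable_fun setT (fun w => complex.Re (Us N w j 0)) by have [] := mUs N j.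
have mI N j : measurable_fun setT (fun w => complex.Im (Us N w j 0)) by have [] := mUs N j.
have nR j : measurable_fun setT (fun w => complex.Re (U w j 0)) by have [] := mU j.
have nI j : measurable_fun setT (fun w => complex.Im (U w j 0)) by have [] := mU j.
have lin (a b : 'I_n -> R) : tends_in_prob P
    (fun N w => \sum_j (a j * complex.Re (Us N w j 0) + b j * complex.Im (Us N w j 0)))
    (fun w => \sum_j (a j * complex.Re (U w j 0) + b j * complex.Im (U w j 0))).
  apply: (@tends_in_prob_sum _ _ _ P _ _
    (fun j N w => a j * complex.Re (Us N w j 0) + b j * complex.Im (Us N w j 0))
    (fun j w => a j * complex.Re (U w j 0) + b j * complex.Im (U w j 0))).
  - by move=> j N; apply: measurable_funD; apply: measurable_funM.
  - by move=> j; apply: measurable_funD; apply: measurable_funM.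
  move=> j; have [c1 c2] := cU j.
  apply: tends_in_probD; try (by move=> N; apply: measurable_funM); try exact: measurable_funM.
    exact: tends_in_probZ.
  exact: tends_in_probZ.
move=> i; split.
  apply: (tends_in_prob_ext _ _
    (lin (fun j => complex.Re (M i j)) (fun j => - complex.Im (M i j)))) => [N|] w;
  by rewrite mxE Re_sum; apply: eq_bigr => j _; rewrite cReM mulNr.
apply: (tends_in_prob_ext _ _
  (lin (fun j => complex.Im (M i j)) (fun j => complex.Re (M i j)))) => [N|] w;
by rewrite mxE Im_sum; apply: eq_bigr => j _; rewrite cImM addrC.
Qed.

Lemma tends_in_prob_ae (Xs : nat -> T -> R) (X Y : T -> R) :
  (forall N, measurable_fun setT (Xs N)) -> measurable_fun setT X -> measurable_fun setT Y ->
  {ae P, forall w, X w = Y w} -> tends_in_prob P Xs X -> tends_in_prob P Xs Y.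
Proof.
move=> mXs mX mY [A [mA A0 XY]] cX e e0; have [N H] := cX _ e0; exists N => n Nn.
have m1 : measurable [set w | e <= `|Xs n w - X w|].
  by apply: measurable_norm_ge; exact: measurable_funB.
have m2 : measurable [set w | e <= `|Xs n w - Y w|].
  by apply: measurable_norm_ge; exact: measurable_funB.
apply: le_trans (H _ Nn); rewrite -[leRHS]adde0 -A0.
apply: le_trans (measureU2 _ m1 mA); apply: le_measure; rewrite ?inE //.
  exact: measurableU.
move=> w /= ew; have [xy|xy] := pselect (X w = Y w); first by left; rewrite /= xy.
by right; exact: XY.
Qed.

Lemma vtends_in_prob_ae n (Xs : nat -> T -> 'cV[C]_n) (X Y : T -> 'cV[C]_n) :
  crandom_vector Y -> {ae P, forall w, X w = Y w} ->
  vtends_in_prob Xs X -> vtends_in_prob Xs Y.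
Proof.
move=> mY XY [mXs mX cX]; split => // i; have [c1 c2] := cX i.
have [x1 x2] := mX i; have [y1 y2] := mY i.
split.
  apply: tends_in_prob_ae c1 => //; first by move=> N; have [] := mXs N i.
  by move: XY; apply: filterS => w ->.
apply: tends_in_prob_ae c2 => //; first by move=> N; have [] := mXs N i.
by move: XY; apply: filterS => w ->.
Qed.

Lemma normr_coord_le n (v : 'cV[C]_n) i :
  `|complex.Re (v i 0)| <= Num.sqrt (cvec_normsq v) /\
  `|complex.Im (v i 0)| <= Num.sqrt (cvec_normsq v).
Proof.
have le : complex.Re (v i 0) ^+ 2 + complex.Im (v i 0) ^+ 2 <= cvec_normsq v.
  rewrite /cvec_normsq (bigD1 i) //= lerDl sumr_ge0 // => j _.
  by rewrite addr_ge0 ?sqr_ge0.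
have n0 : 0 <= cvec_normsq v by apply: le_trans le; rewrite addr_ge0 ?sqr_ge0.
split; rewrite -sqrtr_sqr ler_psqrt ?nnegrE ?sqr_ge0 //; apply: le_trans le.
  by rewrite lerDl sqr_ge0.
by rewrite lerDr sqr_ge0.
Qed.

Lemma measurable_norm_event n (U : T -> 'cV[C]_n) (e : R) : 0 < e -> crandom_vector U ->
  measurable [set w | e <= Num.sqrt (cvec_normsq (U w))].
Proof.
move=> e0 mU; have mN : measurable_fun setT (fun w => cvec_normsq (U w)).
  apply: measurable_sum => i; have [u1 u2] := mU i.
  by apply: measurable_funD; exact: measurable_funX.
have -> : [set w | e <= Num.sqrt (cvec_normsq (U w))] =
    [set w | e ^+ 2 <= `|cvec_normsq (U w)|].
  have n0 w : 0 <= cvec_normsq (U w).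
    by apply: sumr_ge0 => i _; rewrite addr_ge0 ?sqr_ge0.
  apply/seteqP; split => w /=; rewrite ger0_norm //.
    by move=> H; rewrite -(sqr_sqrtr (n0 w)) ler_sqr // nnegrE ?sqrtr_ge0 ?ltW.
  by move=> H; rewrite -(ler_sqr (ltW e0 : e \in Num.nneg)) ?nnegrE ?sqrtr_ge0 // sqr_sqrtr.
exact: measurable_norm_ge.
Qed.

Lemma vtends_in_prob_norm n (Xs : nat -> T -> 'cV[C]_n) X :
  (forall N, crandom_vector (Xs N)) -> crandom_vector X ->
  (forall e : R, 0 < e -> exists N0, forall N, (N0 <= N)%N ->
     (P [set w | (e <= Num.sqrt (cvec_normsq (Xs N w - X w)))%R] <= e%:E)%E) ->
  vtends_in_prob Xs X.
Proof.
move=> mXs mX cX; split => // i; have [x1 x2] := mX i.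
have mD N : crandom_vector (fun w => Xs N w - X w).
  move=> j; have [a1 a2] := mXs N j; have [b1 b2] := mX j; split.
    under eq_fun do rewrite !mxE cReD cReN.
    exact: measurable_funB.
  under eq_fun do rewrite !mxE cImD cImN.
  exact: measurable_funB.
split => e e0; have [N0 H] := cX _ e0; exists N0 => N /H; apply: le_trans;
  have [a1 a2] := mXs N i; apply: le_measure; rewrite ?inE.
- by apply: measurable_norm_ge; exact: measurable_funB.
- exact: measurable_norm_event.
- move=> w /= /le_trans; apply.
  by have [+ _] := normr_coord_le (Xs N w - X w) i; rewrite !mxE cReD cReN.
- by apply: measurable_norm_ge; exact: measurable_funB.
- exact: measurable_norm_event.
move=> w /= /le_trans; apply.
by have [_ +] := normr_coord_le (Xs N w - X w) i; rewrite !mxE cImD cImN.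
Qed.

End VectorConvergenceInProbability.

(** * The noise of the sampled process *)

Section ProcessNoise.
Context (disp : measure_display) (T : measurableType disp) (R : realType).
Variable P : probability T R.
Local Notation C := R[i].
Variables (m : nat) (L : R -> T -> 'cV[R]_m).
Hypothesis hL : levy_process P L.
Hypothesis hL2 : ('E_P[fun w => (\sum_(i < m) (L 1 w i 0) ^+ 2)%R] < +oo)%E.
Hypothesis hL1 : forall i : 'I_m, ('E_P[fun w => L 1%R w i 0%R] = 0)%E.
Variables (h : R) (h_gt0 : 0 < h).

Definition grid (M K : nat) : seq R := [seq gridpt h M i.+1 | i <- iota 0 K].

Lemma nth_grid M K i : (i < K)%N -> nth 0 (grid M K) i = gridpt h M i.+1.
Proof. by move=> iK; rewrite (nth_map 0%N) ?size_iota // nth_iota. Qed.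

Lemma nth_grid_left M K i : (i < K)%N -> nth 0 (0 :: grid M K) i = gridpt h M i.
Proof.
case: i => [|i] iK /=; first by rewrite /gridpt mul0r.
by rewrite nth_grid // ltnW.
Qed.

Lemma gridpt_end n M j : gridpt h M.+1 (n * M.+1 + j) = n%:R * h + gridpt h M.+1 j.
Proof.
rewrite /gridpt natrD mulrDl; congr (_ + _); rewrite natrM.
by rewrite -mulrA; congr (_ * _); rewrite mulrC divfK // pnatr_eq0.
Qed.

Lemma grid_partition n M : itv_partition 0 (n%:R * h) (grid M.+1 (n * M.+1)).
Proof.
have step i : gridpt h M.+1 i < gridpt h M.+1 i.+1.
  by rewrite /gridpt ltr_pM2r ?ltr_nat // divr_gt0 // ltr0n.
split.
  have -> : (0 : R) = gridpt h M.+1 0 by rewrite /gridpt mul0r.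
  rewrite /grid; move: (n * M.+1)%N (0%N) => K; elim: K => //= K IH i.
  by rewrite step IH.
apply/eqP; rewrite -(nth_last 0) /= size_map size_iota.
have [->|n0] := posnP n; first by rewrite mul0n /= mul0r.
have K0 : (0 < n * M.+1)%N by rewrite muln_gt0 n0.
rewrite (set_nth_default 0) ?size_map ?size_iota ?prednK // nth_grid ?prednK //.
by have := gridpt_end n M 0; rewrite addn0 => ->; rewrite /gridpt mul0r addr0.
Qed.

Lemma left_sum_grid d (f : R -> 'M[C]_(d, m)) M K w :
  left_sum L f 0 (grid M K) w = \sum_(0 <= i < K) f (gridpt h M i) *m dLgrid L h M i w.
Proof.
rewrite /left_sum size_map size_iota big_mkord; apply: eq_bigr => i _.
by rewrite nth_grid // nth_grid_left.
Qed.

Lemma left_sum_step d (E : 'M[C]_d) (f f' g : R -> 'M[C]_(d, m)) n M w :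
  (forall u, E *m f u = f' u) -> (forall u, f' (n%:R * h + u) = g u) ->
  left_sum L f' 0 (grid M.+1 (n.+1 * M.+1)) w -
    E *m left_sum L f 0 (grid M.+1 (n * M.+1)) w =
  gridsum L h n M.+1 (fun j => g (gridpt h M.+1 j)) w.
Proof.
move=> Ef fg; rewrite (left_sum_grid f') (left_sum_grid f) mulmx_sumr.
rewrite (@big_cat_nat _ _ _ (n * M.+1)) ?leq_mul2r ?leqnSn ?orbT //=.
rewrite [X in (X + _) - _](_ : _ = \sum_(0 <= i < n * M.+1)
    E *m (f (gridpt h M.+1 i) *m dLgrid L h M.+1 i w)); last first.
  by apply: eq_bigr => i _; rewrite mulmxA Ef.
rewrite addrAC subrr add0r mulSn -{1}[(n * _)%N]add0n big_addn addnK /gridsum.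
by apply: eq_bigr => j _; rewrite addnC gridpt_end fg.
Qed.

Lemma expm_step d (S : 'M[C]_d) n u :
  expm (h%:C *: S) *m expm ((n%:R * h - u)%:C *: S) = expm ((n.+1%:R * h - u)%:C *: S).
Proof.
rewrite expmD; congr expm; congr (_ *: _); rewrite -rmorphD; congr (_%:C).
by rewrite -natr1 mulrDl mul1r addrCA addrA.
Qed.

Lemma crandom_left_sum d (f : R -> 'M[C]_(d, m)) M K : crandom_vector (left_sum L f 0 (grid M K)).
Proof.
have -> : left_sum L f 0 (grid M K) =
    fun w => \sum_(0 <= i < K) f (gridpt h M i) *m dLgrid L h M i w.
  by apply/funext => w; rewrite left_sum_grid.
have s1 : sqint_vec P (@one_vec _ T R) by exact: sqint_vec_cst.
apply: (sqint_vec_crandom (P := P) _).1.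
apply: (cov_suml _ (W := @one_vec _ T R) _ s1).1 => i.
by apply: sqint_vecM; exact: (sqint_dLgrid hL hL2 hL1).
Qed.

Lemma left_sum_vtends d (f : R -> 'M[C]_(d, m)) n J :
  is_stoch_integral P L f 0 (n%:R * h) J ->
  vtends_in_prob P (fun M => left_sum L f 0 (grid M.+1 (n * M.+1))) J.
Proof.
move=> [mJ cJ]; apply: vtends_in_prob_norm => // [M|e e0]; first exact: crandom_left_sum.
have [delta d0 H] := cJ _ e0.
pose N0 := (Num.truncn (h / delta)).+1; exists N0 => N NN; apply: H.
  exact: grid_partition.
move=> i; rewrite size_map size_iota => iK.
rewrite nth_grid // nth_grid_left // /gridpt -natr1 mulrDl mul1r addrAC subrr add0r.
rewrite ltr_pdivrMr ?ltr0n // mulrC -ltr_pdivrMr //.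
apply: lt_le_trans (_ : _ < N0%:R) _; first exact: truncnS_gt.
by rewrite ler_nat ltnW.
Qed.

Variables (d p : nat) (S : 'I_p -> 'M[C]_d) (Cm : 'I_p -> 'M[C]_(d, m)).
Variable Y : 'I_p -> R -> T -> 'cV[C]_d.
Hypothesis hY : forall k, mcarma_component P L (S k) (Cm k) (Y k).

(** The part of a component that its exponential propagation over one step leaves
    unexplained. *)
Definition noise_comp k n (w : T) : 'cV[C]_d :=
  Y k (n.+1%:R * h) w - expm (h%:C *: S k) *m Y k (n%:R * h) w.

Definition noise n (w : T) : 'cV[C]_(\sum_(k < p) d) := \mxcol_(k < p) noise_comp k n w.

(** The stochastic integrals at two consecutive sampling times, the earlier one
    propagated by one step, differ by an integral over the step in between, and
    so do their left sums. *)
Lemma noise_comp_vtends k n : vtends_in_prob P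
  (fun M => gridsum L h n M.+1 (fun j => expm ((h - gridpt h M.+1 j)%:C *: S k) *m Cm k))
  (noise_comp k n).
Proof.
have t0 l : 0 <= l%:R * h by rewrite mulr_ge0 // ltW.
have [mY1 [J1 iJ1 Y1]] := hY k (t0 n.+1); have [mY0 [J0 iJ0 Y0]] := hY k (t0 n).
pose g u := expm ((h - u)%:C *: S k) *m Cm k.
pose f (l : nat) u := expm ((l%:R * h - u)%:C *: S k) *m Cm k.
have c1 := left_sum_vtends iJ1; have c0 := left_sum_vtends iJ0.
have f_step u : expm (h%:C *: S k) *m f n u = f n.+1 u.
  exact: etrans (mulmxA _ _ _) (congr1 (mulmx^~ (Cm k)) (expm_step (S k) n u)).
have fg u : f n.+1 (n%:R * h + u) = g u.
  have e : n.+1%:R * h - (n%:R * h + u) = h - u.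
    by rewrite -natr1 mulrDl mul1r opprD addrACA subrr add0r.
  exact: (congr1 (fun x => expm (x%:C *: S k) *m Cm k) e).
have c := vtends_in_probD c1 (vtends_in_probM (- expm (h%:C *: S k)) c0).
have mW : crandom_vector (noise_comp k n).
  have -> : noise_comp k n = fun w => Y k (n.+1%:R * h) w +
      (- expm (h%:C *: S k)) *m Y k (n%:R * h) w.
    by apply/funext => w; rewrite mulNmx.
  by apply: crandomD => //; exact: crandomM.
apply: vtends_in_prob_ae mW _ _; last first.
  rewrite (_ : (fun M => gridsum _ _ _ _ _) = (fun M w =>
     left_sum L (f n.+1) 0 (grid M.+1 (n.+1 * M.+1)) w +
     (- expm (h%:C *: S k)) *m left_sum L (f n) 0 (grid M.+1 (n * M.+1)) w)); first exact: c.
  apply/funext => M; apply/funext => w; rewrite mulNmx.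
  exact: esym (left_sum_step M w f_step fg).
have st := expm_step (S k) n 0; rewrite !subr0 in st.
move: Y1 Y0; apply: filterS2 => w e1 e0.
rewrite /noise_comp e1 e0 -st.
move: (expm _) (expm _) (Y k 0 w) => E E' y.
by rewrite mulmxDr mulmxA mulNmx opprD addrACA subrr add0r.
Qed.

Lemma noise_l2cvg n : l2cvg_vec P (approx L h S Cm n) (noise n).
Proof.
have aE a N w : approx L h S Cm n N w a 0 =
    gridsum L h n N.+1 (fun j => expm ((h - gridpt h N.+1 j)%:C *: S (tagnat.sig1 a)) *m
      Cm (tagnat.sig1 a)) w (tagnat.sig2 a) 0.
  rewrite /approx /gridsum !summxE; apply: eq_bigr => j _.
  rewrite !mxE; apply: eq_bigr => l _; congr (_ * _).
  by rewrite [LHS]mxE.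
have nE a w : noise n w a 0 = noise_comp (tagnat.sig1 a) n w (tagnat.sig2 a) 0.
  by rewrite [LHS]mxE.
have key (a : 'I_(\sum_(k < p) d)) := noise_comp_vtends (tagnat.sig1 a) n.
apply: (approx_l2cvg hL hL2 hL1 h_gt0) => a; have [_ m1 c1] := key a.
- by under eq_fun do rewrite nE; have [] := m1 (tagnat.sig2 a).
- by under eq_fun do rewrite nE; have [] := m1 (tagnat.sig2 a).
- have [c2 _] := c1 (tagnat.sig2 a).
  by apply: tends_in_prob_ext c2 => [N|] w; rewrite ?aE ?nE.
have [_ c2] := c1 (tagnat.sig2 a).
by apply: tends_in_prob_ext c2 => [N|] w; rewrite ?aE ?nE.
Qed.

Lemma sqint_noise n : sqint_vec P (noise n).
Proof. exact: l2cvg_vec_sqint (noise_l2cvg n). Qed.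

Fact sqint_zero a : sqint_vec P (fun=> (0 : 'cV[C]_a)).
Proof. exact: sqint_vec_cst. Qed.

Lemma noise_mean n : cov P (noise n) (@one_vec _ T R) = 0.
Proof.
have s1 : sqint_vec P (@one_vec _ T R) by exact: sqint_vec_cst.
have c1 := l2cvg_vec_cst s1; have c0 := l2cvg_vec_cst (@sqint_zero (\sum_(k < p) d)).
rewrite -[RHS](cov_cst0l P _ (@one_vec _ T R)).
apply: (cov_limit_eq (noise_l2cvg n) c1 c0 c1) => N.
by rewrite (cov_gridsum_mean hL hL2 hL1) // cov_cst0l.
Qed.

Lemma noise_uncorrelated n n' : n != n' -> cov P (noise n) (noise n') = 0.
Proof.
move=> nn; have c0 := l2cvg_vec_cst (@sqint_zero (\sum_(k < p) d)).
rewrite -[RHS](cov_cst0l P _ (fun=> (0 : 'cV[C]_(\sum_(k < p) d)))).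
apply: (cov_limit_eq (noise_l2cvg n) (noise_l2cvg n') c0 c0) => N.
by rewrite (cov_gridsum hL hL2 hL1) // (negbTE nn) cov_cst0l.
Qed.

Lemma noise_stationary n : cov P (noise n) (noise n) = cov P (noise 0) (noise 0).
Proof.
apply: (cov_limit_eq (noise_l2cvg n) (noise_l2cvg n) (noise_l2cvg 0) (noise_l2cvg 0)) => N.
by rewrite !(cov_gridsum hL hL2 hL1) // !eqxx.
Qed.

(** Meant for linear functionals U of the increments before time 0. *)
Lemma noise_past n D (U : T -> 'cV[C]_D) : sqint_vec P U ->
  (forall s t : R, 0 <= s -> s <= t -> cov P (dL L s t) U = 0) -> cov P (noise n) U = 0.
Proof.
move=> sU U0; have cU := l2cvg_vec_cst sU.
have c0 := l2cvg_vec_cst (@sqint_zero (\sum_(k < p) d)).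
rewrite -[RHS](cov_cst0l P _ U).
apply: (cov_limit_eq (noise_l2cvg n) cU c0 cU) => N.
rewrite (cov_gridsum_past hL hL2 hL1) // ?cov_cst0l // => k.
apply: U0; last exact: gridpt_le.
by rewrite mulr_ge0 // divr_ge0 // ltW.
Qed.

Lemma noise_degenerate : cov P (dL L 0 h) (dL L 0 h) = 0 -> cov P (noise 0) (noise 0) = 0.
Proof.
move=> G0; have c0 := l2cvg_vec_cst (@sqint_zero (\sum_(k < p) d)).
rewrite -[RHS](cov_cst0l P _ (fun=> (0 : 'cV[C]_(\sum_(k < p) d)))).
apply: (cov_limit_eq (noise_l2cvg 0) (noise_l2cvg 0) c0 c0) => N.
rewrite (cov_gridsum hL hL2 hL1) // eqxx cov_cst0l; apply: big1 => j _.
have /eqP := cov_stepM hL hL2 hL1 h_gt0 (ltn0Sn N); rewrite G0 eq_sym.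
have -> : cov_step P L h N.+1 *+ N.+1 = (N.+1%:R : C) *: cov_step P L h N.+1.
  by rewrite scaler_nat.
by rewrite scaler_eq0 pnatr_eq0 /= => /eqP ->; rewrite mulmx0 mul0mx.
Qed.

End ProcessNoise.

(** * The autoregression of the samples *)

Lemma sum_triangle (V : zmodType) (F : nat -> nat -> V) n :
  \sum_(0 <= j < n.+1) \sum_(0 <= i < j) F i j =
  \sum_(0 <= i < n) \sum_(i.+1 <= j < n.+1) F i j.
Proof.
elim: n => [|n IH]; first by rewrite big_nat1 !big_geq.
rewrite big_nat_recr //= IH [in RHS]big_nat_recr //= [X in _ = _ + X]big_nat1.
rewrite [X in _ + X = _]big_nat_recr //= addrA; congr (_ + _).
rewrite -big_split /=; apply: eq_big_nat => i /andP[_ ilt].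
by rewrite [RHS]big_nat_recr //= ltnS ltnW.
Qed.

Section SampledAutoregression.
Variables (R : realType) (d p : nat).
Local Notation C := R[i].
Hypothesis p_gt0 : (0 < p)%N.
Implicit Types Z : 'I_p -> 'M[C]_d.

Lemma mxrow_vandermonde a Z (g : nat -> 'M[C]_(a, d)) :
  (\mxrow_(i < p) g i) *m vandermonde Z = \mxrow_(k < p) \sum_(i < p) g i *m Z k ^+ i.
Proof. by rewrite /vandermonde mul_mxrow_mxblock. Qed.

(** The constant coefficient of the annihilating polynomial is invertible: a row
    that kills it would give, after division by the invertible Z k, a nonzero
    combination of the rows of the Vandermonde matrix that vanishes. *)
Lemma annihilator_unit Z (g : nat -> 'M[C]_d) :
  (forall k, Z k \in unitmx) -> vandermonde Z \in unitmx ->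
  (forall k, \sum_(i < p) g i *m Z k ^+ i + Z k ^+ p = 0) -> g 0%N \in unitmx.
Proof.
move=> Zu Vu gZ; rewrite -row_free_unit; apply: inj_row_free => v v0.
pose r (i : nat) : 'rV[C]_d := if i == p.-1 then v else v *m g i.+1.
have lastE (G : nat -> 'rV[C]_d) :
    \sum_(0 <= i < p) G i = \sum_(0 <= i < p.-1) G i + G p.-1.
  by rewrite -{1}(prednK p_gt0) big_nat_recr.
have headE (G : nat -> 'rV[C]_d) :
    \sum_(0 <= i < p) G i = G 0%N + \sum_(0 <= i < p.-1) G i.+1.
  by rewrite -{1}(prednK p_gt0) big_nat_recl.
have rZ k : \sum_(i < p) r i *m Z k ^+ i = 0.
  have : (\sum_(i < p) r i *m Z k ^+ i) *m Z k = 0.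
    have := congr1 (mulmx v) (gZ k); rewrite mulmxDr mulmx0 mulmx_sumr => E; rewrite -[RHS]E.
    rewrite -(big_mkord xpredT (fun i => r i *m Z k ^+ i)).
    rewrite -(big_mkord xpredT (fun i => v *m (g i *m Z k ^+ i))).
    rewrite lastE headE mulmxA v0 mul0mx add0r mulmxDl {2}/r eqxx; congr (_ + _).
      rewrite mulmx_suml; apply: eq_big_nat => i /andP[_ ip].
      by rewrite /r ltn_eqF // exprSr -!mulmxA.
    by rewrite -mulmxA -[Z k ^+ p.-1 *m Z k]/(Z k ^+ p.-1 * Z k) -exprSr prednK.
  by move/(congr1 (mulmx^~ (invmx (Z k)))); rewrite mulmxK // mul0mx.
have : (\mxrow_(i < p) r i) *m vandermonde Z = 0.
  by rewrite mxrow_vandermonde; under eq_mxrow do rewrite rZ; rewrite mxrow0.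
move/(congr1 (mulmx^~ (invmx (vandermonde Z)))); rewrite mulmxK // mul0mx => r0.
have pp : (p.-1 < p)%N by rewrite prednK.
have := congr1 (fun M => submxrow M (Ordinal pp)) r0.
by rewrite mxrowK /r /= eqxx => ->; apply/matrixP => i j; rewrite !mxE.
Qed.

Variables (S : 'I_p -> 'M[C]_d) (h : R).
Local Notation Z := (fun k => expm ((- h)%:C *: S k)).

Lemma expmMn (M : 'M[C]_d) (x : R) n : expm ((n%:R * x)%:C *: M) = expm (x%:C *: M) ^+ n.
Proof.
elim: n => [|n IH]; first by rewrite mul0r expm0 expr0.
rewrite exprSr -IH -[RHS]/(_ *m _) expmD -rmorphD.
by rewrite -natr1 mulrDl mul1r.
Qed.

Lemma expm_inv (M : 'M[C]_d) : expm ((- h)%:C *: M) *m expm (h%:C *: M) = 1%:M.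
Proof. by rewrite expmD -rmorphD addNr expm0. Qed.

Lemma expm_unit (M : 'M[C]_d) : expm ((- h)%:C *: M) \in unitmx.
Proof. exact: (proj1 (mulmx1_unit (expm_inv M))). Qed.

Hypothesis hV : sampled_vandermonde S h \in unitmx.

Lemma Psi_block (i : 'I_p) : Psi S h (p - i) = submxrow (Psi_row S h) i.
Proof.
rewrite /Psi subn_eq0 leqNgt ltn_ord /= subKn; last exact: ltnW.
by rewrite (valK i).
Qed.

(** The equation that defines the coefficients: each Z k is a right solvent of the
    monic matrix polynomial with coefficients Psi. *)
Lemma Psi_annihilator k : \sum_(i < p) Psi S h (p - i) *m Z k ^+ i + Z k ^+ p = 0.
Proof.
have e : Psi_row S h *m vandermonde Z = - \mxrow_(k < p) (Z k ^+ p).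
  rewrite /Psi_row mulNmx mulmxKV //; congr (- _); apply: eq_mxrow => l.
  by rewrite -mulrN expmMn.
have : (\mxrow_(i < p) Psi S h (p - i)) *m vandermonde Z = - \mxrow_(k < p) (Z k ^+ p).
  by rewrite -e; congr (_ *m _); rewrite -[RHS]submxrowK; apply: eq_mxrow => i; exact: Psi_block.
rewrite (mxrow_vandermonde Z (fun i => Psi S h (p - i))) -mxrowN.
by move/eq_mxrowP/(_ k) => ->; rewrite addNr.
Qed.

Lemma Psi_unit : Psi S h p \in unitmx.
Proof.
have := @annihilator_unit Z (fun i => Psi S h (p - i)) (fun k => expm_unit (S k)) hV
  Psi_annihilator.
by rewrite subn0.
Qed.

Lemma Phi_coefE j : (j <= p)%N -> Phi_coef S h j = invmx (Psi S h p) *m Psi S h (p - j).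
Proof.
move=> jp; rewrite /Phi_coef; case: eqP => [->|_]; last by rewrite /Phi opprK.
by rewrite subn0 mulVmx // Psi_unit.
Qed.

Lemma Phi_annihilator k : \sum_(j < p.+1) Phi_coef S h j *m Z k ^+ j = 0.
Proof.
rewrite big_ord_recr /= Phi_coefE // subnn -[Psi S h 0]/(1%:M : 'M[C]_d) mulmx1.
under eq_bigr => j _ do rewrite Phi_coefE 1?ltnW // -mulmxA.
by rewrite -mulmx_sumr -mulmxDr Psi_annihilator mulmx0.
Qed.

(** Coefficient of the noise at lag i, once each y (n - j) is written in terms of
    y n and of the noise in between. *)
Definition noise_coef i : 'M[C]_(d, \sum_(k < p) d) :=
  \mxrow_(k < p) - \sum_(i.+1 <= j < p.+1) Phi_coef S h j *m Z k ^+ (j - i).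

Lemma backward_recursion (E E' : 'M[C]_d) (y e : nat -> 'cV[C]_d) n j : E' *m E = 1%:M ->
  (forall l, e l = y l.+1 - E *m y l) -> (j <= n)%N ->
  y (n - j)%N = E' ^+ j *m y n - \sum_(0 <= i < j) E' ^+ (j - i) *m e (n - i.+1)%N.
Proof.
move=> EE ey; elim: j => [|j IH] jn.
  by rewrite subn0 expr0 mul1mx big_geq // subr0.
have -> : y (n - j.+1)%N = E' *m y (n - j)%N - E' *m e (n - j.+1)%N.
  rewrite ey mulmxBr mulmxA EE mul1mx.
  by rewrite -subSn // subSS opprB addrC subrK.
rewrite IH 1?ltnW // mulmxBr mulmxA -addrA -opprD exprS; congr (_ - _).
rewrite big_nat_recr //= subSnn expr1; congr (_ + _).
rewrite mulmx_sumr; apply: eq_big_nat => i /andP[_ ij].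
by rewrite mulmxA subSn 1?ltnW // exprS.
Qed.

(** After the backward recursion the terms in y k n cancel by Phi_annihilator, for
    every k at once; what remains is noise. *)
Lemma sampled_autoregression (T : Type) (y : 'I_p -> nat -> T -> 'cV[C]_d) n w : (p <= n)%N ->
  backshift_poly p (Phi_coef S h) (fun l w => \sum_(k < p) y k l w) n w =
  \sum_(i < p) noise_coef i *m
    \mxcol_(k < p) (y k (n - i.+1).+1 w - expm (h%:C *: S k) *m y k (n - i.+1)%N w).
Proof.
move=> pn; rewrite /backshift_poly; under eq_bigr do rewrite mulmx_sumr.
rewrite exchange_big /=.
under [RHS]eq_bigr do rewrite /noise_coef mul_mxrow_mxcol.
rewrite [RHS]exchange_big /=; apply: eq_bigr => k _.
pose e l := y k l.+1 w - expm (h%:C *: S k) *m y k l w.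
have rec j := @backward_recursion _ _ (fun l => y k l w) e n j (expm_inv (S k)) (fun=> erefl).
transitivity (\sum_(0 <= j < p.+1) \sum_(0 <= i < j)
    - (Phi_coef S h j *m Z k ^+ (j - i) *m e (n - i.+1)%N)).
  rewrite big_mkord -[RHS]add0r -[X in _ = X + _](mul0mx _ (y k n w)) -(Phi_annihilator k).
  rewrite mulmx_suml -big_split /=; apply: eq_bigr => j _.
  rewrite rec; last by rewrite (leq_trans _ pn) // -ltnS.
  rewrite mulmxBr mulmxA mulmx_sumr -sumrN; congr (_ + _).
  by apply: eq_bigr => i _; rewrite mulmxA.
transitivity (\sum_(0 <= i < p) \sum_(i.+1 <= j < p.+1)
    - (Phi_coef S h j *m Z k ^+ (j - i) *m e (n - i.+1)%N)).
  exact: sum_triangle.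
rewrite big_mkord; apply: eq_bigr => i _.
by rewrite mulNmx mulmx_suml sumrN.
Qed.

End SampledAutoregression.

(** * State space realization *)

Section ShiftRealization.
Variables (R : realType) (p D a : nat).
Local Notation C := R[i].
Variable M : nat -> 'M[C]_(a, D).

(** The state stacks the last p noise vectors: the transition shifts them down by
    one block, the input enters at the top, and the output combines them. *)
Definition shift_mx : 'M[C]_(\sum_(i < p) D) :=
  \mxblock_(i < p, j < p) (if i == j.+1 :> nat then 1%:M else 0 : 'M[C]_D).

Definition input_mx : 'M[C]_(\sum_(i < p) D, D) :=
  \mxcol_(i < p) (if i == 0%N :> nat then 1%:M else 0 : 'M[C]_D).

Definition output_mx : 'M[C]_(a, \sum_(i < p) D) := \mxrow_(i < p) M i.

Fact sum_delta_mx b (k : nat)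
    (G : 'I_p -> 'M[C]_(b, D)) (g : 'M[C]_(b, D)) :
  (forall j : 'I_p, j = k :> nat -> G j = g) -> ((k < p)%N = false -> g = 0) ->
  \sum_(j < p) G j *m (if j == k :> nat then 1%:M else 0) = g.
Proof.
move=> Gg g0; have [kp|kp] := boolP (k < p)%N.
  rewrite (bigD1 (Ordinal kp)) //= eqxx mulmx1 big1 ?addr0 => [|j jk]; first exact: Gg.
  by rewrite ifN ?mulmx0.
rewrite g0 ?(negbTE kp) // big1 // => j _; rewrite ifN ?mulmx0 //.
by apply: contraNneq kp => <-.
Qed.

Lemma shift_mx_pow k : shift_mx ^+ k.+1 =
  \mxblock_(i < p, j < p) (if i == (j + k.+1)%N :> nat then 1%:M else 0 : 'M[C]_D).
Proof.
elim: k => [|k IH].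
  by rewrite expr1; apply: eq_mxblock => i j; rewrite addn1.
rewrite exprSr {}IH -[LHS]/(_ *m shift_mx) /shift_mx mul_mxblock.
apply: eq_mxblock => i j.
apply: (@sum_delta_mx _ j.+1) => [l ->|].
  by rewrite addSnnS.
move=> jp; rewrite ifN //; apply/eqP => e.
have := ltn_ord i; rewrite e -addSnnS => /(leq_ltn_trans (leq_addr _ _)).
by rewrite jp.
Qed.

Lemma shift_mx_nilpotent : (0 < p)%N -> shift_mx ^+ p = 0.
Proof.
move=> p0; have := shift_mx_pow p.-1; rewrite prednK // => ->; rewrite -mxblock0.
apply: eq_mxblock => i j; rewrite ifN //.
by rewrite neq_ltn (leq_trans (ltn_ord i)) // leq_addl.
Qed.

Lemma realization_output i : (i < p)%N -> output_mx *m shift_mx ^+ i *m input_mx = M i.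
Proof.
move=> ip; case: i ip => [|i] ip.
  rewrite expr0 mulmx1 /output_mx /input_mx mul_mxrow_mxcol.
  by apply: (@sum_delta_mx _ 0%N) => [j ->|]; rewrite ?ip.
rewrite shift_mx_pow /output_mx mul_mxrow_mxblock /input_mx mul_mxrow_mxcol.
apply: (@sum_delta_mx _ 0%N) => [j j0|]; last by rewrite (leq_ltn_trans _ ip).
rewrite j0 add0n.
by apply: (@sum_delta_mx _ i.+1) => [l ->|]; rewrite ?ip.
Qed.

(** The stationary covariance of the state, a finite sum because the shift is
    nilpotent. *)
Definition state_cov (Q : 'M[C]_(\sum_(i < p) D)) : 'M[C]_(\sum_(i < p) D) :=
  \sum_(0 <= j < p) shift_mx ^+ j *m Q *m adjmx (shift_mx ^+ j).

Lemma psd_state_cov Q : psd Q -> psd (state_cov Q).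
Proof. by move=> pQ; apply: psd_sum => j; exact: psd_congr. Qed.

Lemma state_cov0 : state_cov 0 = 0.
Proof. by apply: big1 => j _; rewrite mulmx0 mul0mx. Qed.

Lemma state_cov_stationary Q : (0 < p)%N ->
  state_cov Q = shift_mx *m state_cov Q *m adjmx shift_mx + Q.
Proof.
move=> p0; rewrite /state_cov mulmx_sumr mulmx_suml.
have E j : shift_mx *m (shift_mx ^+ j *m Q *m adjmx (shift_mx ^+ j)) *m adjmx shift_mx =
    shift_mx ^+ j.+1 *m Q *m adjmx (shift_mx ^+ j.+1).
  by rewrite exprS -[_ * _]/(_ *m _) adjmx_mul !mulmxA.
rewrite [in RHS](eq_bigr _ (fun j _ => E j)).
have e0 : shift_mx ^+ p *m Q *m adjmx (shift_mx ^+ p) = 0.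
  by rewrite shift_mx_nilpotent // !mul0mx.
have eQ : Q = shift_mx ^+ 0 *m Q *m adjmx (shift_mx ^+ 0).
  by rewrite expr0 mul1mx adjmx1 mulmx1.
rewrite addrC [in X in _ = X + _]eQ.
rewrite -(big_nat_recl _ _ (fun j => shift_mx ^+ j *m Q *m adjmx (shift_mx ^+ j))) //.
by rewrite big_nat_recr //= e0 addr0.
Qed.

End ShiftRealization.

(** * The initial prediction error *)

Section InitialError.
Context (disp : measure_display) (T : measurableType disp) (R : realType).
Variable P : probability T R.
Local Notation C := R[i].
Variables (m : nat) (L : R -> T -> 'cV[R]_m).
Hypothesis hL : levy_process P L.
Hypothesis hL2 : ('E_P[fun w => (\sum_(i < m) (L 1 w i 0) ^+ 2)%R] < +oo)%E.
Hypothesis hL1 : forall i : 'I_m, ('E_P[fun w => L 1%R w i 0%R] = 0)%E.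

(** Increments of one coordinate over the unit intervals to the left of 0: a
    source of uncorrelated variables that is independent of the future. *)
Definition past_increments N (i : 'I_m) (w : T) : 'cV[C]_N :=
  \col_(k < N) (incr L (- k.+1%:R) (- k%:R) i w)%:C.

Fact past_le k : (- k.+1%:R : R) <= - k%:R.
Proof. by rewrite lerN2 ler_nat. Qed.

Fact past_incrementsE N i (k : 'I_N) :
  (fun w => past_increments N i w k 0) = (fun w => (incr L (- k.+1%:R) (- k%:R) i w)%:C).
Proof. by apply/funext => w; rewrite mxE. Qed.

Lemma sqint_past N i : sqint_vec P (past_increments N i).
Proof.
move=> k; rewrite past_incrementsE; split; last exact: sqint_cst.
exact: (sqint_incr hL hL2 hL1 i (past_le k)).
Qed.

Lemma cov_past N i : cov P (past_increments N i) (past_increments N i) =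
  (ip P (incr L 0 1 i) (incr L 0 1 i))%:C%:M.
Proof.
apply/matrixP => k l; rewrite !mxE !past_incrementsE cip_real.
have [<-|kl] := eqVneq k l.
  rewrite -(incr_ip_shift hL hL2 hL1 (- k.+1%:R) i i ler01) add0r.
  by rewrite -[k.+1%:R]natr1 opprD addrCA subrr addr0 -opprD natr1.
suff e (u v : nat) : (u < v)%N ->
    ip P (incr L (- v.+1%:R) (- v%:R) i) (incr L (- u.+1%:R) (- u%:R) i) = 0.
  have : (k < l)%N || (l < k)%N by rewrite -neq_ltn.
  by case/orP => lt; [rewrite ipC e | rewrite e].
by move=> uv; apply: (incr_uncorrelated hL hL2 hL1); rewrite ?past_le ?lerN2 ?ler_nat.
Qed.

Lemma cov_past_mean N i : cov P (past_increments N i) (@one_vec _ T R) = 0.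
Proof.
apply/matrixP => k j; rewrite !mxE past_incrementsE ord1.
rewrite (_ : (fun w : T => one_vec R w 0 0) = fun=> 1%:C); last by apply/funext => w; rewrite mxE.
by rewrite cip_real -/(mean P _) (incr_mean0 hL hL2 hL1 i (past_le k)) mxE.
Qed.

Lemma cov_future_past N i s t : 0 <= s -> s <= t ->
  cov P (dL L s t) (past_increments N i) = 0.
Proof.
move=> s0 st; apply/matrixP => j k; rewrite !mxE dL_fun past_incrementsE cip_real.
rewrite ipC (incr_uncorrelated hL hL2 hL1) ?past_le //.
by apply: le_trans s0; rewrite oppr_le0.
Qed.

Lemma degenerate_increments h : 0 <= h ->
  (forall i, ip P (incr L 0 1 i) (incr L 0 1 i) = 0) -> cov P (dL L 0 h) (dL L 0 h) = 0.
Proof.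
move=> h0 v0; have v1 i : ivar P L i 1 = 0.
  rewrite /ivar v0 sub0r /imean (incr_mean0 hL hL2 hL1) ?ler01 //.
  by rewrite expr0n oppr0.
have vh i : ip P (incr L 0 h i) (incr L 0 h i) = 0.
  have e : ip P (incr L 0 h i) (incr L 0 h i) = ivar P L i h.
    by rewrite /ivar /imean (incr_mean0 hL hL2 hL1) // expr0n subr0.
  rewrite e; apply: le_anti; rewrite (ivar_ge0 hL hL2 hL1) // andbT.
  have hn : h <= (Num.truncn h).+1%:R * 1 by rewrite mulr1 ltW ?truncnS_gt.
  apply: le_trans (ivar_le hL hL2 hL1 i h0 hn) _.
  by rewrite (ivarMn hL hL2 hL1) // v1 mulr0.
apply/matrixP => i j; rewrite !mxE !dL_fun cip_real.
have := ip_cauchy_schwarz (sqint_incr hL hL2 hL1 i h0) (sqint_incr hL hL2 hL1 j h0).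
rewrite !vh mulr0 => le0; congr (_%:C).
by apply/eqP; rewrite -sqrf_eq0; apply/eqP/le_anti; rewrite le0 sqr_ge0.
Qed.

(** A factor of Sg is applied to normalized past increments. *)
Lemma past_vector N (Sg : 'M[C]_N) (i : 'I_m) : psd Sg ->
  ip P (incr L 0 1 i) (incr L 0 1 i) != 0 ->
  exists U : T -> 'cV[C]_N, [/\ sqint_vec P U, cov P U (@one_vec _ T R) = 0,
    cov P U U = Sg & forall s t, 0 <= s -> s <= t -> cov P (dL L s t) U = 0].
Proof.
move=> /psd_factor[B ->]; set v := ip _ _ _ => v0.
have vp : 0 < v by rewrite lt_neqAle eq_sym v0 ip_ge0.
pose c := (Num.sqrt v)^-1; pose A := c%:C *: B.
have sp := @sqint_past N i; have s1 : sqint_vec P (@one_vec _ T R) by exact: sqint_vec_cst.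
exists (fun w => A *m past_increments N i w); split.
- exact: sqint_vecM.
- by rewrite covMl // cov_past_mean mulmx0.
- rewrite covMl ?covMr //; last exact: sqint_vecM.
  rewrite cov_past -/v /A adjmxZ mul_scalar_mx -scalemxAl -!scalemxAr !scalerA.
  have -> : conjc c%:C = c%:C by rewrite /= oppr0.
  rewrite -!rmorphM /= (_ : c * _ = 1) ?scale1r //.
  rewrite /c; have sv : Num.sqrt v != 0 by rewrite sqrtr_eq0 -ltNge.
  by rewrite mulrC -[X in X * _ * _](sqr_sqrtr (ltW vp)) expr2 mulfK // mulfV.
- move=> s t s0 st; rewrite covMr ?cov_future_past ?mul0mx //.
  by apply: (sqint_dL hL hL2 hL1).
Qed.

End InitialError.

(** * The weak VARMA representation *)

Theorem theorem3p8 (R : realType) (disp : measure_display)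
  (T : measurableType disp) (P : probability T R)
  (d m p q : nat) (hd : (0 < d)%N) (hm : (0 < m)%N)
  (hq : (0 < q)%N) (hqp : (q < p)%N)
  (L : R -> T -> 'cV[R]_m) (hL : levy_process P L)
  (hL2 : ('E_P[fun w => (\sum_(i < m) (L 1 w i 0) ^+ 2)%R] < +oo)%E)
  (hL1 : forall i : 'I_m, ('E_P[fun w => L 1%R w i 0%R] = 0)%E)
  (A : nat -> 'M[R]_d) (B : nat -> 'M[R]_(d, m))
  (hirr : left_coprime (ar_poly p A) (ma_poly q B))
  (S : 'I_p -> 'M[R[i]]_d)
  (hreg : forall k, regular_right_solvent p A (S k))
  (hcomplete : complete_solvents A S)
  (Yk : 'I_p -> R -> T -> 'cV[R[i]]_d)
  (hYk : forall k, mcarma_component P L (S k)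
           (residue (ar_poly p A) (ma_poly q B) (S k)) (Yk k))
  (hY0 : {ae P, forall w, exists x : 'cV[R]_(\sum_(k < p) d),
           vandermonde S *m (\mxcol_(k < p) Yk k 0 w) = toC x})
  (h : R) (hh : 0 < h)
  (hV : sampled_vandermonde S h \in unitmx) :
  let Y (t : R) (w : T) := \sum_(k < p) Yk k t w in
  let Yh (n : nat) := Y (n%:R * h) in
  exists (Theta : nat -> 'M[R[i]]_d) (eps : nat -> T -> 'cV[R[i]]_d),
    [/\ Theta 0%N = 1%:M,
        weak_white_noise P eps &
        forall n, (p <= n)%N ->
          {ae P, forall w, backshift_poly p (Phi_coef S h) Yh n w =
                           backshift_poly p.-1 Theta eps n w}].
Proof.
move=> Y Yh; have p0 : (0 < p)%N by exact: leq_ltn_trans hqp.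
pose N := (\sum_(k < p) d)%N.
pose W := noise h S Yk.
have sW n : sqint_vec P (W n) by exact: (sqint_noise hL hL2 hL1 hh hYk).
pose F := shift_mx R p N; pose G := input_mx R p N.
pose H := output_mx p (noise_coef S h).
pose Q := cov P (W 0%N) (W 0%N); pose Q' := G *m Q *m adjmx G.
have pQ' : psd Q' by apply: psd_congr; exact: psd_cov.
have [Sg [K [pS pPS gainK fixS]]] :=
  riccati_fixed_point H pQ' (psd_state_cov pQ') (state_cov_stationary Q' p0).
have [U [sU U1 UU UL]] : exists U : T -> 'cV[R[i]]_(\sum_(i < p) N),
    [/\ sqint_vec P U, cov P U (@one_vec _ T R) = 0, cov P U U = Sg &
        forall s t, 0 <= s -> s <= t -> cov P (dL L s t) U = 0].
  have [[i vi]|deg] := pselect (exists i, ip P (incr L 0 1 i) (incr L 0 1 i) != 0).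
    exact: (past_vector hL hL2 hL1 pS vi).
  (* All increments vanish in L^2, hence so does the noise, and the filter starts
     without error. *)
  have Q0 : Q = 0.
    apply: (noise_degenerate hL hL2 hL1 hh hYk).
    apply: (degenerate_increments hL hL2 hL1 (ltW hh)) => i.
    by apply/eqP; apply: contra_notT deg => vi; exists i.
  have S0 : Sg = 0.
    apply: psd_antisym; first by rewrite subr0.
    by move: pPS; rewrite /Q' Q0 mulmx0 mul0mx state_cov0.
  exists (fun=> 0); rewrite S0 !cov_cst0l; split => //; first exact: sqint_vec_cst.
  by move=> s t _ _; rewrite -cov_adj cov_cst0l adjmx0.
(* The n-th sample is driven by the noise over the step that ends at n h. *)
pose w n : T -> 'cV[R[i]]_(\sum_(i < p) N) :=
  if n is l.+1 then fun z => G *m W l z else U.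
have sw n : sqint_vec P (w n) by case: n => [|n] //=; exact: sqint_vecM.
have w1 n : cov P (w n) (@one_vec _ T R) = 0.
  have s1 : sqint_vec P (@one_vec _ T R) by exact: sqint_vec_cst.
  case: n => [|n] //=; rewrite covMl // (noise_mean hL hL2 hL1 hh hYk).
  by rewrite mulmx0.
have WU n : cov P (w n.+1) U = 0.
  by rewrite covMl // (noise_past hL hL2 hL1 hh hYk) ?mulmx0.
have ww n k : n != k -> cov P (w n) (w k) = 0.
  case: n k => [|n] [|k] //= nk.
  - by rewrite -cov_adj WU adjmx0.
  - exact: WU.
  rewrite covMl ?covMr //; last exact: sqint_vecM.
  by rewrite (noise_uncorrelated hL hL2 hL1 hh hYk) ?mul0mx ?mulmx0.
have wQ n : cov P (w n.+1) (w n.+1) = Q'.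
  rewrite /= covMl ?covMr //; last exact: sqint_vecM.
  by rewrite (noise_stationary hL hL2 hL1 hh hYk) mulmxA.
have Fp : F ^+ p = 0 by exact: shift_mx_nilpotent.
exists (ma_coef F H K), (innovation F H K w); split.
- by [].
- exact: (innovation_white gainK fixS sw w1 ww UU wQ).
move=> n pn; apply: aeW => z.
apply: etrans _ (innovation_representation H K p0 Fp w z pn).
apply: etrans (sampled_autoregression p0 hV (fun k l => Yk k (l%:R * h)) z pn) _.
apply: eq_bigr => i _.
have -> : (n - i)%N = (n - i.+1).+1 by rewrite -subSn // (leq_trans (ltn_ord i)).
by rewrite /w mulmxA realization_output.
Qed.
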